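(* Let $\tau$ be the $\theta$-twisted cyclic 2-cocycle on $\mathcal{O}(\mathrm{S}_q^2)$ given by $$\tau(a_0,a_1,a_2)=h\Big(a_0\big(q\,\partial_E(a_1)\partial_F(a_2)-q^{-1}\partial_F(a_1)\partial_E(a_2)\big)\Big).$$ The pairing of $[\tau]$ with $K_0^{\mathcal{U}_q(\mathrm{su}_2)}(\mathcal{O}(\mathrm{S}_q^2))$ is given by $$\langle[\tau],[P_N]\rangle=2[N]_q,\qquad N\in\mathbb{Z}.$$ In particular, $[\tau]=\frac{2}{q^{-1}-q}\,([\mathcal{S}h]-[\mathcal{S}\varepsilon])$ in $\mathrm{HC}^2_\theta(\mathcal{O}(\mathrm{S}_q^2))$.
   Context: Let $q>0$, $q\neq 1$, $[x]_q=\frac{q^x-q^{-x}}{q-q^{-1}}$. $\mathcal{U}_q(\mathrm{su}_2)$ is the Hopf *-algebra generated by $E,F,K,K^{-1}$ with $KK^{-1}=K^{-1}K=1$, $KE=qEK$, $FK=qKF$, $EF-FE=\frac{1}{q-q^{-1}}(K^2-K^{-2})$, $E^*=F$, $K^*=K$, $\Delta(E)=E\otimes K+K^{-1}\otimes E$, $\Delta(F)=F\otimes K+K^{-1}\otimes F$, $\Delta(K)=K\otimes K$, $\varepsilon(E)=\varepsilon(F)=\varepsilon(K-1)=0$, $S(K)=K^{-1}$, $S(E)=-qE$, $S(F)=-q^{-1}F$. $\mathcal{O}(\mathrm{SU}_q(2))$ is the coordinate Hopf *-algebra of quantum $\mathrm{SU}(2)$, generated by $a,b,c,d$ with $ab=qba$,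 $ac=qca$, $bd=qdb$, $cd=qdc$, $bc=cb$, $ad-da=(q-q^{-1})bc$, $ad-qbc=1$, $a^*=d$, $b^*=-qc$. It has the Peter-Weyl basis $t^l_{jk}$ ($l\in\frac12\mathbb{N}_0$, $j,k=-l,\dots,l$) of matrix elements of irreducible unitary corepresentations, with $t^{1/2}=\begin{pmatrix}a&b\\c&d\end{pmatrix}$ (indices $-\frac12,\frac12$), counit $\varepsilon(t^l_{jk})=\delta_{jk}$. The Haar state is $h(t^0_{00})=1$, $h(t^l_{jk})=0$ for $l>0$; $v^l_{jk}=[2l+1]_q^{1/2}q^jt^l_{jk}$ are orthonormal for $\langle x,y\rangle=h(x^*y)$. With $\alpha^l_j=([l-j]_q[l+j+1]_q)^{1/2}$, the left action is $E\triangleright v^l_{jk}=\alpha^l_kv^l_{j,k+1}$, $F\triangleright v^l_{jk}=\alpha^l_{k-1}v^l_{j,k-1}$, $K\triangleright v^l_{jk}=q^kv^l_{jk}$, and there is a commuting representation $f\mapsto\partial_f$ with $\partial_E(v^l_{jk})=-\alpha^l_{j-1}v^l_{j-1,k}$, $\partial_F(v^l_{jk})=-\alpha^l_jv^l_{j+1,k}$, $\partial_K(v^l_{jk})=q^{-j}v^l_{jk}$. The standard Podleś sphere is $\mathcal{O}(\mathrm{S}_q^2)=\{x:\partial_{K^2}(x)=x\}$. The restriction of $h$ to it has modular automorphism $\theta(y)=K^{-2}\triangleright y$, i.e. $h(xy)=h(\theta(y)x)$; $\varepsilon$ also denotes the restriction of the counit to $\mathcal{O}(\mathrm{S}_q^2)$.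 For $n\in\frac12\mathbb{Z}$, $l\in\{|n|,|n|+1,\dots\}$, let $\mathbf{t}^l_n=(t^l_{n,-l},\dots,t^l_{n,l})$ and $\mathbf{t}^{l*}_n$ its conjugate transpose (column). Let $\sigma_l(f)$ be the matrix with $f\triangleright v^l_{nk}=\sum_j\sigma_l(f)_{jk}v^l_{nj}$, $\rho_l^\circ(f)=\sigma_l(K^{-1}S(f)K)$, and $P_N:=\rho^\circ_{|N|/2}(K^{-1})\,\mathbf{t}^{|N|/2*}_{N/2}\,\mathbf{t}^{|N|/2}_{N/2}\,\rho^\circ_{|N|/2}(K)\in\mathrm{M}_{|N|+1\times|N|+1}(\mathcal{O}(\mathrm{S}_q^2))$. These (with $\rho^\circ_{|N|/2}$) are invariant projections whose classes $[P_N]$ generate the equivariant $K_0$-group $K_0^{\mathcal{U}_q(\mathrm{su}_2)}(\mathcal{O}(\mathrm{S}_q^2))$ (taken with respect to $\theta^{-1}$). A $\theta$-twisted cyclic $n$-cocycle is an $(n+1)$-linear form $\phi$ with $\phi(a_0,\dots,a_n)=(-1)^n\phi(\theta(a_n),a_0,\dots,a_{n-1})$ and $\sum_{j=0}^{n}(-1)^j\phi(a_0,\dots,a_ja_{j+1},\dots,a_{n+1})+(-1)^{n+1}\phi(\theta(a_{n+1})a_0,a_1,\dots,a_n)=0$; $\mathrm{HC}^n_\theta$ is the corresponding cohomology (cocycles modulo coboundaries of cyclic $(n-1)$-cochains). Pairing of a $\theta$-twisted cyclic $2n$-cocycle with an invariant projection $P\in \mathrm{M}_{m\times m}$ (with $\rho^\circ$):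 $\langle[\Phi],[P]\rangle=(-1)^n\frac{(2n)!}{n!}\Phi(\mathrm{Tr}_\theta(P^{\otimes(2n+1)}))$, where $\mathrm{Tr}_\theta(A_0\otimes\cdots\otimes A_r)=\sum\rho^\circ(K^{-2})_{j_{r+1},j_0}a^0_{j_0,j_1}\otimes\cdots\otimes a^r_{j_r,j_{r+1}}$. $\mathcal{S}:\mathrm{HC}^n_\theta\to\mathrm{HC}^{n+2}_\theta$ is Connes' periodicity operator; for $n=0$ it is $(\mathcal{S}\Phi)(a_0,a_1,a_2)=-\frac12\Phi(a_0a_1a_2)$. *)

(* Defs.v *)
From HB Require Import structures.
From mathcomp Require Import all_boot all_order all_algebra.
From mathcomp Require Import boolp reals exp.
From mathcomp Require Import complex.
Set Implicit Arguments.
Unset Strict Implicit.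
Unset Printing Implicit Defensive.
Import Order.TTheory GRing.Theory Num.Theory.
Local Open Scope ring_scope.
Local Open Scope complex_scope.

(* Unital associative algebras over a commutative ring given by generators and
   relations: [palg P] is the quotient of the formal terms in the generators by
   the least congruence containing the relations and the algebra axioms. *)

Section Terms.
Variable K : comNzRingType.

Inductive term (X : Type) : Type :=
  | Gen of X
  | Cst of K
  | Add of term X & term X
  | Mul of term X & term X.

Fixpoint eval (X : Type) (D : algType K) (g : X -> D) (s : term X) : D :=
  match s with
  | Gen x => g x
  | Cst c => c%:A
  | Add s1 s2 => eval g s1 + eval g s2
  | Mul s1 s2 => eval g s1 * eval g s2
  end.

Fixpoint term_map (X Y : Type) (f : X -> Y) (s : term X) : term Y :=
  match s with
  | Gen x => Gen (f x)
  | Cst c => Cst _ c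
  | Add s1 s2 => Add (term_map f s1) (term_map f s2)
  | Mul s1 s2 => Mul (term_map f s1) (term_map f s2)
  end.

Lemma eval_map X Y (D : algType K) (f : X -> Y) (g : Y -> D) s :
  eval g (term_map f s) = eval (g \o f) s.
Proof. by elim: s => //= s1 -> s2 ->. Qed.

(* The augmentation only serves to make the presented algebra nonzero. *)
Record presentation := Presentation {
  gens : Type;
  rels : term gens -> term gens -> Prop;
  aug : gens -> K^o;
  augP : forall s t, rels s t -> eval aug s = eval aug t }.

Inductive cong (P : presentation) : term (gens P) -> term (gens P) -> Prop :=
  | cong_rel s t : rels s t -> cong s t
  | cong_refl s : cong s s
  | cong_sym s t : cong s t -> cong t s
  | cong_trans s t u : cong s t -> cong t u -> cong s u
  | cong_add s s' t t' : cong s s' -> cong t t' -> cong (Add s t) (Add s' t')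
  | cong_mul s s' t t' : cong s s' -> cong t t' -> cong (Mul s t) (Mul s' t')
  | cong_addA s t u : cong (Add s (Add t u)) (Add (Add s t) u)
  | cong_addC s t : cong (Add s t) (Add t s)
  | cong_mulA s t u : cong (Mul s (Mul t u)) (Mul (Mul s t) u)
  | cong_mulDl s t u : cong (Mul (Add s t) u) (Add (Mul s u) (Mul t u))
  | cong_mulDr s t u : cong (Mul s (Add t u)) (Add (Mul s t) (Mul s u))
  | cong_add0 s : cong (Add (Cst _ 0) s) s
  | cong_mul0 s : cong (Mul (Cst _ 0) s) (Cst _ 0)
  | cong_mul1 s : cong (Mul (Cst _ 1) s) s
  | cong_cstD c d : cong (Cst _ (c + d)) (Add (Cst _ c) (Cst _ d))
  | cong_cstM c d : cong (Cst _ (c * d)) (Mul (Cst _ c) (Cst _ d))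
  | cong_cstC c s : cong (Mul (Cst _ c) s) (Mul s (Cst _ c)).

Record palg (P : presentation) : Type := Palg {
  pclass : term (gens P) -> Prop;
  pclassP : exists s, pclass = @cong P s }.

HB.instance Definition _ P := gen_eqMixin (palg P).
HB.instance Definition _ P := gen_choiceMixin (palg P).

Section Palg.
Variable P : presentation.
Implicit Types (s t u : term (gens P)) (x y z : palg P).

Definition pi s : palg P := Palg (ex_intro _ s erefl).
Definition rep x : term (gens P) := projT1 (cid (pclassP x)).

Lemma piP s t : pi s = pi t <-> cong s t.
Proof.
split=> [/(congr1 (@pclass P))/= st|st]; first by rewrite st; apply: cong_refl.
have st_eq : @cong P s = @cong P t.
  apply/funext => u; apply/propext; split; last exact: cong_trans.
  by apply: cong_trans; apply: cong_sym.
rewrite /pi; move: (ex_intro _ s _) (ex_intro _ t _) => /=.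
by rewrite st_eq => p1 p2; congr Palg; apply: Prop_irrelevance.
Qed.

Lemma repK x : pi (rep x) = x.
Proof.
rewrite /rep; case: cid => s /= xs; case: x xs => c cP /= c_s.
rewrite /pi; case: _ / (esym c_s) cP => cP; congr Palg.
exact: Prop_irrelevance.
Qed.

Lemma cong_rep s : cong (rep (pi s)) s.
Proof. by apply/piP; rewrite repK. Qed.

Lemma palg_ind (Q : palg P -> Prop) : (forall s, Q (pi s)) -> forall x, Q x.
Proof. by move=> Qpi x; rewrite -(repK x). Qed.

Definition padd x y := pi (Add (rep x) (rep y)).
Definition pmul x y := pi (Mul (rep x) (rep y)).
Definition pscale (c : K) x := pi (Mul (Cst _ c) (rep x)).
Definition popp x := pscale (-1) x.

Lemma pi_add s t : padd (pi s) (pi t) = pi (Add s t).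
Proof. by apply/piP/cong_add; apply: cong_rep. Qed.
Lemma pi_mul s t : pmul (pi s) (pi t) = pi (Mul s t).
Proof. by apply/piP/cong_mul; apply: cong_rep. Qed.
Lemma pi_scale c s : pscale c (pi s) = pi (Mul (Cst _ c) s).
Proof. by apply/piP/cong_mul; [apply: cong_refl|apply: cong_rep]. Qed.

Lemma paddA : associative padd.
Proof.
elim/palg_ind=> s; elim/palg_ind=> t; elim/palg_ind=> u.
by rewrite !pi_add; apply/piP/cong_addA.
Qed.
Lemma paddC : commutative padd.
Proof.
by elim/palg_ind=> s; elim/palg_ind=> t; rewrite !pi_add; apply/piP/cong_addC.
Qed.
Lemma padd0 : left_id (pi (Cst _ 0)) padd.
Proof. by elim/palg_ind=> s; rewrite pi_add; apply/piP/cong_add0. Qed.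
Lemma pmulA : associative pmul.
Proof.
elim/palg_ind=> s; elim/palg_ind=> t; elim/palg_ind=> u.
by rewrite !pi_mul; apply/piP/cong_mulA.
Qed.
Lemma pmul1 : left_id (pi (Cst _ 1)) pmul.
Proof. by elim/palg_ind=> s; rewrite pi_mul; apply/piP/cong_mul1. Qed.
Lemma pmulr1 : right_id (pi (Cst _ 1)) pmul.
Proof.
elim/palg_ind=> s; rewrite -[RHS]pmul1 !pi_mul.
exact/piP/cong_sym/cong_cstC.
Qed.
Lemma pmulDl : left_distributive pmul padd.
Proof.
elim/palg_ind=> s; elim/palg_ind=> t; elim/palg_ind=> u.
by rewrite !(pi_add, pi_mul); apply/piP/cong_mulDl.
Qed.
Lemma pmulDr : right_distributive pmul padd.
Proof.
elim/palg_ind=> s; elim/palg_ind=> t; elim/palg_ind=> u.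
by rewrite !(pi_add, pi_mul); apply/piP/cong_mulDr.
Qed.
Lemma pscaleE c x : pscale c x = pmul (pi (Cst _ c)) x.
Proof. by elim/palg_ind: x => s; rewrite pi_scale pi_mul. Qed.
Lemma pi_cstD c d : pi (Cst _ (c + d)) = padd (pi (Cst _ c)) (pi (Cst _ d)).
Proof. by rewrite pi_add; apply/piP/cong_cstD. Qed.
Lemma pi_cstM c d : pi (Cst _ (c * d)) = pmul (pi (Cst _ c)) (pi (Cst _ d)).
Proof. by rewrite pi_mul; apply/piP/cong_cstM. Qed.
Lemma pi_cstC c x : pmul (pi (Cst _ c)) x = pmul x (pi (Cst _ c)).
Proof. by elim/palg_ind: x => s; rewrite !pi_mul; apply/piP/cong_cstC. Qed.
Lemma paddN : left_inverse (pi (Cst _ 0)) popp padd.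
Proof.
move=> x; rewrite -{2}[x]pmul1 /popp pscaleE -pmulDl -pi_cstD addNr.
by elim/palg_ind: x => s; rewrite pi_mul; apply/piP/cong_mul0.
Qed.

Lemma cong_eval (D : algType K) (g : gens P -> D) :
    (forall s t, rels s t -> eval g s = eval g t) ->
  forall s t, cong s t -> eval g s = eval g t.
Proof.
move=> gP s t; elim=> //= {s t}.
- by move=> s t u _ -> _ ->.
- by move=> s s' t t' _ -> _ ->.
- by move=> s s' t t' _ -> _ ->.
- by move=> *; rewrite addrA.
- by move=> *; rewrite addrC.
- by move=> *; rewrite mulrA.
- by move=> *; rewrite mulrDl.
- by move=> *; rewrite mulrDr.
- by move=> *; rewrite scale0r add0r.
- by move=> *; rewrite !scale0r mul0r.
- by move=> *; rewrite scale1r mul1r.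
- by move=> *; rewrite scalerDl.
- by move=> *; rewrite -scalerAl mul1r scalerA.
- by move=> *; rewrite -scalerAl -scalerAr mul1r mulr1.
Qed.

Lemma pnontriv : pi (Cst _ 1) != pi (Cst _ 0).
Proof.
apply/eqP => /piP/(cong_eval (@augP P))/= /eqP.
by rewrite scale0r scale1r oner_eq0.
Qed.

HB.instance Definition _ := GRing.isNzRing.Build (palg P)
  paddA paddC padd0 paddN pmulA pmul1 pmulr1 pmulDl pmulDr pnontriv.

Lemma pscaleA a b x : pscale a (pscale b x) = pscale (a * b) x.
Proof. by rewrite !pscaleE pi_cstM pmulA. Qed.
Lemma pscale1 : left_id 1 pscale.
Proof. by move=> x; rewrite pscaleE pmul1. Qed.
Lemma pscaleDr : right_distributive pscale +%R.
Proof. by move=> a x y; rewrite !pscaleE pmulDr. Qed.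
Lemma pscaleDl x : {morph pscale^~ x : a b / a + b}.
Proof. by move=> a b /=; rewrite !pscaleE pi_cstD pmulDl. Qed.
HB.instance Definition _ := GRing.Zmodule_isLmodule.Build K (palg P)
  pscaleA pscale1 pscaleDr pscaleDl.

Lemma pscaleAl a x y : a *: (x * y) = (a *: x) * y.
Proof. by rewrite /GRing.scale/= !pscaleE; apply: pmulA. Qed.
HB.instance Definition _ := GRing.Lmodule_isLalgebra.Build K (palg P) pscaleAl.

Lemma pscaleAr a x y : a *: (x * y) = x * (a *: y).
Proof.
rewrite /GRing.scale/= !pscaleE.
by rewrite [LHS]pmulA pi_cstC -[LHS]pmulA.
Qed.
HB.instance Definition _ := GRing.Lalgebra_isAlgebra.Build K (palg P) pscaleAr.

Definition pgen (i : gens P) : palg P := pi (Gen i).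

Lemma piD s t : pi (Add s t) = pi s + pi t. Proof. by rewrite -pi_add. Qed.
Lemma piM s t : pi (Mul s t) = pi s * pi t. Proof. by rewrite -pi_mul. Qed.
Lemma piC c : pi (Cst _ c) = c%:A.
Proof. by rewrite /GRing.scale/= pscaleE pmulr1. Qed.

Lemma pi_eval s : pi s = eval pgen s.
Proof.
by elim: s => //= [c|s IHs t IHt|s IHs t IHt]; rewrite ?piC ?piD ?piM ?IHs ?IHt.
Qed.

Lemma palg_rel s t : rels s t -> eval pgen s = eval pgen t.
Proof. by move=> st; rewrite -!pi_eval; apply/piP/cong_rel. Qed.

Definition respects (D : algType K) (g : gens P -> D) :=
  forall s t, rels s t -> eval g s = eval g t.

Definition plift (D : algType K) (g : gens P -> D) (gP : respects g) x : D :=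
  eval g (rep x).

Section Lift.
Variables (D : algType K) (g : gens P -> D) (gP : respects g).

Lemma plift_pi s : plift gP (pi s) = eval g s.
Proof. exact/(cong_eval gP)/cong_rep. Qed.

Lemma plift_gen i : plift gP (pgen i) = g i.
Proof. exact: plift_pi. Qed.

Fact plift_linear : linear (plift gP).
Proof.
move=> c; elim/palg_ind=> s; elim/palg_ind=> t.
rewrite -[c *: pi s]mul1r -scalerAr scalerAl -piC -piM -piD !plift_pi /=.
by rewrite -scalerAl mul1r.
Qed.
HB.instance Definition _ :=
  GRing.isLinear.Build K (palg P) D _ (plift gP) plift_linear.
Fact plift_monoid : monoid_morphism (plift gP).
Proof.
split; first by rewrite [1]/(pi _) plift_pi /= scale1r.
by elim/palg_ind=> s; elim/palg_ind=> t; rewrite -piM !plift_pi.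
Qed.
HB.instance Definition _ :=
  GRing.isMonoidMorphism.Build (palg P) D (plift gP) plift_monoid.

Lemma plift_unique (f : {lrmorphism palg P -> D}) :
  (forall i, f (pgen i) = g i) -> f =1 plift gP.
Proof.
move=> fg; elim/palg_ind=> s; rewrite plift_pi pi_eval.
elim: s => /= [i|c|s <- t <-|s <- t <-].
- exact: fg.
- by rewrite linearZ rmorph1.
- by rewrite rmorphD.
- by rewrite rmorphM.
Qed.
End Lift.

(* Anti-multiplicative and [s]-semilinear extensions: antipodes ([s] the
   identity) and involutions ([s] the complex conjugation). *)
Section AntiLift.
Variables (s : {rmorphism K -> K}) (g : gens P -> palg P).

Fixpoint aeval (t : term (gens P)) : palg P :=
  match t with
  | Gen i => g i
  | Cst c => (s c)%:A
  | Add t1 t2 => aeval t1 + aeval t2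
  | Mul t1 t2 => aeval t2 * aeval t1
  end.

Definition arespects := forall t u, rels t u -> aeval t = aeval u.
Definition palift (gP : arespects) x : palg P := aeval (rep x).

Variable gP : arespects.
Lemma cong_aeval t u : cong t u -> aeval t = aeval u.
Proof.
elim=> //= {t u}.
- by move=> t u v _ -> _ ->.
- by move=> t t' u u' _ -> _ ->.
- by move=> t t' u u' _ -> _ ->.
- by move=> *; rewrite addrA.
- by move=> *; rewrite addrC.
- by move=> *; rewrite mulrA.
- by move=> *; rewrite mulrDr.
- by move=> *; rewrite mulrDl.
- by move=> *; rewrite rmorph0 scale0r add0r.
- by move=> *; rewrite rmorph0 !scale0r mulr0.
- by move=> *; rewrite rmorph1 scale1r mulr1.
- by move=> *; rewrite rmorphD scalerDl.
- by move=> *; rewrite -scalerAl mul1r scalerA rmorphM mulrC.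
- by move=> *; rewrite -scalerAl -scalerAr mul1r mulr1.
Qed.

Lemma palift_pi t : palift gP (pi t) = aeval t.
Proof. exact/cong_aeval/cong_rep. Qed.
Lemma palift_gen i : palift gP (pgen i) = g i.
Proof. exact: palift_pi. Qed.
Lemma paliftD x y : palift gP (x + y) = palift gP x + palift gP y.
Proof. by elim/palg_ind: x => t; elim/palg_ind: y => u; rewrite -piD !palift_pi. Qed.
Lemma paliftM x y : palift gP (x * y) = palift gP y * palift gP x.
Proof. by elim/palg_ind: x => t; elim/palg_ind: y => u; rewrite -piM !palift_pi. Qed.
Lemma paliftZ c x : palift gP (c *: x) = s c *: palift gP x.
Proof.
rewrite -[x in LHS]mul1r scalerAl paliftM -piC palift_pi /=.
by rewrite -scalerAr mulr1.
Qed.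
Lemma palift1 : palift gP 1 = 1.
Proof. by rewrite [1]/(pi _) palift_pi /= rmorph1 scale1r. Qed.
End AntiLift.
End Palg.

(* The algebra tensor product, presented by the generators of both factors,
   their relations, and the commutation of the two factors. *)
Section Tensor.
Variables P Q : presentation.

Inductive tens_rels :
    term (gens P + gens Q) -> term (gens P + gens Q) -> Prop :=
  | tens_rels_l s t : rels s t -> tens_rels (term_map inl s) (term_map inl t)
  | tens_rels_r s t : rels s t -> tens_rels (term_map inr s) (term_map inr t)
  | tens_rels_comm i j : tens_rels (Mul (Gen (inl i)) (Gen (inr j)))
                                   (Mul (Gen (inr j)) (Gen (inl i))).

Definition tens_aug (i : gens P + gens Q) : K^o :=
  match i with inl i => aug i | inr i => aug i end.

Fact tens_augP s t : tens_rels s t -> eval tens_aug s = eval tens_aug t.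
Proof.
case=> [s' t' st|s' t' st|i j]; rewrite ?eval_map; [| |exact: mulrC].
- exact: augP st.
- exact: augP st.
Qed.

Definition tens := Presentation tens_augP.

Definition tens_inl_gen (i : gens P) : palg tens := @pgen tens (inl i).
Definition tens_inr_gen (i : gens Q) : palg tens := @pgen tens (inr i).

Fact tens_inlP : respects tens_inl_gen.
Proof.
move=> s t st; have := @palg_rel tens _ _ (tens_rels_l st).
by rewrite !eval_map.
Qed.
Fact tens_inrP : respects tens_inr_gen.
Proof.
move=> s t st; have := @palg_rel tens _ _ (tens_rels_r st).
by rewrite !eval_map.
Qed.

Definition tensor (x : palg P) (y : palg Q) : palg tens :=
  plift tens_inlP x * plift tens_inrP y.

Lemma tens_comm x y : GRing.comm (plift tens_inlP x) (plift tens_inrP y).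
Proof.
elim/palg_ind: x => s; elim/palg_ind: y => t; rewrite !plift_pi.
elim: s => /= [i|c|s1 IH1 s2 IH2|s1 IH1 s2 IH2].
- elim: t => /= [j|c|t1 IH1 t2 IH2|t1 IH1 t2 IH2].
  + exact: (@palg_rel tens _ _ (tens_rels_comm i j)).
  + by rewrite /GRing.comm -scalerAl -scalerAr mul1r mulr1.
  + exact: commrD.
  + exact: commrM.
- by rewrite /GRing.comm -scalerAl -scalerAr mul1r mulr1.
- exact/commr_sym/commrD/commr_sym.
- apply/commr_sym; apply: commrM; exact/commr_sym.
Qed.

Lemma tensorM x1 x2 y1 y2 :
  tensor x1 y1 * tensor x2 y2 = tensor (x1 * x2) (y1 * y2).
Proof.
rewrite /tensor !rmorphM -!mulrA; congr (_ * _).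
by rewrite !mulrA (tens_comm x2 y1).
Qed.
Lemma tensorDl x1 x2 y : tensor (x1 + x2) y = tensor x1 y + tensor x2 y.
Proof. by rewrite /tensor rmorphD mulrDl. Qed.
Lemma tensorDr x y1 y2 : tensor x (y1 + y2) = tensor x y1 + tensor x y2.
Proof. by rewrite /tensor rmorphD mulrDr. Qed.
Lemma tensorZl c x y : tensor (c *: x) y = c *: tensor x y.
Proof. by rewrite /tensor linearZ -scalerAl. Qed.
Lemma tensorZr c x y : tensor x (c *: y) = c *: tensor x y.
Proof. by rewrite /tensor linearZ -scalerAr. Qed.
Lemma tensor11 : tensor 1 1 = 1.
Proof. by rewrite /tensor !rmorph1 mulr1. Qed.
End Tensor.
End Terms.

Declare Scope presentation_scope.
Delimit Scope presentation_scope with P.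
Notation "z %:T" := (Cst _ z) : presentation_scope.
Notation "s + t" := (Add s t) : presentation_scope.
Notation "s * t" := (Mul s t) : presentation_scope.
Notation "s - t" := (Add s (Mul (Cst _ (-1)) t)) : presentation_scope.

(* Equality of two sums up to associativity and commutativity. *)
Local Ltac acsum :=
  rewrite -?addrA;
  repeat match goal with
  | |- ?x = ?x => reflexivity
  | |- ?x + _ = _ =>
      rewrite ?[in RHS](addrC _ x) ?[in RHS](addrCA _ x);
      congr (_ + _)
  end.

Section SUq2Algebra.
Variables (R : realType) (q : R).
Local Notation C := R[i].

Inductive SU_gens := SUa | SUb | SUc | SUd.
Local Notation "''a'" := (Gen C SUa).
Local Notation "''b'" := (Gen C SUb).
Local Notation "''c'" := (Gen C SUc).
Local Notation "''d'" := (Gen C SUd).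

Inductive SU_rels : term C SU_gens -> term C SU_gens -> Prop :=
  | SU_ab : SU_rels ('a * 'b)%P ((q%:C)%:T * ('b * 'a))%P
  | SU_ac : SU_rels ('a * 'c)%P ((q%:C)%:T * ('c * 'a))%P
  | SU_bd : SU_rels ('b * 'd)%P ((q%:C)%:T * ('d * 'b))%P
  | SU_cd : SU_rels ('c * 'd)%P ((q%:C)%:T * ('d * 'c))%P
  | SU_bc : SU_rels ('b * 'c)%P ('c * 'b)%P
  | SU_ad : SU_rels ('a * 'd - 'd * 'a)%P (((q - q^-1)%:C)%:T * ('b * 'c))%P
  | SU_det : SU_rels ('a * 'd - (q%:C)%:T * ('b * 'c))%P (1%:T)%P.

Definition SU_aug (x : SU_gens) : C^o :=
  match x with SUa => 1 | SUb => 0 | SUc => 0 | SUd => 1 end.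

Fact SU_augP s t : SU_rels s t -> eval SU_aug s = eval SU_aug t.
Proof.
by case=> /=; rewrite !(mulr0, mul0r, mulr1, subr0) // /GRing.scale /=
   ?(mulr1, mulr0, addr0, subrr).
Qed.

Definition SU_pres : presentation C := Presentation SU_augP.
Local Notation A := (palg SU_pres).

Definition SU_a : A := @pgen _ SU_pres SUa.
Definition SU_b : A := @pgen _ SU_pres SUb.
Definition SU_c : A := @pgen _ SU_pres SUc.
Definition SU_d : A := @pgen _ SU_pres SUd.
Local Notation a := SU_a.
Local Notation b := SU_b.
Local Notation c := SU_c.
Local Notation d := SU_d.

Definition SU_counit : A -> C^o := plift (SU_augP : respects (P := SU_pres) SU_aug).

Lemma SUabE : a * b = q%:C *: (b * a).
Proof. by have := @palg_rel _ SU_pres _ _ SU_ab; rewrite /= -scalerAl mul1r. Qed.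
Lemma SUacE : a * c = q%:C *: (c * a).
Proof. by have := @palg_rel _ SU_pres _ _ SU_ac; rewrite /= -scalerAl mul1r. Qed.
Lemma SUbdE : b * d = q%:C *: (d * b).
Proof. by have := @palg_rel _ SU_pres _ _ SU_bd; rewrite /= -scalerAl mul1r. Qed.
Lemma SUcdE : c * d = q%:C *: (d * c).
Proof. by have := @palg_rel _ SU_pres _ _ SU_cd; rewrite /= -scalerAl mul1r. Qed.
Lemma SUbcC : b * c = c * b.
Proof. exact: (@palg_rel _ SU_pres _ _ SU_bc). Qed.
Lemma SUadE : a * d = 1 + q%:C *: (b * c).
Proof.
have := @palg_rel _ SU_pres _ _ SU_det; rewrite /= -!scalerAl !mul1r scale1r.
by rewrite scaleN1r => /eqP; rewrite subr_eq => /eqP.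
Qed.
Lemma SUdaE : d * a = 1 + (q^-1)%:C *: (b * c).
Proof.
have := @palg_rel _ SU_pres _ _ SU_ad; rewrite /= -!scalerAl !mul1r.
rewrite scaleN1r -/a -/b -/c -/d => adE.
have -> : d * a = a * d - (a * d - d * a) by rewrite opprB addrC subrK.
rewrite adE SUadE -addrA -scalerBl -raddfB /=; congr (_ + _%:C *: _).
by rewrite opprB addrC subrK.
Qed.

(* c^* = - q^-1 b is forced by b^* = - q c and x^** = x *)
Definition SU_star_gen (x : SU_gens) : A :=
  match x with
  | SUa => d
  | SUb => (- q)%:C *: c
  | SUc => (- q^-1)%:C *: b
  | SUd => a
  end.

Fact SU_starP : arespects (P := SU_pres) (@conjc R) SU_star_gen.
Proof.
have qq : (- q)%:C * (- q^-1)%:C *: (b * c) = (if q == 0 then 0 else b * c).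
  rewrite -rmorphM mulrNN; case: eqVneq => [->|q0]; first by rewrite mul0r scale0r.
  by rewrite mulfV // scale1r.
have cr x : (x -i* 0)%C = x%:C by rewrite oppr0.
have cN1 : (-1 -i* - 0)%C = -1 :> C by rewrite !oppr0 -[LHS]/((-1)%:C) rmorphN1.
move=> s t [] /=; rewrite ?cN1 ?cr -?(scalerAl, scalerAr) ?mul1r ?mulr1.
- by rewrite SUcdE !scalerA mulrC.
- by rewrite SUbdE !scalerA mulrC.
- by rewrite SUacE !scalerA mulrC.
- by rewrite SUabE !scalerA mulrC.
- by rewrite SUbcC !scalerA mulrC.
- rewrite scaleN1r [(- q^-1)%:C *: _]scalerA [X in X *: (b * c)]mulrC qq SUadE SUdaE.
  rewrite opprD addrACA subrr add0r -scalerBl -raddfB.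
  by case: eqVneq => // ->; rewrite invr0 subr0 raddf0 !scale0r.
- rewrite scaleN1r [(- q^-1)%:C *: _]scalerA [X in X *: (b * c)]mulrC qq SUadE.
  rewrite scale1r; case: eqVneq => [->|_]; last by rewrite addrK.
  by rewrite raddf0 !scale0r subr0 addr0.
Qed.

Definition SU_star : A -> A := palift SU_starP.

Local Notation A2 := (palg (tens SU_pres SU_pres)).
Local Notation "x *t y" := (@tensor _ SU_pres SU_pres x y) (at level 40).

(* the matrix (a b; c d) is a corepresentation *)
Definition SU_coprod_gen (x : SU_gens) : A2 :=
  match x with
  | SUa => a *t a + b *t c
  | SUb => a *t b + b *t d
  | SUc => c *t a + d *t c
  | SUd => c *t b + d *t d
  end.

Let tE := (@tensorDl, @tensorDr, @tensorZl, @tensorZr, scalerDr, scalerA).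

Fact SU_coprodP : respects (P := SU_pres) SU_coprod_gen.
Proof.
have [q0|q0] := eqVneq q 0.
  have b0 : b = 0.
    rewrite -[b]mul1r. have <- : d * a = 1 by rewrite SUdaE q0 invr0 raddf0 scale0r addr0.
    by rewrite -mulrA SUabE q0 raddf0 scale0r mulr0.
  have c0 : c = 0.
    rewrite -[c]mul1r. have <- : d * a = 1 by rewrite SUdaE q0 invr0 raddf0 scale0r addr0.
    by rewrite -mulrA SUacE q0 raddf0 scale0r mulr0.
  have t0 x : (0 : A) *t x = 0 by rewrite /tensor raddf0 mul0r.
  have t0' x : x *t (0 : A) = 0 by rewrite /tensor raddf0 mulr0.
  have ad1 : a * d = 1 by rewrite SUadE b0 mul0r scaler0 addr0.
  have da1 : d * a = 1 by rewrite SUdaE b0 mul0r scaler0 addr0.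
  move=> s t [] /=; rewrite ?b0 ?c0 ?(t0, t0') ?addr0 ?add0r ?t0 ?mul0r ?mulr0;
    rewrite ?mulr0 ?tensorM ?ad1 ?da1 ?subrr // ?tensor11 ?subr0 ?scale1r //.
    by rewrite mulr1 scaleN1r subrr.
  by rewrite addr0.
have qq : q%:C * (q^-1)%:C = 1 :> C by rewrite -rmorphM mulfV.
have qq' : (q^-1)%:C * q%:C = 1 :> C by rewrite -rmorphM mulVf.
move=> s t [] /=; rewrite -?scalerAl ?mul1r ?scale1r ?scaleN1r.
all: rewrite ?mulrDl ?mulrDr ?tensorM; rewrite ?(SUabE,SUacE, SUbdE, SUcdE,SUadE,SUdaE,=^~SUbcC) ?tE ?(qq,qq',scale1r).
1-5: acsum.
  rewrite raddfB /= !mulrBl ?qq ?qq' !scalerBl !scale1r -[RHS](addrK (1 *t 1)).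
  rewrite !opprD; acsum.
by apply/eqP; rewrite subr_eq tensor11; apply/eqP; acsum.
Qed.

Definition SU_coprod : A -> A2 := plift SU_coprodP.
End SUq2Algebra.

Notation SUq2 q := (palg (SU_pres q)).

Section UqSu2.
Variables (R : realType) (q : R).
Local Notation C := R[i].

Inductive U_gens := UE | UF | UK | UKi.
Local Notation "''E'" := (Gen C UE).
Local Notation "''F'" := (Gen C UF).
Local Notation "''K'" := (Gen C UK).
Local Notation "''Ki'" := (Gen C UKi).

Inductive U_rels : term C U_gens -> term C U_gens -> Prop :=
  | U_KKi : U_rels ('K * 'Ki)%P (1%:T)%P
  | U_KiK : U_rels ('Ki * 'K)%P (1%:T)%P
  | U_KE : U_rels ('K * 'E)%P ((q%:C)%:T * ('E * 'K))%P
  | U_FK : U_rels ('F * 'K)%P ((q%:C)%:T * ('K * 'F))%P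
  | U_EF : U_rels ('E * 'F - 'F * 'E)%P
      (((q - q^-1)^-1%:C)%:T * ('K * 'K - 'Ki * 'Ki))%P.

Definition U_aug (x : U_gens) : C^o :=
  match x with UE => 0 | UF => 0 | UK => 1 | UKi => 1 end.

Fact U_augP s t : U_rels s t -> eval U_aug s = eval U_aug t.
Proof.
by case=> /=; rewrite ?(mulr0, mul0r, mulr1, addr0) // /GRing.scale /=
   ?(mulr1, mulr0, addr0, subrr).
Qed.

Definition U_pres : presentation C := Presentation U_augP.
Local Notation U := (palg U_pres).

Definition U_E : U := @pgen _ U_pres UE.
Definition U_F : U := @pgen _ U_pres UF.
Definition U_K : U := @pgen _ U_pres UK.
Definition U_Ki : U := @pgen _ U_pres UKi.

Lemma UKKiE : U_K * U_Ki = 1.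
Proof. by have := @palg_rel _ U_pres _ _ U_KKi; rewrite /= scale1r. Qed.
Lemma UKiKE : U_Ki * U_K = 1.
Proof. by have := @palg_rel _ U_pres _ _ U_KiK; rewrite /= scale1r. Qed.
Lemma UKEE : U_K * U_E = q%:C *: (U_E * U_K).
Proof. by have := @palg_rel _ U_pres _ _ U_KE; rewrite /= -scalerAl mul1r. Qed.
Lemma UFKE : U_F * U_K = q%:C *: (U_K * U_F).
Proof. by have := @palg_rel _ U_pres _ _ U_FK; rewrite /= -scalerAl mul1r. Qed.
Lemma UEFE : U_E * U_F - U_F * U_E =
  (q - q^-1)^-1%:C *: (U_K * U_K - U_Ki * U_Ki).
Proof.
have := @palg_rel _ U_pres _ _ U_EF.
by rewrite /= -scalerAl !mul1r -!scalerAl !mul1r !scaleN1r.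
Qed.
Lemma UEKiE : U_E * U_Ki = q%:C *: (U_Ki * U_E).
Proof.
rewrite -[LHS]mul1r -UKiKE -mulrA (mulrA U_K) UKEE -scalerAl -scalerAr.
by rewrite -(mulrA U_E) UKKiE mulr1.
Qed.
Lemma UKiFE : U_Ki * U_F = q%:C *: (U_F * U_Ki).
Proof.
rewrite -[LHS]mulr1 -UKKiE mulrA -(mulrA U_Ki U_F) UFKE -scalerAr -scalerAl.
by rewrite (mulrA U_Ki) UKiKE mul1r.
Qed.

Definition U_antipode_gen (x : U_gens) : U :=
  match x with
  | UE => (- q)%:C *: U_E
  | UF => (- q^-1)%:C *: U_F
  | UK => U_Ki
  | UKi => U_K
  end.

Fact U_antipodeP : arespects (P := U_pres) (@idfun C) U_antipode_gen.
Proof.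
have cN1 x : (- x)%:C = - x%:C :> C by rewrite rmorphN.
move=> s t [] /=; rewrite -?(scalerAl, scalerAr) ?mul1r ?mulr1 ?scale1r.
- exact: UKKiE.
- exact: UKiKE.
- by rewrite UEKiE !scalerA mulrC.
- by rewrite UKiFE !scalerA mulrC.
- rewrite !scaleN1r !scalerA -!rmorphM !mulrNN.
  have [->|q0] := eqVneq q 0.
    by rewrite invr0 subrr invr0 mulr0 raddf0 !scale0r subrr.
  rewrite mulVf // mulfV // !scale1r -opprB UEFE -scalerN opprB.
  by [].
Qed.

Definition U_antipode : U -> U := palift U_antipodeP.
End UqSu2.

Notation Uqsu2 q := (palg (U_pres q)).

(* Half-integers are encoded by naturals: the spin l = n/2 is given by n, and
   the index j = -l, .., l by i = j + l in 'I_n.+1. *)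
Section PeterWeyl.
Variables (R : realType) (q : R).
Local Notation C := R[i].
Local Notation A := (SUq2 q).
Local Notation U := (Uqsu2 q).
Local Notation "x *t y" := (@tensor _ (SU_pres q) (SU_pres q) x y) (at level 40).

Definition qnum (x : R) : R := (q `^ x - q `^ (- x)) / (q - q^-1).

Definition weight (n i : nat) : R := i%:R - n%:R / 2.

Definition alpha (n i : nat) : R :=
  Num.sqrt (qnum (n%:R / 2 - weight n i) * qnum (n%:R / 2 + weight n i + 1)).

Variable t : forall n, 'M[A]_n.+1.

Definition adjmx m n (M : 'M[A]_(m, n)) : 'M[A]_(n, m) := (map_mx (@SU_star R q) M)^T.

(* Matrix elements of irreducible unitary corepresentations forming a basis.
   Linear independence of the entries (field [pw_free]) is equivalent to the
   irreducibility and pairwise inequivalence of the corepresentations t n. *)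
Record peter_weyl : Prop := PeterWeyl {
  pw_coprod : forall n j k,
    SU_coprod (t n j k) = \sum_i t n j i *t t n i k;
  pw_counit : forall n j k, SU_counit (t n j k) = (j == k)%:R;
  pw_unitaryl : forall n, adjmx (t n) *m t n = 1%:M;
  pw_unitaryr : forall n, t n *m adjmx (t n) = 1%:M;
  pw_trivial : t 0 = 1%:M;
  pw_fundamental : [/\ t 1 0 0 = SU_a q, t 1 0 1 = SU_b q,
                       t 1 1 0 = SU_c q & t 1 1 1 = SU_d q];
  pw_span : forall x : A, exists N (z : forall n, 'M[C]_n.+1),
    x = \sum_(n < N) \sum_j \sum_k z n j k *: t n j k;
  pw_free : forall N (z : forall n, 'M[C]_n.+1),
    \sum_(n < N) \sum_j \sum_k z n j k *: t n j k = 0 ->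
    forall n, (n < N)%N -> z n = 0 }.

Definition pw_v (n : nat) (j k : 'I_n.+1) : A :=
  (Num.sqrt (qnum n.+1%:R) * q `^ weight n j)%:C *: t n j k.
Local Notation v := pw_v.

Record haar_state (h : A -> C) : Prop := HaarState {
  haar_linear : scalar h;
  haar0 : h (t 0 0 0) = 1;
  haarS : forall n j k, (0 < n)%N -> h (t n j k) = 0;
  haar_orthonormal : forall n j k n' j' k',
    h (SU_star (v (n := n) j k) * v (n := n') j' k') =
      [&& n == n', j == j' :> nat & k == k' :> nat]%:R }.

Definition representation (D : U -> A -> A) : Prop :=
  [/\ forall f, linear (D f),
      forall z f g x, D (z *: f + g) x = z *: D f x + D g x,
      forall x, D 1 x = x
    & forall f g x, D (f * g) x = D f (D g x)].

(* In the formulas for E and F a vector whose index leaves the range -l, .., l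
   is zero: the sums have at most one term. *)
Record left_action (act : U -> A -> A) : Prop := LeftAction {
  act_repr : representation act;
  act_E : forall n (j k : 'I_n.+1), act (U_E q) (v j k) =
    \sum_(k' < n.+1 | k' == k.+1 :> nat) (alpha n k)%:C *: v j k';
  act_F : forall n (j k : 'I_n.+1), act (U_F q) (v j k) =
    \sum_(k' < n.+1 | k == k'.+1 :> nat) (alpha n k')%:C *: v j k';
  act_K : forall n (j k : 'I_n.+1), act (U_K q) (v j k) =
    (q `^ weight n k)%:C *: v j k;
  (* module algebra, with the coproduct
     E |-> E (x) K + K^-1 (x) E, F |-> F (x) K + K^-1 (x) F, K |-> K (x) K *)
  act_EM : forall x y, act (U_E q) (x * y) =
    act (U_E q) x * act (U_K q) y + act (U_Ki q) x * act (U_E q) y;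
  act_FM : forall x y, act (U_F q) (x * y) =
    act (U_F q) x * act (U_K q) y + act (U_Ki q) x * act (U_F q) y;
  act_KM : forall x y, act (U_K q) (x * y) = act (U_K q) x * act (U_K q) y }.

Record del_action (del : U -> A -> A) : Prop := DelAction {
  del_repr : representation del;
  del_E : forall n (j k : 'I_n.+1), del (U_E q) (v j k) =
    \sum_(j' < n.+1 | j == j'.+1 :> nat) - (alpha n j')%:C *: v j' k;
  del_F : forall n (j k : 'I_n.+1), del (U_F q) (v j k) =
    \sum_(j' < n.+1 | j' == j.+1 :> nat) - (alpha n j)%:C *: v j' k;
  del_K : forall n (j k : 'I_n.+1), del (U_K q) (v j k) =
    (q `^ (- weight n j))%:C *: v j k }.

Definition action_matrices (act : U -> A -> A)
    (sigma : forall n, U -> 'M[C]_n.+1) : Prop :=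
  forall n f (i k : 'I_n.+1),
    act f (v i k) = \sum_j sigma n f j k *: v i j.

Definition rho_circ (sigma : forall n, U -> 'M[C]_n.+1) n (f : U) :
    'M[C]_n.+1 :=
  sigma n (U_Ki q * U_antipode f * U_K q).

(* the index j = N/2 for the spin l = |N|/2 *)
Definition extremal (N : int) : 'I_`|N|.+1 := if 0 <= N then ord_max else ord0.

Lemma weight_extremal N : weight `|N| (extremal N) = N%:~R / 2.
Proof.
rewrite /weight /extremal; case: N => n /=.
  by rewrite [X in X - _ = _](splitr n%:R) addrK pmulrn.
by rewrite add0r NegzE rmorphN mulNr pmulrn.
Qed.

Definition scalar_mx_alg m n (M : 'M[C]_(m, n)) : 'M[A]_(m, n) :=
  map_mx (fun z => z%:A) M.

Definition projection (sigma : forall n, U -> 'M[C]_n.+1) (N : int) :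
    'M[A]_(`|N|.+1) :=
  let tN := row (extremal N) (t `|N|) in
  scalar_mx_alg (rho_circ sigma `|N| (U_Ki q)) *m adjmx tN *m tN
    *m scalar_mx_alg (rho_circ sigma `|N| (U_K q)).
End PeterWeyl.

(* Twisted cyclic cohomology of a subalgebra B of A, with respect to an
   automorphism theta of B.  An n-cochain on B is represented by a function on
   (n+1)-tuples of A, of which only the values on tuples from B matter. *)
Section TwistedCyclic.
Variables (K : fieldType) (A : algType K) (B : A -> Prop) (theta : A -> A).

Definition cochain n := ('I_n.+1 -> A) -> K.

Definition on_sub n (a : 'I_n -> A) : Prop := forall i, B (a i).

Definition multilinear n (phi : cochain n) : Prop :=
  forall (a : 'I_n.+1 -> A) i z x y, on_sub a -> B x -> B y ->
    phi [eta a with i |-> z *: x + y] =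
      z * phi [eta a with i |-> x] + phi [eta a with i |-> y].

(* (theta a_n, a_0, .., a_{n-1}) *)
Definition rotation n (a : 'I_n.+1 -> A) : 'I_n.+1 -> A :=
  fun i => if i == ord0 then theta (a ord_max) else a (ord_pred i).

(* (a_0, .., a_j a_{j+1}, .., a_{n+1}) *)
Definition face n (j : 'I_n.+1) (a : 'I_n.+2 -> A) : 'I_n.+1 -> A :=
  fun i => if (i < j)%N then a (widen_ord (leqnSn _) i)
           else if i == j then a (widen_ord (leqnSn _) i) * a (lift ord0 i)
           else a (lift ord0 i).

(* (theta a_{n+1} a_0, a_1, .., a_n) *)
Definition last_face n (a : 'I_n.+2 -> A) : 'I_n.+1 -> A :=
  fun i => if i == ord0 then theta (a ord_max) * a ord0
           else a (widen_ord (leqnSn _) i).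

Definition hochschild n (phi : cochain n) : cochain n.+1 :=
  fun a => \sum_(j < n.+1) (-1) ^+ j * phi (face j a)
           + (-1) ^+ n.+1 * phi (last_face a).

Definition cyclic_cochain n (phi : cochain n) : Prop :=
  multilinear phi /\
  forall a, on_sub a -> phi a = (-1) ^+ n * phi (rotation a).

Definition cyclic_cocycle n (phi : cochain n) : Prop :=
  cyclic_cochain phi /\ forall a, on_sub a -> hochschild phi a = 0.

(* equality of the classes of phi and psi in HC^(n+1) *)
Definition HC_eq n (phi psi : cochain n.+1) : Prop :=
  [/\ cyclic_cocycle phi, cyclic_cocycle psi
    & exists2 chi : cochain n, cyclic_cochain chi &
        forall a, on_sub a -> phi a - psi a = hochschild chi a].

Definition cochain0 (f : A -> K) : cochain 0 := fun a => f (a ord0).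

Definition periodicity0 (phi : cochain 0) : cochain 2 :=
  fun a => - 2^-1 * phi (fun=> a 0 * a 1 * a 2).

(* Phi (Tr_theta (P (x) .. (x) P)), with r + 1 factors; [rho2] stands for
   rho^o(K^-2) and [J] for the indices j_0, .., j_{r+1}. *)
Definition twisted_trace r (Phi : cochain r) m (P : 'M[A]_m) (rho2 : 'M[K]_m) :=
  \sum_(J : {ffun 'I_r.+2 -> 'I_m}) rho2 (J ord_max) (J ord0) *
    Phi (fun i => P (J (widen_ord (leqnSn _) i)) (J (lift ord0 i))).

Definition pairing n (Phi : cochain n.*2) m (P : 'M[A]_m) (rho2 : 'M[K]_m) : K :=
  (-1) ^+ n * ((n.*2)`!%:R / n`!%:R) * twisted_trace Phi P rho2.
End TwistedCyclic.

Section PodlesSphere.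
Variables (R : realType) (q : R).
Local Notation C := R[i].
Local Notation A := (SUq2 q).
Local Notation U := (Uqsu2 q).
Variables (act del : U -> A -> A) (h : A -> C).

Definition podles_sphere (x : A) : Prop := del (U_K q ^+ 2) x = x.

Definition modular_aut (x : A) : A := act (U_Ki q ^+ 2) x.

Definition tau : cochain A 2 := fun a =>
  h (a 0 * (q%:C *: (del (U_E q) (a 1) * del (U_F q) (a 2))
            - (q^-1)%:C *: (del (U_F q) (a 1) * del (U_E q) (a 2)))).
End PodlesSphere.

(* Main.v *)
Require Import Defs.
From HB Require Import structures.
From mathcomp Require Import all_boot all_order all_algebra.
From mathcomp Require Import boolp reals exp complex.
From mathcomp Require Import ring lra.
Import Order.TTheory GRing.Theory Num.Theory.
Local Open Scope ring_scope.
Local Open Scope complex_scope.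
Set Implicit Arguments.
Unset Strict Implicit.
Unset Printing Implicit Defensive.

(** Write X and Y for the operators del E and del F, and call an eigenvector
    of del K a weight vector.  The sphere is the fixed space of del K.

    The matrix elements show that X and Y are convolutions by functionals on
    the coordinate algebra, hence twisted derivations
    ([convolution_derivation]).  On the sphere they are honest derivations,
    they commute, and they multiply the weight by q and by 1/q.  The Haar state
    h vanishes on their images and is a theta-twisted trace on the sphere.
    Integration by parts then makes tau a twisted cyclic cocycle
    ([area_cocycle]).  The trace property is read off from the moments of h on
    the powers of z = bc: monomials in a, b, c, d span, h kills those of
    nontrivial weight, and h(X(z^n cd)) = 0 is a recursion for the moments
    ([haar_twisted_trace]).

    For the pairing, the entries of the projection are multiples of
    star(x_j) x_k, where x is the first or the last row of t^l.  For nonzero N,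
    one of X and Y kills x and the other sends it to a multiple of the
    neighbouring row y, so the derivatives of star(x_j) x_k are multiples of
    star(x_j) y_k and star(y_j) x_k.  Unitarity collapses the sums over the
    inner indices: one of the two terms of tau vanishes because x and y are
    orthogonal rows, and the other leaves the sum of q^(2j) h(star(x_j) x_j),
    which orthonormality evaluates ([pairing_tau]).

    For the cohomology class, note that X is, up to a scalar, the commutator
    with a c^-1, which lives in a localization only.  Pairing a c^-1 with Y(x)
    under an extension of h turns out to give a multiple of (eps - h)(x).
    Since Y maps the sphere onto the vectors of weight 1/q, with the constants
    as its kernel, the rule G(Y(x)) = eps(x) - h(x) defines a functional G
    without any localization ([lowering_functional]).  The inner derivation
    survives as the identity
      G(theta(x) m) - G(m x) = (q^2 - 1) h(X(theta(x)) m),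
    which passes to products in x and so need only be checked on the generators
    ac, bc, bd of the sphere, where it follows from the moments
    ([lowered_functional_twisted]).  These properties of G make
      chi(x, y) = q h(X(x) Y(y)) + (G(Y(x) y) - G(x Y(y))) / (q - 1/q)
    a twisted cyclic cochain with coboundary
    tau(x, y, z) + (eps - h)(xyz) / (q - 1/q), and this is the asserted relation
    between the classes ([area_cohomologous]). *)

(** * Spans of eigenvectors *)

Section Spans.
Variables (F : fieldType) (V : lmodType F).

Inductive lspan (S : V -> Prop) : V -> Prop :=
  | lspan0 : lspan S 0
  | lspanS c x y : S x -> lspan S y -> lspan S (c *: x + y).

Lemma lspanD S x y : lspan S x -> lspan S y -> lspan S (x + y).
Proof.
move=> Sx Sy; elim: Sx => [|c u v Su _ IH]; first by rewrite add0r.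
by rewrite -addrA; apply: lspanS.
Qed.

Lemma lspanZ S c x : lspan S x -> lspan S (c *: x).
Proof.
elim=> [|d u v Su _ IH]; first by rewrite scaler0; apply: lspan0.
by rewrite scalerDr scalerA; apply: lspanS.
Qed.

Lemma lspan_mem (S : V -> Prop) x : S x -> lspan S x.
Proof.
by move=> Sx; rewrite -[x]addr0 -[x]scale1r; apply: lspanS => //; apply: lspan0.
Qed.

Lemma lspan_sum S (I : Type) (r : seq I) (P : pred I) f :
  (forall i, P i -> lspan S (f i)) -> lspan S (\sum_(i <- r | P i) f i).
Proof.
move=> Sf; elim/big_rec: _ => [|i y Pi Sy]; first exact: lspan0.
by apply: lspanD => //; apply: Sf.
Qed.

Lemma lspan_sub (S S' : V -> Prop) x :
  (forall y, S y -> lspan S' y) -> lspan S x -> lspan S' x.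
Proof.
move=> SS'; elim=> [|c u v Su _ IH]; first exact: lspan0.
by apply: lspanD => //; apply/lspanZ/SS'.
Qed.

Lemma lspan_closed (S Q : V -> Prop) x :
    Q 0 -> (forall c y z, Q y -> Q z -> Q (c *: y + z)) ->
    (forall y, S y -> Q y) -> lspan S x -> Q x.
Proof. by move=> Q0 QD SQ; elim=> // c u v Su _ Qv; apply: QD => //; apply: SQ. Qed.

Lemma lspan_linear (W : lmodType F) (f g : V -> W) (S : V -> Prop) x :
    linear f -> linear g -> (forall y, S y -> f y = g y) -> lspan S x ->
  f x = g x.
Proof.
move=> fL gL fg; have lin0 (k : V -> W) : linear k -> k 0 = 0.
  by move=> kL; have := kL (-1) 0 0; rewrite !scaleN1r oppr0 addr0 addNr.
apply: (lspan_closed (Q := fun y => f y = g y)) => //.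
  by rewrite (lin0 f) ?(lin0 g).
by move=> c y z fgy fgz; rewrite fL gL fgy fgz.
Qed.

Section Eigen.
Variables (T : V -> V) (T_linear : linear T).

Let TD x y : T (x + y) = T x + T y.
Proof. by have := T_linear 1 x y; rewrite !scale1r. Qed.
Let T0 : T 0 = 0.
Proof. by have := T_linear (-1) 0 0; rewrite !scaleN1r oppr0 addr0 addNr. Qed.
Let TZ c x : T (c *: x) = c *: T x.
Proof. by have := T_linear c x 0; rewrite T0 !addr0. Qed.

(** Applying T minus the first eigenvalue removes the first term and multiplies
    the sum by a nonzero scalar, which starts an induction on the number of
    terms. *)
Lemma eigen_sum_eq0 mu (s : seq (F * V)) :
    (forall y, y \in s -> T y.2 = y.1 *: y.2 /\ y.1 != mu) ->
    T (\sum_(y <- s) y.2) = mu *: \sum_(y <- s) y.2 ->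
  \sum_(y <- s) y.2 = 0.
Proof.
elim: {s}(size s) {-2}s (leqnn (size s)) => [[] // _|n IH [|y0 s]] /=.
- by rewrite big_nil.
- by rewrite big_nil.
rewrite ltnS => size_s sP; have [Ty0 y0mu] := sP y0 (mem_head _ _).
rewrite !big_cons; set z := y0.2 + _ => Tz.
have {}y0mu : mu - y0.1 != 0 by rewrite subr_eq0 eq_sym.
pose f (y : F * V) := (y.1, ((mu - y0.1)^-1 * (y.1 - y0.1)) *: y.2).
have Tsum : T (\sum_(y <- s) y.2) = \sum_(y <- s) y.1 *: y.2.
  rewrite (big_morph _ TD T0); apply: eq_big_seq => y ys.
  by case: (sP y); rewrite // in_cons ys orbT.
have zE : z = \sum_(y <- map f s) y.2.
  apply: (scalerI y0mu); rewrite scalerBl -Tz TD Ty0 Tsum /z scalerDr opprD.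
  rewrite addrACA subrr add0r big_map /= !scaler_sumr -sumrB.
  apply: eq_bigr => y _; rewrite !scalerA mulrA mulfV // mul1r.
  by rewrite -scalerBl.
rewrite zE; apply: IH; rewrite ?size_map // -?zE // => y /mapP[y' y's ->] /=.
by have [|Ty' y'mu] := sP y'; rewrite ?in_cons ?y's ?orbT // TZ Ty' !scalerA mulrC.
Qed.

(** A vector fixed up to the scalar mu cannot see the spanning eigenvectors
    with another eigenvalue: these cancel, since eigenvectors to distinct
    eigenvalues are independent. *)
Lemma eigen_lspan (S : F -> V -> Prop) mu x :
    (forall l y, S l y -> T y = l *: y) ->
    lspan (fun y => exists l, S l y) x -> T x = mu *: x ->
  lspan (S mu) x.
Proof.
move=> SP Sx; have {Sx} [s sP ->] : exists2 s : seq (F * V),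
    (forall y, y \in s -> exists c v, y.2 = c *: v /\ S y.1 v)
  & x = \sum_(y <- s) y.2.
  elim: Sx => [|c u v [l Su] _ [s sP ->]]; first by exists [::]; rewrite ?big_nil.
  exists ((l, c *: u) :: s); last by rewrite big_cons.
  by move=> y; rewrite in_cons => /orP[/eqP->|/sP//]; exists c, u.
have TS y : y \in s -> T y.2 = y.1 *: y.2.
  by case/sP=> c [v [-> /SP Tv]]; rewrite TZ Tv !scalerA mulrC.
rewrite (bigID (fun y => y.1 == mu)) /=; set u := \sum_(y <- s | y.1 == _) _.
have Su : lspan (S mu) u.
  rewrite /u big_seq_cond; apply: lspan_sum => y /andP[/sP[c [v [-> Sv]]]].
  by move/eqP <-; apply/lspanZ/lspan_mem.
have Tu : T u = mu *: u.
  rewrite /u (big_morph _ TD T0) scaler_sumr big_seq_cond [RHS]big_seq_cond.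
  by apply: eq_bigr => y /andP[/TS-> /eqP->].
rewrite TD Tu scalerDr => /addrI Tv.
suff -> : \sum_(y <- s | y.1 != mu) y.2 = 0 by rewrite addr0.
rewrite -big_filter; apply: (@eigen_sum_eq0 mu); last by rewrite big_filter.
by move=> y; rewrite mem_filter => /andP[ymu /TS].
Qed.
End Eigen.
End Spans.

(** * Algebra maps out of a tensor product *)

Section TensorLift.
Variable K : comNzRingType.

Lemma morph_eval (P : presentation K) (D : algType K) (f : palg P -> D) s :
  linear f -> monoid_morphism f -> eval (f \o @pgen K P) s = f (Defs.pi s).
Proof.
move=> fL [f1 fM]; have f0 : f 0 = 0.
  by have := fL (-1) 0 0; rewrite !scaleN1r oppr0 addr0 addNr.
elim: s => //= [c|s -> t ->|s -> t ->].
- by rewrite piC -[X in f X]addr0 fL f0 f1 addr0.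
- by rewrite piD -[X in f (X + _)]scale1r fL scale1r.
- by rewrite piM fM.
Qed.

Variables (P Q : presentation K) (D : algType K).
Variables (f : palg P -> D) (g : palg Q -> D).
Hypotheses (fL : linear f) (fM : monoid_morphism f).
Hypotheses (gL : linear g) (gM : monoid_morphism g).
Hypothesis fg : forall x y, f x * g y = g y * f x.

(** The universal property of the tensor product: commuting images are what the
    extra relations of its presentation ask for. *)
Lemma tensor_lift : exists psi : {lrmorphism palg (tens P Q) -> D},
  forall x y, psi (tensor x y) = f x * g y.
Proof.
pose k (i : gens (tens P Q)) : D :=
  match i with inl i => f (pgen i) | inr j => g (pgen j) end.
have kP : respects k.
  move=> _ _ [s t st|s t st|i j] /=; rewrite ?eval_map; last exact: fg.
  - rewrite -[eval _ s]/(eval (f \o @pgen K P) s) -[eval _ t]/(eval (f \o @pgen K P) t).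
    by rewrite !morph_eval //; congr f; apply/Defs.piP/cong_rel.
  - rewrite -[eval _ s]/(eval (g \o @pgen K Q) s) -[eval _ t]/(eval (g \o @pgen K Q) t).
    by rewrite !morph_eval //; congr g; apply/Defs.piP/cong_rel.
exists (plift kP); elim/palg_ind=> s; elim/palg_ind=> t.
rewrite /tensor rmorphM /= -(morph_eval s fL fM) -(morph_eval t gL gM) !plift_pi; congr (_ * _).
  elim: s => /= [i|c|s IHs t' IHt|s IHs t' IHt]; first by rewrite plift_gen.
  - by rewrite linearZ rmorph1.
  - by rewrite rmorphD /= IHs IHt.
  - by rewrite rmorphM /= IHs IHt.
elim: t => /= [i|c|t IHt t' IHt'|t IHt t' IHt']; first by rewrite plift_gen.
- by rewrite linearZ rmorph1.
- by rewrite rmorphD /= IHt IHt'.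
- by rewrite rmorphM /= IHt IHt'.
Qed.
End TensorLift.

Section MatrixAlgebra.
Variables (K : comNzRingType) (A : algType K) (n : nat).

(** The matrix type acts on itself over the coefficient ring A, which need not
    be commutative; this copy of it carries the action of the scalars K. *)
Definition mxalg : Type := 'M[A]_n.+1.
HB.instance Definition _ := GRing.NzRing.on mxalg.

Definition mxalg_scale (c : K) (M : mxalg) : mxalg := map_mx ( *:%R c) M.

Fact mxalg_scaleA a b M : mxalg_scale a (mxalg_scale b M) = mxalg_scale (a * b) M.
Proof. by apply/matrixP => i j; rewrite !mxE scalerA. Qed.
Fact mxalg_scale1 : left_id 1 mxalg_scale.
Proof. by move=> M; apply/matrixP => i j; rewrite !mxE scale1r. Qed.
Fact mxalg_scaleDr : right_distributive mxalg_scale +%R.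
Proof. by move=> a M N; apply/matrixP => i j; rewrite !mxE scalerDr. Qed.
Fact mxalg_scaleDl M : {morph mxalg_scale^~ M : a b / a + b}.
Proof. by move=> a b; apply/matrixP => i j; rewrite !mxE scalerDl. Qed.
HB.instance Definition _ := GRing.Zmodule_isLmodule.Build K mxalg
  mxalg_scaleA mxalg_scale1 mxalg_scaleDr mxalg_scaleDl.

Fact mxalg_scaleAl (a : K) (M N : mxalg) : a *: (M * N) = (a *: M) * N.
Proof.
apply/matrixP => i j; rewrite !mxE scaler_sumr.
by apply: eq_bigr => k _; rewrite !mxE scalerAl.
Qed.
HB.instance Definition _ := GRing.Lmodule_isLalgebra.Build K mxalg mxalg_scaleAl.

Fact mxalg_scaleAr (a : K) (M N : mxalg) : a *: (M * N) = M * (a *: N).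
Proof.
apply/matrixP => i j; rewrite !mxE scaler_sumr.
by apply: eq_bigr => k _; rewrite !mxE scalerAr.
Qed.
HB.instance Definition _ := GRing.Lalgebra_isAlgebra.Build K mxalg mxalg_scaleAr.
End MatrixAlgebra.

(** * Convolution derivations *)

Section UpperTriangular.
Variables (K : comNzRingType) (A : algType K).

(** The corner entry of a product of such matrices is a twisted Leibniz rule. *)
Definition utri (u v w : A) : mxalg A 1 :=
  \matrix_(i, j) if i == 0 then if j == 0 then u else v else if j == 0 then 0 else w.

Lemma utriM u v w u' v' w' :
  utri u v w * utri u' v' w' = utri (u * u') (u * v' + v * w') (w * w').
Proof.
apply/matrixP => i j; rewrite !mxE big_ord_recl big_ord1 !mxE /=.
by case: i => [[|[|]]] //= ?; case: j => [[|[|]]] //= ?;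
   rewrite ?(mul0r, mulr0, addr0, add0r).
Qed.

Lemma utri_scaleD c u v w u' v' w' :
  utri (c *: u + u') (c *: v + v') (c *: w + w') = c *: utri u v w + utri u' v' w'.
Proof.
apply/matrixP => i j; rewrite !mxE.
by case: ifP; case: ifP; rewrite // scaler0 addr0.
Qed.

Lemma utri0 : utri 0 0 0 = 0.
Proof. by apply/matrixP => i j; rewrite !mxE; case: ifP; case: ifP. Qed.

Lemma utri1 : utri 1 0 1 = 1.
Proof.
by apply/matrixP => i j; rewrite !mxE; case: i => [[|[|]]] //= ?; case: j => [[|[|]]] //= ?.
Qed.

Lemma utri_inj u v w u' v' w' :
  utri u v w = utri u' v' w' -> [/\ u = u', v = v' & w = w'].
Proof.
move/matrixP => uu; have := uu 0 0; have := uu 0 1; have := uu 1 1.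
by rewrite !mxE /=.
Qed.

Lemma utri_sum (I : Type) (r : seq I) (u v w : I -> A) :
  \sum_(i <- r) utri (u i) (v i) (w i) =
  utri (\sum_(i <- r) u i) (\sum_(i <- r) v i) (\sum_(i <- r) w i).
Proof.
elim: r => [|i r IH]; rewrite ?big_nil ?utri0 // !big_cons IH.
by rewrite -[u i]scale1r -[v i]scale1r -[w i]scale1r utri_scaleD !scale1r.
Qed.
End UpperTriangular.

Section Convolution.
Variables (R : realType) (q : R).
Local Notation C := R[i].
Local Notation A := (SUq2 q).
Variables (t : forall n, 'M[A]_n.+1) (ht : peter_weyl t).

Lemma pw_lspan x : lspan (fun y => exists n j k, y = t n j k) x.
Proof.
have [N [z ->]] := pw_span ht x.
do 3 apply: lspan_sum => ? _; apply/lspanZ/lspan_mem.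
by do 3 eexists.
Qed.

Lemma pw_linear (W : lmodType C) (f g : A -> W) : linear f -> linear g ->
  (forall n j k, f (t n j k) = g (t n j k)) -> f =1 g.
Proof.
move=> fL gL fg x; apply: (lspan_linear fL gL _ (pw_lspan x)).
by move=> _ [n [j [k ->]]].
Qed.

Lemma pw_scalar (f g : A -> C) : scalar f -> scalar g ->
  (forall n j k, f (t n j k) = g (t n j k)) -> f =1 g.
Proof. by move=> fL gL; apply: (@pw_linear C^o f g fL gL). Qed.

Variables (k1 k2 e : A -> C) (L1 L2 E : A -> A).
Hypotheses (k1L : scalar k1) (k2L : scalar k2) (eL : scalar e).
Hypotheses (k11 : k1 1 = 1) (k21 : k2 1 = 1) (e1 : e 1 = 0).
Hypotheses (k1M : forall x y, k1 (x * y) = k1 x * k1 y).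
Hypotheses (k2M : forall x y, k2 (x * y) = k2 x * k2 y).
Hypotheses (eM : forall x y, e (x * y) = k1 x * e y + e x * k2 y).
Hypotheses (L1L : linear L1) (L2L : linear L2) (EL : linear E).
Hypotheses (L1t : forall n j k, L1 (t n j k) = \sum_i k1 (t n j i) *: t n i k).
Hypotheses (L2t : forall n j k, L2 (t n j k) = \sum_i k2 (t n j i) *: t n i k).
Hypotheses (Et : forall n j k, E (t n j k) = \sum_i e (t n j i) *: t n i k).

(** The functionals k1, e, k2 are the entries of an algebra map from A to the
    upper triangular scalar matrices.  Its tensor product with the identity,
    composed with the coproduct, is an algebra map from A to the upper
    triangular matrices over A, with entries L1, E and L2. *)
Lemma convolution_derivation :
  [/\ forall x y, L1 (x * y) = L1 x * L1 y,
      forall x y, L2 (x * y) = L2 x * L2 y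
    & forall x y, E (x * y) = L1 x * E y + E x * L2 y].
Proof.
pose f x : mxalg A 1 := utri (k1 x)%:A (e x)%:A (k2 x)%:A.
pose g y : mxalg A 1 := utri y 0 y.
have fL : linear f.
  by move=> c x y; rewrite /f -utri_scaleD k1L k2L eL !scalerDl !scalerA.
have fM : monoid_morphism f.
  split=> [|x y]; first by rewrite /f k11 k21 e1 scale0r scale1r utri1.
  by rewrite /f utriM k1M k2M eM scalerDl -!scalerAl !mul1r !scalerA.
have gL : linear g.
  by move=> c x y; rewrite /g -utri_scaleD scaler0 addr0.
have gM : monoid_morphism g.
  split=> [|x y]; first exact: utri1.
  by rewrite /g utriM mulr0 mul0r addr0.
have fg x y : f x * g y = g y * f x.
  by rewrite /f /g !utriM !(mul0r, mulr0, addr0, add0r) -!scalerAl -!scalerAr !mul1r !mulr1.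
have [psi psiE] := tensor_lift fL fM gL gM fg.
pose th x := psi (SU_coprod x).
have thE x : th x = utri (L1 x) (E x) (L2 x).
  move: x; apply: pw_linear.
  - by move=> c x y; rewrite /th /SU_coprod !linearP.
  - by move=> c x y; rewrite -utri_scaleD L1L L2L EL.
  move=> n j k; rewrite /th (pw_coprod ht) raddf_sum L1t L2t Et -utri_sum.
  apply: eq_bigr => i _; apply: etrans (psiE _ _) _; rewrite /f /g utriM mulr0 add0r.
  by rewrite -!scalerAl !mul1r.
have thM x y : th (x * y) = th x * th y.
  by rewrite /th /SU_coprod rmorphM rmorphM.
split=> x y; have := thM x y; rewrite !thE utriM => /utri_inj[] //.
Qed.
End Convolution.

(** * Twisted cochains of low degree *)

Section LowDegree.
Variables (F : fieldType) (A : algType F) (theta : A -> A).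

Lemma rotation2 (a : 'I_3 -> A) :
  [/\ rotation theta a 0 = theta (a 2), rotation theta a 1 = a 0
    & rotation theta a 2 = a 1].
Proof.
by split; rewrite /rotation /=; do ?congr theta; congr a; apply: val_inj.
Qed.

Lemma rotation1 (a : 'I_2 -> A) :
  rotation theta a 0 = theta (a 1) /\ rotation theta a 1 = a 0.
Proof.
by split; rewrite /rotation /=; do ?congr theta; congr a; apply: val_inj.
Qed.

Lemma hochschild2 (f : A -> A -> A -> F) (a : 'I_4 -> A) :
  hochschild theta (fun b : 'I_3 -> A => f (b 0) (b 1) (b 2)) a =
    f (a 0 * a 1) (a 2) (a 3) - f (a 0) (a 1 * a 2) (a 3)
    + f (a 0) (a 1) (a 2 * a 3) - f (theta (a 3) * a 0) (a 1) (a 2).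
Proof.
rewrite /hochschild !big_ord_recl big_ord0 /face /last_face /=.
rewrite /bump /= !addn0 !(exprS, expr0, mulr1, mul1r, mulN1r, opprK, addr0) !addrA.
do 3?[congr (_ + _)]; do ?congr (- _); congr f; do ?[congr (_ * _)]; do ?congr theta.
all: by congr a; apply: val_inj.
Qed.

Lemma hochschild1 (f : A -> A -> F) (a : 'I_3 -> A) :
  hochschild theta (fun b : 'I_2 -> A => f (b 0) (b 1)) a =
    f (a 0 * a 1) (a 2) - f (a 0) (a 1 * a 2) + f (theta (a 2) * a 0) (a 1).
Proof.
rewrite /hochschild !big_ord_recl big_ord0 /face /last_face /=.
rewrite /bump /= !addn0 !(exprS, expr0, mulr1, mul1r, mulN1r, opprK, addr0).
do 3?[congr (_ + _)]; do ?congr (- _); congr f; do ?[congr (_ * _)]; do ?congr theta.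
all: by congr a; apply: val_inj.
Qed.

Lemma multilinear2 (B : A -> Prop) (f : A -> A -> A -> F) :
    (forall z x y u v, B x -> B y -> B u -> B v -> f (z *: x + y) u v = z * f x u v + f y u v) ->
    (forall z x y u v, B x -> B y -> B u -> B v -> f u (z *: x + y) v = z * f u x v + f u y v) ->
    (forall z x y u v, B x -> B y -> B u -> B v -> f u v (z *: x + y) = z * f u v x + f u v y) ->
  multilinear B (fun b : 'I_3 -> A => f (b 0) (b 1) (b 2)).
Proof.
move=> f0 f1 f2 a i z x y Ba Bx By.
by case: i => [[|[|[|]]]] //= ?; [apply: f0|apply: f1|apply: f2].
Qed.

Lemma multilinear1 (B : A -> Prop) (f : A -> A -> F) :
    (forall z x y u, B x -> B y -> B u -> f (z *: x + y) u = z * f x u + f y u) ->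
    (forall z x y u, B x -> B y -> B u -> f u (z *: x + y) = z * f u x + f u y) ->
  multilinear B (fun b : 'I_2 -> A => f (b 0) (b 1)).
Proof.
move=> f0 f1 a i z x y Ba Bx By.
by case: i => [[|[|]]] //= ?; [apply: f0|apply: f1].
Qed.
End LowDegree.

Section DiagonalTrace.
Variables (F : fieldType) (A : algType F) (m : nat).

Lemma sum_ffun4 (V : nmodType) (f : {ffun 'I_4 -> 'I_m} -> V) :
  \sum_J f J = \sum_i \sum_j \sum_k \sum_l
    f [ffun x : 'I_4 => nth i [:: i; j; k; l] x].
Proof.
pose e (p : 'I_m * ('I_m * ('I_m * 'I_m))) : {ffun 'I_4 -> 'I_m} :=
  [ffun x : 'I_4 => nth p.1 [:: p.1; p.2.1; p.2.2.1; p.2.2.2] x].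
pose e' (J : {ffun 'I_4 -> 'I_m}) := (J 0, (J 1, (J 2, J 3))).
rewrite (reindex e) /=; last first.
  exists e' => [[i [j [k l]]] _|J _]; first by rewrite /e' !ffunE.
  apply/ffunP => x; rewrite ffunE /=.
  case: x => [[|[|[|[|]]]]] //= lt_x; congr (J _); exact: val_inj.
under [RHS]eq_bigr do under eq_bigr do rewrite pair_bigA /=.
under [RHS]eq_bigr do rewrite pair_bigA /=.
by rewrite pair_bigA /=; apply: eq_bigr => -[i [j [k l]]].
Qed.

Lemma twisted_trace_diag (phi : A -> A -> A -> F) (P : 'M[A]_m) (rho2 : 'M[F]_m) mu :
    (forall i j, rho2 i j = (i == j)%:R * mu j) ->
  twisted_trace (fun a : 'I_3 -> A => phi (a 0) (a 1) (a 2)) P rho2 =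
  \sum_i \sum_j \sum_k mu i * phi (P i j) (P j k) (P k i).
Proof.
move=> rhoE; rewrite /twisted_trace sum_ffun4.
apply: eq_bigr => i _; apply: eq_bigr => j _; apply: eq_bigr => k _.
rewrite (bigD1 i) //= big1 ?addr0 => [|l /negPf li]; rewrite !ffunE /= rhoE ?li ?mul0r //.
by rewrite eqxx mul1r.
Qed.
End DiagonalTrace.

(** * The area cocycle of two commuting derivations *)

Section TwistedTrace.
Variables (F : numFieldType) (A : algType F) (B : A -> Prop) (theta : A -> A).
Hypothesis BM : forall x y, B x -> B y -> B (x * y).
Variable f : A -> F.
Hypotheses (fL : scalar f) (fT : forall x y, B x -> B y -> f (x * y) = f (theta y * x)).

(** All faces of the product cochain are values of f on the full product, the
    last one by the trace property, and their signs cancel in pairs. *)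
Lemma periodicity_cocycle : cyclic_cocycle B theta (periodicity0 (cochain0 f)).
Proof.
pose s x y z := - 2^-1 * f (x * y * z).
split; first split.
- apply: (@multilinear2 _ _ B s) => z x y u v Bx By Bu Bv; rewrite /s.
  + by rewrite !mulrDl -!scalerAl fL; ring.
  + by rewrite mulrDr mulrDl -!scalerAr -!scalerAl fL; ring.
  + by rewrite mulrDr -!scalerAr fL; ring.
- move=> a Ba; have [r0 r1 r2] := rotation2 theta a.
  rewrite [RHS](_ : _ = (-1) ^+ 2 * s (theta (a 2)) (a 0) (a 1)); last first.
    by rewrite -r0 -r1 -r2.
  rewrite sqrrN expr1n mul1r /s -mulrA -fT //; exact: BM.
move=> a Ba; apply: etrans (hochschild2 theta s a) _; rewrite /s.
have -> : theta (a 3) * a 0 * a 1 * a 2 = theta (a 3) * (a 0 * a 1 * a 2).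
  by rewrite !mulrA.
rewrite -fT ?mulrA; [by rewrite addrK subrr | | exact: Ba].
by do 2?[apply: BM] => //; apply: Ba.
Qed.
End TwistedTrace.

Section Derivations.
Variables (F : numFieldType) (q : F) (A : algType F).
Hypotheses (q0 : q != 0) (q1 : q - q^-1 != 0).
(* The hypotheses abstract the operators del E, del F, del K and its inverse, and
   the Haar state; B is then the sphere. *)
Variables (X Y K Ki theta : A -> A) (h : A -> F).
Hypotheses (XL : linear X) (YL : linear Y) (KL : linear K) (KiL : linear Ki).
Hypothesis hL : scalar h.
Let B x := K x = x.
Hypotheses (KM : forall x y, K (x * y) = K x * K y) (KK : forall x, Ki (K x) = x).
Hypotheses (XM : forall x y, X (x * y) = K x * X y + X x * Ki y).
Hypotheses (YM : forall x y, Y (x * y) = K x * Y y + Y x * Ki y).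
Hypotheses (KX : forall x, K (X x) = q *: X (K x)).
Hypotheses (KY : forall x, K (Y x) = q^-1 *: Y (K x)).
Hypothesis XYC : forall x, B x -> X (Y x) = Y (X x).
Hypotheses (hX : forall x, h (X x) = 0) (hY : forall x, h (Y x) = 0).
Hypothesis thetaB : forall x, B x -> B (theta x).
Hypothesis hT : forall x y, B x -> B y -> h (x * y) = h (theta y * x).

#[local] HB.instance Definition _ := GRing.isLinear.Build F A A *:%R X XL.
#[local] HB.instance Definition _ := GRing.isLinear.Build F A A *:%R Y YL.
#[local] HB.instance Definition _ := GRing.isLinear.Build F A A *:%R K KL.
#[local] HB.instance Definition _ := GRing.isLinear.Build F A A *:%R Ki KiL.
#[local] HB.instance Definition _ := GRing.isLinear.Build F A F *%R h hL.

Lemma Ki_weight l x : l != 0 -> K x = l *: x -> Ki x = l^-1 *: x.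
Proof.
by move=> l0 Kx; rewrite -{2}(KK x) Kx linearZ /= scalerA mulVf // scale1r.
Qed.

Let wt l x := K x = l *: x.

Let BP x : B x <-> wt 1 x.
Proof. by rewrite /wt scale1r. Qed.
Let wtM l l' x y : wt l x -> wt l' y -> wt (l * l') (x * y).
Proof. by rewrite /wt KM => -> ->; rewrite -scalerAl -scalerAr scalerA. Qed.
Let wtX l x : wt l x -> wt (q * l) (X x).
Proof. by rewrite /wt KX => ->; rewrite linearZ /= scalerA. Qed.
Let wtY l x : wt l x -> wt (q^-1 * l) (Y x).
Proof. by rewrite /wt KY => ->; rewrite linearZ /= scalerA. Qed.
Let wtBX x : B x -> wt q (X x).
Proof. by move/BP/wtX; rewrite mulr1. Qed.
Let wtBY x : B x -> wt q^-1 (Y x).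
Proof. by move/BP/wtY; rewrite mulr1. Qed.
Let wtBl l x y : B x -> wt l y -> wt l (x * y).
Proof. by move=> /BP Bx ly; rewrite -[l]mul1r; apply: wtM. Qed.
Let wtBr l x y : wt l x -> B y -> wt l (x * y).
Proof. by move=> lx /BP By; rewrite -[l]mulr1; apply: wtM. Qed.
Let BM x y : B x -> B y -> B (x * y).
Proof. by rewrite /B KM => -> ->. Qed.
Let BXY x y : B x -> B y -> B (X x * Y y).
Proof. by move=> Bx By; apply/BP; rewrite -(mulfV q0); apply: wtM; [apply: wtBX|apply: wtBY]. Qed.
Let BYX x y : B x -> B y -> B (Y x * X y).
Proof. by move=> Bx By; apply/BP; rewrite -(mulVf q0); apply: wtM; [apply: wtBY|apply: wtBX]. Qed.
Let BD x y : B x -> B y -> B (x + y).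
Proof. by rewrite /B linearD /= => -> ->. Qed.
Let BZ c x : B x -> B (c *: x).
Proof. by rewrite /B linearZ /= => ->. Qed.
Let BXm m : wt q^-1 m -> B (X m).
Proof. by move/wtX; rewrite mulfV // => /BP. Qed.

(* The twisted Leibniz rules on weight vectors, with explicit scalars. *)
Let Xwt l l' x y : l' != 0 -> wt l x -> wt l' y ->
  X (x * y) = l *: (x * X y) + l'^-1 *: (X x * y).
Proof.
by move=> l'0 lx ly; rewrite XM lx (Ki_weight l'0 ly) -scalerAl -scalerAr.
Qed.
Let Ywt l l' x y : l' != 0 -> wt l x -> wt l' y ->
  Y (x * y) = l *: (x * Y y) + l'^-1 *: (Y x * y).
Proof.
by move=> l'0 lx ly; rewrite YM lx (Ki_weight l'0 ly) -scalerAl -scalerAr.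
Qed.
Let XB x y : B x -> B y -> X (x * y) = x * X y + X x * y.
Proof.
by move=> /BP Bx /BP By; rewrite (Xwt (oner_neq0 _) Bx By) invr1 !scale1r.
Qed.
Let YB x y : B x -> B y -> Y (x * y) = x * Y y + Y x * y.
Proof.
by move=> /BP Bx /BP By; rewrite (Ywt (oner_neq0 _) Bx By) invr1 !scale1r.
Qed.
Let qV0 : q^-1 != 0. Proof. by rewrite invr_eq0. Qed.

(* integration by parts *)
Let hXr l x y : l != 0 -> B x -> wt l y -> h (x * X y) = - l^-1 * h (X x * y).
Proof.
move=> l0 /BP Bx ly; apply/eqP; rewrite mulNr -addr_eq0; apply/eqP.
by have := hX (x * y); rewrite (Xwt l0 Bx ly) scale1r linearD linearZ.
Qed.
Let hXl l x y : wt l x -> B y -> h (X x * y) = - l * h (x * X y).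
Proof.
move=> lx /BP By; apply/eqP; rewrite mulNr -addr_eq0 addrC; apply/eqP.
by have := hX (x * y); rewrite (Xwt (oner_neq0 _) lx By) invr1 scale1r linearD linearZ.
Qed.
Let hYl l x y : wt l x -> B y -> h (Y x * y) = - l * h (x * Y y).
Proof.
move=> lx /BP By; apply/eqP; rewrite mulNr -addr_eq0 addrC; apply/eqP.
by have := hY (x * y); rewrite (Ywt (oner_neq0 _) lx By) invr1 scale1r linearD linearZ.
Qed.

(** A q-analogue of the area form dX dY; it takes values in the sphere because X
    and Y shift the weight in opposite ways. *)
Definition area x y := q *: (X x * Y y) - q^-1 *: (Y x * X y).

Let areaB x y : B x -> B y -> B (area x y).
Proof.
move=> Bx By; rewrite /area -scaleNr; apply: BD; apply: BZ.
- exact: BXY.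
- exact: BYX.
Qed.

Definition area_cochain x y z := h (x * area y z).

Let lincomb (a b c : F) : c = 0 -> a - b = c -> a = b.
Proof. by move=> -> /eqP; rewrite subr_eq0 => /eqP. Qed.

(** Expand h(Y(x X(y) z)) = 0 and h(X(x Y(y) z)) = 0 by the Leibniz rules.  The
    second order terms agree because X and Y commute on the sphere, and the
    difference of the two expansions is the claim. *)
Lemma area_cochain_rotate x y z : B x -> B y -> B z ->
  area_cochain x y z = area_cochain (theta z) x y.
Proof.
move=> Bx By Bz; rewrite /area_cochain -(hT (areaB Bx By) Bz).
have eY : h (Y (x * X y * z)) = q * h (x * (X y * Y z)) + h (x * Y (X y) * z)
    + q^-1 * h (Y x * X y * z).
  rewrite (Ywt (oner_neq0 _) (wtBl Bx (wtBX By)) ((BP z).1 Bz)).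
  rewrite (Ywt q0 ((BP x).1 Bx) (wtBX By)) !scale1r invr1 scale1r mulrDl.
  by rewrite !linearD !linearZ /= -scalerAl linearZ /= -!mulrA addrA.
have eX : h (X (x * Y y * z)) = q^-1 * h (x * (Y y * X z)) + h (x * X (Y y) * z)
    + q * h (X x * Y y * z).
  rewrite (Xwt (oner_neq0 _) (wtBl Bx (wtBY By)) ((BP z).1 Bz)).
  rewrite (Xwt qV0 ((BP x).1 Bx) (wtBY By)) !scale1r invr1 scale1r mulrDl invrK.
  by rewrite !linearD !linearZ /= -scalerAl linearZ /= -!mulrA addrA.
apply: (lincomb (c := h (Y (x * X y * z)) - h (X (x * Y y * z)))).
  by rewrite hX hY subr0.
rewrite eX eY XYC // /area !(mulrBr, mulrBl) -!scalerAr -!scalerAl.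
by rewrite !linearB !linearZ /=; ring.
Qed.

(** The derivation rules make the first three faces telescope to the product of
    the form of (a 0, a 1, a 2) with a 3, which the trace property moves to the
    front. *)
Lemma area_cocycle : cyclic_cocycle B theta (fun a : 'I_3 -> A => area_cochain (a 0) (a 1) (a 2)).
Proof.
split; first split.
- apply: multilinear2 => c x y u v Bx By Bu Bv; rewrite /area_cochain /area.
  + by rewrite mulrDl -scalerAl linearP.
  + rewrite !linearP !(mulrDl, mulrBr, mulrDr, =^~scalerAl, =^~scalerAr) /=.
    by rewrite !(linearP, linearB, linearZ, linearD) /=; ring.
  + rewrite !linearP !(mulrDl, mulrBr, mulrDr, =^~scalerAl, =^~scalerAr) /=.
    by rewrite !(linearP, linearB, linearZ, linearD) /=; ring.
- move=> a Ba; have [r0 r1 r2] := rotation2 theta a.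
  by rewrite r0 r1 r2 sqrrN expr1n mul1r area_cochain_rotate //; apply: Ba.
move=> a Ba; rewrite hochschild2 /area_cochain.
have [Ba0 Ba1 Ba2 Ba3] : [/\ B (a 0), B (a 1), B (a 2) & B (a 3)] by split; apply: Ba.
rewrite -[theta _ * _ * _]mulrA -[h (theta _ * _)]hT //; last by apply: BM => //; apply: areaB.
rewrite /area !(XB, YB) //.
rewrite !(scalerN, mulNr, mulrN, mulrDl, mulrBl, mulrBr, mulrDr, =^~scalerAl, =^~scalerAr).
rewrite !mulrA /=.
by rewrite !(linearN, linearB, linearZ, linearD) /=; ring.
Qed.

Variables (g G : A -> F).
Hypothesis gT : forall x y, B x -> B y -> g (x * y) = g (theta y * x).
Hypothesis GL : forall c x y, K x = q^-1 *: x -> K y = q^-1 *: y ->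
  G (c *: x + y) = c * G x + G y.
Hypothesis GY : forall x, B x -> G (Y x) = g x.
Hypothesis Gtheta : forall x m, B x -> K m = q^-1 *: m ->
  G (theta x * m) - G (m * x) = (q ^+ 2 - 1) * h (X (theta x) * m).

Let p := q - q^-1.

(** If X were (up to the factor q (q - 1/q)) the commutator with an element w
    and G the functional h(w m), then Gtheta would be the trace property of h;
    the formula below is the antisymmetric part of the cochain that bounds the
    area form in that situation. *)
Definition transgression x y :=
  q * h (X x * Y y) + p^-1 * (G (Y x * y) - G (x * Y y)).

Let GD x y : wt q^-1 x -> wt q^-1 y -> G (x + y) = G x + G y.
Proof. by move=> wx wy; have := GL 1 wx wy; rewrite scale1r mul1r. Qed.

Let GYM x y : B x -> B y -> G (x * Y y) + G (Y x * y) = g (x * y).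
Proof.
move=> Bx By; rewrite -(GY (BM Bx By)) YB // GD //.
- exact: wtBl (wtBY By).
- exact: wtBr (wtBY Bx) By.
Qed.

(** Both G(x Y(y)) + G(Y(x) y) and its rotated analogue equal g(xy), by the
    derivation rule and the trace property of g; the remaining discrepancy
    G(theta(y) Y(x)) - G(Y(x) y) is given by Gtheta and compensates the two
    equal terms q h(X(x) Y(y)). *)
Lemma transgression_rotate x y : B x -> B y ->
  transgression x y = - transgression (theta y) x.
Proof.
move=> Bx By; have Bty := thetaB By; rewrite /transgression.
have BXYx : B (X (Y x)) by apply/BXm/wtBY.
have e1 : q * h (X (theta y) * Y x) = q * h (X x * Y y).
  have := hXr qV0 Bty (wtBY Bx); rewrite invrK -[h (theta y * _)]hT // XYC //.
  by rewrite (hYl (wtBX Bx) By) !mulNr => /oppr_inj.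
have e2 := GYM Bx By; have e3 := GYM Bty Bx.
have e4 := Gtheta By (wtBY Bx); rewrite -gT // -e2 in e3.
have {}e4 : G (theta y * Y x) - G (Y x * y) = p * (q * h (X x * Y y)).
  by rewrite e4 -e1 /p; field.
apply: (lincomb (c := p^-1 * (2 * (p * (q * h (X x * Y y))
    - (G (theta y * Y x) - G (Y x * y)))
    + (G (theta y * Y x) + G (Y (theta y) * x) - (G (x * Y y) + G (Y x * y)))))).
  by rewrite e4 e3 !subrr mulr0 addr0 mulr0.
by rewrite e1; field.
Qed.

(** The terms with G reduce to twice G(x Y(y) z) - G(theta(z) x Y(y)), which
    Gtheta turns into an integral, plus g(xyz).  Integration by parts moves X
    from theta(z) to z and produces the second half of the area form. *)
Lemma transgression_boundary x y z : B x -> B y -> B z ->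
  transgression (x * y) z - transgression x (y * z) + transgression (theta z * x) y
  = area_cochain x y z + p^-1 * g (x * y * z).
Proof.
move=> Bx By Bz; have Btz := thetaB Bz.
have wYyz : wt q^-1 (x * Y y * z) by apply: wtBr => //; apply: wtBl => //; apply: wtBY.
have wxY : wt q^-1 (x * Y y) by apply: wtBl => //; apply: wtBY.
have e1 : q * h (X (theta z) * (x * Y y)) = q^-1 * h (x * Y y * X z).
  have := hXr qV0 Btz wxY; rewrite invrK -[h (theta z * _)]hT //; last exact: BXm.
  by rewrite (hXl wxY Bz) !mulNr => /oppr_inj.
have e2 := Gtheta Bz wxY.
have e3 := GYM (BM Btz Bx) By.
rewrite -[theta z * x * y]mulrA -gT // in e3; last exact: BM.
have e6 := hT (BXY Bx By) Bz.
have e4 : G (x * Y (y * z)) = G (x * y * Y z) + G (x * Y y * z).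
  rewrite YB // mulrDr GD ?mulrA //.
  by rewrite -mulrA; apply: wtBl => //; apply: wtBl => //; apply: wtBY.
have e5 : G (Y (x * y) * z) = G (x * Y y * z) + G (Y x * y * z).
  rewrite YB // mulrDl GD //.
  by apply: wtBr => //; apply: wtBr => //; apply: wtBY.
rewrite /transgression e4 e5.
rewrite !XB // YB //  !(mulrDl, mulrDr) !linearD /=.
rewrite /area_cochain /area mulrBr -!scalerAr linearB !linearZ /= !mulrA.
rewrite !mulrA in e1 e2 e3 e6.
have {}e2 : G (theta z * x * Y y) = G (x * Y y * z) + q * p * h (X (theta z) * x * Y y).
  by apply/eqP; rewrite addrC -subr_eq e2 /p; apply/eqP; field.
rewrite e6 -e3 e2 -e1; have p0 : p != 0 := q1.
by field.
Qed.

Lemma transgression_cyclic :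
  cyclic_cochain B theta (fun a : 'I_2 -> A => transgression (a 0) (a 1)).
Proof.
split.
- apply: multilinear1 => c x y u Bx By Bu; rewrite /transgression.
  + rewrite !linearP !(mulrDl, =^~scalerAl) linearP /=.
    by rewrite !GL; first (by ring); [apply: (wtBl _ (wtBY _))..
      |apply: (wtBr (wtBY _))|apply: (wtBr (wtBY _))].
  + rewrite !linearP !(mulrDr, =^~scalerAr) linearP /=.
    by rewrite !GL; first (by ring); [apply: (wtBl _ (wtBY _))..
      |apply: (wtBr (wtBY _))|apply: (wtBr (wtBY _))].
move=> a Ba; have [-> ->] := rotation1 theta a.
by rewrite expr1 mulN1r; apply: transgression_rotate; apply: Ba.
Qed.

Lemma area_cohomologous (e : A -> F) :
    scalar e -> (forall x y, B x -> B y -> e (x * y) = e (theta y * x)) ->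
    (forall x, g x = e x - h x) ->
  HC_eq B theta (fun a : 'I_3 -> A => area_cochain (a 0) (a 1) (a 2))
    (fun a => 2 / (q^-1 - q)
       * (periodicity0 (cochain0 h) a - periodicity0 (cochain0 e) a)).
Proof.
move=> eL eT ge; have p0 : p != 0 := q1.
have p0' : q^-1 - q = - p by rewrite opprB.
split; first exact: area_cocycle.
- pose f x := 2 / (q^-1 - q) * (h x - e x).
  rewrite (_ : (fun a => _) = periodicity0 (cochain0 f)); last first.
    by apply/funext => a; rewrite /periodicity0 /cochain0 /f; ring.
  apply: periodicity_cocycle; first exact: BM.
    by move=> c x y; rewrite /f hL eL; ring.
  by move=> x y Bx By; rewrite /f hT // eT.
exists (fun a : 'I_2 -> A => transgression (a 0) (a 1)).
  exact: transgression_cyclic.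
move=> a Ba; rewrite hochschild1 transgression_boundary; try exact: Ba.
rewrite /periodicity0 /cochain0 p0' ge.
by field.
Qed.
End Derivations.

(** * The actions on the Peter-Weyl basis *)

Lemma linear_rules (F : pzRingType) (V W : lmodType F) (f : V -> W) : linear f ->
  [/\ f 0 = 0, forall x y, f (x + y) = f x + f y & forall c x, f (c *: x) = c *: f x].
Proof.
move=> fL; have f0 : f 0 = 0.
  by have := fL (-1) 0 0; rewrite !scaleN1r oppr0 addr0 addNr.
split=> // [x y|c x]; first by have := fL 1 x y; rewrite !scale1r.
by have := fL c x 0; rewrite f0 !addr0.
Qed.

Section QuantumNumbers.
Variables (R : realType) (q : R).
Hypotheses (q_gt0 : 0 < q) (q_neq1 : q != 1).
Local Notation C := R[i].

Lemma qsub_neq0 : q - q^-1 != 0.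
Proof.
have q0 := lt0r_neq0 q_gt0.
rewrite subr_eq0; apply/eqP => /(congr1 ( *%R q)); rewrite mulfV // => /eqP.
by rewrite -expr2 sqrf_eq1 (negPf q_neq1) /= => /eqP qN; have := q_gt0; rewrite qN ltr0N1.
Qed.

(** Numerator and denominator both have the sign of ln q. *)
Lemma qnum_gt0 x : 0 < x -> 0 < qnum q x.
Proof.
move=> x0; have q0 := lt0r_neq0 q_gt0.
have sgn (y : R) : 0 < y -> 0 < (q `^ y - q `^ (- y)) * ln q.
  move=> y0; rewrite /powR !(negPf q0).
  have [q1|q1|q1] := ltgtP q 1.
  - have lq : ln q < 0 by rewrite ln_lt0 // q_gt0.
    by rewrite nmulr_lgt0 // subr_lt0 ltr_expR -subr_gt0; nra.
  - by have lq := ln_gt0 q1; rewrite pmulr_lgt0 // subr_gt0 ltr_expR; nra.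
  - by move: q_neq1; rewrite q1 eqxx.
have lnq : ln q != 0.
  by apply/eqP => l0; have := sgn 1 ltr01; rewrite l0 mulr0 ltxx.
have := sgn 1 ltr01; rewrite powRr1 ?ltW // powR_inv1 ?ltW //.
have := sgn x x0; rewrite /qnum; move: (q `^ x - _) (q - _) => u v ul vl.
have : 0 < (u * ln q) / (v * ln q) by rewrite divr_gt0.
by rewrite invfM mulrACA mulfV // mulr1.
Qed.

Lemma qnum0 : qnum q 0 = 0.
Proof. by rewrite /qnum oppr0 subrr mul0r. Qed.

Lemma qnum1 : qnum q 1 = 1.
Proof. by rewrite /qnum powRr1 ?ltW // powR_inv1 ?ltW // mulfV // qsub_neq0. Qed.

Lemma qnumN x : qnum q (- x) = - qnum q x.
Proof. by rewrite /qnum opprK -mulNr opprB. Qed.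

(** Complex from the start, since the powers of q are used as scalars. *)
Definition qpow (x : R) : C := (q `^ x)%:C.

Lemma qpowD x y : qpow (x + y) = qpow x * qpow y.
Proof. by rewrite /qpow powRD ?rmorphM //; apply/implyP => _; apply: lt0r_neq0. Qed.
Lemma qpow_neq0 x : qpow x != 0.
Proof. by rewrite /qpow fmorph_eq0 lt0r_neq0 // powR_gt0. Qed.
Lemma qpowN x : qpow (- x) = (qpow x)^-1.
Proof. by rewrite /qpow powRN fmorphV. Qed.
Lemma qpow0 : qpow 0 = 1.
Proof. by rewrite /qpow powRr0. Qed.
Lemma qpow1 : qpow 1 = q%:C.
Proof. by rewrite /qpow powRr1 // ltW. Qed.
Lemma qpowB x y : qpow (x - y) = qpow x / qpow y.
Proof. by rewrite qpowD qpowN. Qed.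
Lemma qpow_inj x y : qpow x = qpow y -> x = y.
Proof.
move=> xy; have /eqP : qpow (x - y) = 1 by rewrite qpowB xy mulfV // qpow_neq0.
rewrite /qpow fmorph_eq1 powR_eq1 (negPf q_neq1) ltNge ltW //= subr_eq0.
by move/eqP.
Qed.
Lemma qpow_half : qpow (1 / 2) * qpow (1 / 2) = q%:C.
Proof. by rewrite -qpowD -splitr qpow1. Qed.

Lemma weight_succ n (i j : nat) : j = i.+1 -> weight R n j = weight R n i + 1.
Proof. by move=> ->; rewrite /weight -[i.+1]addn1 natrD addrAC. Qed.

End QuantumNumbers.

Section Basis.
Variables (R : realType) (q : R).
Hypotheses (q_gt0 : 0 < q) (q_neq1 : q != 1).
Local Notation C := R[i].
Local Notation A := (SUq2 q).
Local Notation U := (Uqsu2 q).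
Local Notation Q := (q%:C).
Local Notation qpow := (@qpow R q).
Local Notation w := (weight R).
Variables (t : forall n, 'M[A]_n.+1) (ht : peter_weyl t).
Variables (h : A -> C) (hh : haar_state t h).
Variables (act del : U -> A -> A) (hact : left_action t act) (hdel : del_action t del).

Let cn (n : nat) : C := (Num.sqrt (qnum q n.+1%:R))%:C.

Lemma sqrt_qnum_neq0 n : cn n != 0.
Proof. by rewrite /cn fmorph_eq0 lt0r_neq0 // sqrtr_gt0 qnum_gt0 // ltr0n. Qed.

Let cnq_neq0 n x : cn n * qpow x != 0.
Proof. by apply: mulf_neq0; [apply: sqrt_qnum_neq0|apply: qpow_neq0]. Qed.

Lemma pw_vE n (j k : 'I_n.+1) : pw_v t j k = (cn n * qpow (w n j)) *: t n j k.
Proof. by rewrite /pw_v rmorphM. Qed.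

Lemma pw_tE n (j k : 'I_n.+1) : t n j k = (cn n * qpow (w n j))^-1 *: pw_v t j k.
Proof. by rewrite pw_vE scalerA mulVf ?scale1r // cnq_neq0. Qed.

Lemma actL f : linear (act f). Proof. by case: (act_repr hact). Qed.
Lemma delL f : linear (del f). Proof. by case: (del_repr hdel). Qed.
Lemma actM f g x : act (f * g) x = act f (act g x).
Proof. by case: (act_repr hact). Qed.
Lemma delM f g x : del (f * g) x = del f (del g x).
Proof. by case: (del_repr hdel). Qed.
Lemma act1 x : act 1 x = x. Proof. by case: (act_repr hact). Qed.
Lemma del1 x : del 1 x = x. Proof. by case: (del_repr hdel). Qed.

Let act_linear f : {linear A -> A} :=
  HB.pack (act f) (GRing.isLinear.Build C A A *:%R (act f) (actL f)).
#[local] Canonical act_linear.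
Let del_linear f : {linear A -> A} :=
  HB.pack (del f) (GRing.isLinear.Build C A A *:%R (del f) (delL f)).
#[local] Canonical del_linear.
#[local] HB.instance Definition _ := GRing.isLinear.Build C A C *%R h (haar_linear hh).

Lemma act_Kt n (j k : 'I_n.+1) : act (U_K q) (t n j k) = qpow (w n k) *: t n j k.
Proof.
rewrite pw_tE linearZ /= (act_K hact); move: (pw_v t j k) => v.
by rewrite !scalerA mulrC.
Qed.
Lemma del_Kt n (j k : 'I_n.+1) : del (U_K q) (t n j k) = qpow (- w n j) *: t n j k.
Proof.
rewrite pw_tE linearZ /= (del_K hdel); move: (pw_v t j k) => v.
by rewrite !scalerA mulrC.
Qed.
Lemma act_KiK x : act (U_Ki q) (act (U_K q) x) = x.
Proof. by rewrite -actM UKiKE act1. Qed.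
Lemma del_KiK x : del (U_Ki q) (del (U_K q) x) = x.
Proof. by rewrite -delM UKiKE del1. Qed.
Lemma act_Kit n (j k : 'I_n.+1) : act (U_Ki q) (t n j k) = qpow (- w n k) *: t n j k.
Proof.
rewrite -{2}(act_KiK (t n j k)) act_Kt linearZ /= scalerA -qpowD // addNr.
by rewrite qpow0 scale1r.
Qed.
Lemma del_Kit n (j k : 'I_n.+1) : del (U_Ki q) (t n j k) = qpow (w n j) *: t n j k.
Proof.
rewrite -{2}(del_KiK (t n j k)) del_Kt linearZ /= scalerA -qpowD // addrN.
by rewrite qpow0 scale1r.
Qed.

Lemma act_Et n (j k : 'I_n.+1) : act (U_E q) (t n j k) =
  \sum_(k' < n.+1 | k' == k.+1 :> nat) (alpha q n k)%:C *: t n j k'.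
Proof.
rewrite pw_tE linearZ /= (act_E hact) scaler_sumr; apply: eq_bigr => k' _.
by rewrite pw_vE !scalerA mulrC -mulrA mulfV ?mulr1 // cnq_neq0.
Qed.
Lemma act_Ft n (j k : 'I_n.+1) : act (U_F q) (t n j k) =
  \sum_(k' < n.+1 | k == k'.+1 :> nat) (alpha q n k')%:C *: t n j k'.
Proof.
rewrite pw_tE linearZ /= (act_F hact) scaler_sumr; apply: eq_bigr => k' _.
by rewrite pw_vE !scalerA mulrC -mulrA mulfV ?mulr1 // cnq_neq0.
Qed.
Lemma del_Et n (j k : 'I_n.+1) : del (U_E q) (t n j k) =
  \sum_(j' < n.+1 | j == j'.+1 :> nat) (- Q^-1 * (alpha q n j')%:C) *: t n j' k.
Proof.
rewrite pw_tE linearZ /= (del_E hdel) scaler_sumr; apply: eq_bigr => j' /eqP jj'.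
have -> : qpow (w n j) = qpow (w n j') * Q by rewrite (weight_succ _ _ jj') qpowD // qpow1.
have Q0 : Q != 0 by rewrite fmorph_eq0 lt0r_neq0.
have w0 := qpow_neq0 q_gt0 (w n j'); have c0 := sqrt_qnum_neq0 n.
by rewrite pw_vE !scalerA; congr (_ *: _); field; rewrite Q0 w0 c0.
Qed.
Lemma del_Ft n (j k : 'I_n.+1) : del (U_F q) (t n j k) =
  \sum_(j' < n.+1 | j' == j.+1 :> nat) (- Q * (alpha q n j)%:C) *: t n j' k.
Proof.
rewrite pw_tE linearZ /= (del_F hdel) scaler_sumr; apply: eq_bigr => j' /eqP jj'.
have wE : qpow (w n j') = qpow (w n j) * Q by rewrite (weight_succ _ _ jj') qpowD // qpow1.
have w0 := qpow_neq0 q_gt0 (w n j); have c0 := sqrt_qnum_neq0 n.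
by rewrite pw_vE wE !scalerA; congr (_ *: _); field; rewrite w0 c0.
Qed.

Lemma pw_eigen (T : A -> A) (lam : forall n, 'I_n.+1 -> 'I_n.+1 -> C) mu x :
    linear T -> (forall n j k, T (t n j k) = lam n j k *: t n j k) ->
    T x = mu *: x ->
  lspan (fun y => exists n j k, y = t n j k /\ lam n j k = mu) x.
Proof.
move=> TL Tt Tx.
have := @eigen_lspan _ _ T TL (fun l y => exists n j k, y = t n j k /\ lam n j k = l) mu x.
apply=> //; first by move=> l _ [n [j [k [-> <-]]]].
apply: lspan_sub (pw_lspan ht x) => _ [n [j [k ->]]].
by apply: lspan_mem; exists (lam n j k), n, j, k.
Qed.

Lemma del_K_eigen x c : del (U_K q) x = qpow c *: x ->
  lspan (fun y => exists n j k, y = t n j k /\ - w n j = c) x.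
Proof.
move=> Kx; have := pw_eigen (delL _) del_Kt Kx.
apply: lspan_sub => _ [n [j [k [-> /(qpow_inj q_gt0 q_neq1) wc]]]].
by apply: lspan_mem; exists n, j, k.
Qed.

(** The eigenvalues of del K are positive, so its square has no new fixed
    vectors. *)
Lemma podlesP x : podles_sphere del x <-> del (U_K q) x = x.
Proof.
rewrite /podles_sphere expr2 delM; split=> [KKx|Kx]; last by rewrite !Kx.
have KKt n (j k : 'I_n.+1) :
    (del (U_K q) \o del (U_K q)) (t n j k) = qpow (- w n j - w n j) *: t n j k.
  by rewrite /= del_Kt linearZ /= del_Kt scalerA qpowD.
have KKL : linear (del (U_K q) \o del (U_K q)) by move=> c u v /=; rewrite !linearP.
have := @pw_eigen _ (fun n j _ => qpow (- w n j - w n j)) (qpow 0) x KKL KKt.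
rewrite /= qpow0 scale1r => /(_ KKx).
apply: (lspan_linear (g := id) (delL _)) => [c u v //|].
move=> _ [n [j [k [-> wj]]]].
rewrite -(qpow0 q) in wj; have {}wj := qpow_inj q_gt0 q_neq1 wj.
have wj0 : w n j = 0 by lra.
by rewrite del_Kt wj0 oppr0 qpow0 scale1r.
Qed.

Lemma pw_t0 : t 0 0 0 = 1.
Proof. by rewrite (pw_trivial ht) !mxE. Qed.

Lemma haar_t n (j k : 'I_n.+1) : h (t n j k) = (n == 0)%:R.
Proof.
case: n j k => [|n] j k; last by rewrite (haarS hh).
by rewrite (ord1 j) (ord1 k) (haar0 hh).
Qed.

Lemma haar1 : h 1 = 1.
Proof. by rewrite -pw_t0 haar_t. Qed.

Lemma haar_unique (f : A -> C) : scalar f -> (forall n j k, f (t n j k) = (n == 0)%:R) ->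
  f =1 h.
Proof.
move=> fL ft; apply: (pw_scalar ht fL (haar_linear hh)) => n j k.
by rewrite haar_t ft.
Qed.

Lemma haar_del_E x : h (del (U_E q) x) = 0.
Proof.
apply: (pw_scalar ht (f := fun x => h (del (U_E q) x)) (g := fun=> 0)) => [c u v|c u v|].
- by rewrite !linearP.
- by rewrite mulr0 addr0.
move=> n j k; rewrite del_Et linear_sum /= big1 // => j' /eqP jj'.
rewrite linearZ /= haar_t; case: n j k j' jj' => [|n] j k j' jj'; rewrite ?mulr0 //.
by rewrite (ord1 j) in jj'.
Qed.

Lemma haar_del_F x : h (del (U_F q) x) = 0.
Proof.
apply: (pw_scalar ht (f := fun x => h (del (U_F q) x)) (g := fun=> 0)) => [c u v|c u v|].
- by rewrite !linearP.
- by rewrite mulr0 addr0.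
move=> n j k; rewrite del_Ft linear_sum /= big1 // => j' /eqP jj'.
rewrite linearZ /= haar_t; case: n j k j' jj' => [|n] j k j' jj'; rewrite ?mulr0 //.
by rewrite (ord1 j') in jj'.
Qed.

Lemma weight0 : w 0 0 = 0.
Proof. by rewrite /weight mul0r subrr. Qed.

Lemma haar_act_K x : h (act (U_K q) x) = h x.
Proof.
apply: (haar_unique (f := fun x => h (act (U_K q) x))) => [c u v|n j k]; first by rewrite !linearP.
rewrite act_Kt linearZ /= haar_t; case: n j k => [|n] j k; rewrite ?mulr0 //.
by rewrite (ord1 k) weight0 qpow0 mul1r.
Qed.

Lemma act_KiM x y : act (U_Ki q) (x * y) = act (U_Ki q) x * act (U_Ki q) y.
Proof.
have KKi z : act (U_K q) (act (U_Ki q) z) = z by rewrite -actM UKKiE act1.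
by rewrite -{1}(KKi x) -{1}(KKi y) -(act_KM hact) act_KiK.
Qed.

Let eps : A -> C := @SU_counit R q.
Let epsL : scalar eps. Proof. by move=> c x y; rewrite /eps /SU_counit linearP. Qed.
Let epsM x y : eps (x * y) = eps x * eps y.
Proof. by rewrite /eps /SU_counit rmorphM. Qed.
#[local] HB.instance Definition _ := GRing.isLinear.Build C A C *%R eps epsL.

Let epsZ c x : eps (c *: x) = c * eps x. Proof. by rewrite linearZ. Qed.

Let eps_t n (j k : 'I_n.+1) : eps (t n j k) = (j == k)%:R.
Proof. exact: pw_counit ht n j k. Qed.

Let eps1 : eps 1 = 1. Proof. by rewrite -pw_t0 eps_t. Qed.

Lemma act_K1 : act (U_K q) 1 = 1.
Proof. by rewrite -pw_t0 act_Kt weight0 qpow0 scale1r. Qed.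
Lemma act_Ki1 : act (U_Ki q) 1 = 1.
Proof. by rewrite -pw_t0 act_Kit weight0 oppr0 qpow0 scale1r. Qed.
Let act_E1 : act (U_E q) 1 = 0.
Proof. by rewrite -pw_t0 act_Et big1 // => i /eqP ik; rewrite (ord1 i) in ik. Qed.
Let act_F1 : act (U_F q) 1 = 0.
Proof. by rewrite -pw_t0 act_Ft big1 // => i /eqP ik; rewrite (ord1 i) in ik. Qed.

Let sum_diag n (c : 'I_n.+1 -> C) (j k : 'I_n.+1) :
  \sum_i (c i * (j == i)%:R) *: t n i k = c j *: t n j k.
Proof.
rewrite (bigD1 j) //= eqxx mulr1 big1 ?addr0 // => i ij.
by rewrite eq_sym (negPf ij) mulr0 scale0r.
Qed.

Let eps_Kt n (j i : 'I_n.+1) : eps (act (U_K q) (t n j i)) = qpow (w n i) * (j == i)%:R.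
Proof. by rewrite act_Kt linearZ /= eps_t. Qed.
Let eps_Kit n (j i : 'I_n.+1) : eps (act (U_Ki q) (t n j i)) = qpow (- w n i) * (j == i)%:R.
Proof. by rewrite act_Kit linearZ /= eps_t. Qed.

(* The convolution by eps o act f is a multiple of del g: the right and the left
   action come from the same functionals on the algebra. *)
Let del_derivation (f g : U) (c : C) :
    (forall x y, act f (x * y) = act f x * act (U_K q) y + act (U_Ki q) x * act f y) ->
    act f 1 = 0 -> c != 0 ->
    (forall n j k, c *: del g (t n j k) = \sum_i eps (act f (t n j i)) *: t n i k) ->
  [/\ forall x y, del (U_K q) (x * y) = del (U_K q) x * del (U_K q) y,
      forall x y, del (U_Ki q) (x * y) = del (U_Ki q) x * del (U_Ki q) y
    & forall x y, del g (x * y) = del (U_K q) x * del g y + del g x * del (U_Ki q) y].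
Proof.
move=> fM f1 c0 fg.
have compL k : scalar (eps \o act k) by move=> z u v /=; rewrite !linearP.
have [] := @convolution_derivation _ _ _ ht (eps \o act (U_Ki q)) (eps \o act (U_K q))
  (eps \o act f) (del (U_K q)) (del (U_Ki q)) (fun x => c *: del g x).
- exact: compL.
- exact: compL.
- exact: compL.
- by rewrite /= act_Ki1.
- by rewrite /= act_K1.
- by rewrite /= f1 linear0.
- by move=> x y; rewrite /= act_KiM epsM.
- by move=> x y; rewrite /= (act_KM hact) epsM.
- move=> x y; rewrite /= fM linearD addrC; congr (_ + _); exact: epsM.
- exact: delL.
- exact: delL.
- by move=> z u v; rewrite linearP scalerDr !scalerA mulrC.
- by move=> n j k; rewrite del_Kt; under eq_bigr do rewrite /= eps_Kit; rewrite sum_diag.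
- by move=> n j k; rewrite del_Kit; under eq_bigr do rewrite /= eps_Kt; rewrite sum_diag.
- exact: fg.
move=> KM KiM gM; split=> // x y; apply: (scalerI c0).
by rewrite gM scalerDr -scalerAr -scalerAl.
Qed.

Let Q0 : Q != 0. Proof. by rewrite fmorph_eq0 lt0r_neq0. Qed.

Let del_E_derivation :
  [/\ forall x y, del (U_K q) (x * y) = del (U_K q) x * del (U_K q) y,
      forall x y, del (U_Ki q) (x * y) = del (U_Ki q) x * del (U_Ki q) y
    & forall x y, del (U_E q) (x * y) =
        del (U_K q) x * del (U_E q) y + del (U_E q) x * del (U_Ki q) y].
Proof.
have c0 : - Q != 0 by rewrite oppr_eq0.
apply: (@del_derivation (U_E q) (U_E q) (- Q) (act_EM hact) act_E1 c0).
move=> n j k; rewrite del_Et scaler_sumr big_mkcond; apply: eq_bigr => i _.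
rewrite act_Et linear_sum /=; case: eqP => [ji|ji].
  rewrite (bigD1 j) ?ji //= epsZ eps_t eqxx mulr1 big1 => [|l /andP[]].
    by rewrite scalerA addr0; congr (_ *: _); field.
  by rewrite epsZ eps_t => _ /negPf lj; rewrite eq_sym lj mulr0.
rewrite big1 ?scale0r // => l /eqP li; rewrite epsZ eps_t.
by case: eqP => [jl|]; rewrite ?mulr0 //; case: ji; rewrite jl.
Qed.

Lemma del_FM x y : del (U_F q) (x * y) =
  del (U_K q) x * del (U_F q) y + del (U_F q) x * del (U_Ki q) y.
Proof.
have c0 : - Q^-1 != 0 by rewrite oppr_eq0 invr_eq0.
case: (@del_derivation (U_F q) (U_F q) (- Q^-1) (act_FM hact) act_F1 c0) => //.
move=> n j k; rewrite del_Ft scaler_sumr big_mkcond; apply: eq_bigr => i _.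
rewrite act_Ft linear_sum /=; case: eqP => [ij|ij].
  rewrite (bigD1 j) ?ij //= epsZ eps_t eqxx mulr1 big1 => [|l /andP[]].
    by rewrite scalerA addr0; congr (_ *: _); field.
  by rewrite epsZ eps_t => _ /negPf lj; rewrite eq_sym lj mulr0.
rewrite big1 ?scale0r // => l /eqP li; rewrite epsZ eps_t.
by case: eqP => [jl|]; rewrite ?mulr0 //; case: ij; rewrite jl.
Qed.

Lemma del_KM x y : del (U_K q) (x * y) = del (U_K q) x * del (U_K q) y.
Proof. by case: del_E_derivation. Qed.
Lemma del_KiM x y : del (U_Ki q) (x * y) = del (U_Ki q) x * del (U_Ki q) y.
Proof. by case: del_E_derivation. Qed.
Lemma del_EM x y : del (U_E q) (x * y) =
  del (U_K q) x * del (U_E q) y + del (U_E q) x * del (U_Ki q) y.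
Proof. by case: del_E_derivation. Qed.

(** The unit is the only matrix element of spin zero. *)
Lemma del_one : [/\ del (U_K q) 1 = 1, del (U_Ki q) 1 = 1, del (U_E q) 1 = 0
  & del (U_F q) 1 = 0].
Proof.
rewrite -pw_t0 del_Kt del_Kit del_Et del_Ft weight0 oppr0 qpow0 !scale1r.
by split=> //; rewrite big1 // => i; rewrite (ord1 i).
Qed.

Let del_lincomb z f g x : del (z *: f + g) x = z *: del f x + del g x.
Proof. by case: (del_repr hdel). Qed.
Let del0 x : del 0 x = 0.
Proof. by have := del_lincomb (-1) 0 0 x; rewrite !scaleN1r oppr0 addr0 addNr. Qed.
Let delZ z f x : del (z *: f) x = z *: del f x.
Proof. by have := del_lincomb z f 0 x; rewrite del0 !addr0. Qed.
Let delB f g x : del (f - g) x = del f x - del g x.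
Proof. by have := del_lincomb (-1) g f x; rewrite !scaleN1r ![- _ + _]addrC. Qed.

Lemma del_K_E x : del (U_K q) (del (U_E q) x) = Q *: del (U_E q) (del (U_K q) x).
Proof. by rewrite -!delM UKEE delZ. Qed.

Lemma del_K_F x : del (U_K q) (del (U_F q) x) = Q^-1 *: del (U_F q) (del (U_K q) x).
Proof.
rewrite -[del (U_F q) (del _ _)]delM UFKE delZ scalerA mulVf ?scale1r ?delM //.
Qed.

Lemma del_EF x : del (U_K q) x = x ->
  del (U_E q) (del (U_F q) x) = del (U_F q) (del (U_E q) x).
Proof.
move=> Kx; apply/eqP; rewrite -subr_eq0 -!delM -delB UEFE delZ delB !delM.
have Kix : del (U_Ki q) x = x by rewrite -{1}Kx del_KiK.
by rewrite !Kx !Kix subrr scaler0.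
Qed.

Lemma act_K_del_E x : act (U_K q) (del (U_E q) x) = del (U_E q) (act (U_K q) x).
Proof.
move: x; apply: (pw_linear ht) => [c u v|c u v|n j k]; rewrite ?linearP //.
rewrite act_Kt linearZ /= !del_Et linear_sum scaler_sumr /=; apply: eq_bigr => i _.
by rewrite linearZ /= act_Kt !scalerA mulrC.
Qed.

Lemma act_K_del_F x : act (U_K q) (del (U_F q) x) = del (U_F q) (act (U_K q) x).
Proof.
move: x; apply: (pw_linear ht) => [c u v|c u v|n j k]; rewrite ?linearP //.
rewrite act_Kt linearZ /= !del_Ft linear_sum scaler_sumr /=; apply: eq_bigr => i _.
by rewrite linearZ /= act_Kt !scalerA mulrC.
Qed.

Lemma act_K_del_K x : act (U_K q) (del (U_K q) x) = del (U_K q) (act (U_K q) x).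
Proof.
move: x; apply: (pw_linear ht) => [c u v|c u v|n j k]; rewrite ?linearP //.
by rewrite act_Kt del_Kt !linearZ /= act_Kt del_Kt !scalerA mulrC.
Qed.

Lemma act_Ki_del_K x : act (U_Ki q) (del (U_K q) x) = del (U_K q) (act (U_Ki q) x).
Proof.
move: x; apply: (pw_linear ht) => [c u v|c u v|n j k]; rewrite ?linearP //.
by rewrite act_Kit del_Kt !linearZ /= act_Kit del_Kt !scalerA mulrC.
Qed.

Lemma counit_act_K x : del (U_K q) x = x -> SU_counit (act (U_K q) x) = SU_counit x :> C.
Proof.
move=> Kx; have : del (U_K q) x = qpow 0 *: x by rewrite qpow0 scale1r.
move/del_K_eigen; apply: (lspan_linear (W := C^o) (f := eps \o act (U_K q)) (g := eps)).
- by move=> c u v /=; rewrite !linearP.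
- by move=> c u v; rewrite !linearP.
move=> _ [n [j [k [-> /eqP]]]]; rewrite oppr_eq0 => /eqP wj.
by rewrite /= eps_Kt eps_t; case: eqP => [<-|]; rewrite ?mulr0 // wj qpow0 mulr1.
Qed.

Let alpha_gt0 n (k : nat) : (k < n)%N -> 0 < alpha q n k.
Proof.
move=> kn; rewrite /alpha sqrtr_gt0 /weight.
have kn' : k%:R + 1 <= n%:R :> R by rewrite natr1 ler_nat.
have k0 : 0 <= k%:R :> R := ler0n _ _.
by rewrite mulr_gt0 // qnum_gt0 //; lra.
Qed.

(** On the row of weight 1 the coefficient alpha does not vanish, so each of its
    matrix elements is a multiple of del F applied to the row of weight 0. *)
Lemma del_F_onto m : del (U_K q) m = Q^-1 *: m ->
  exists2 x, del (U_K q) x = x & del (U_F q) x = m.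
Proof.
rewrite -qpow1 // -qpowN // => /del_K_eigen.
apply: (lspan_closed (Q := fun m => exists2 x, del (U_K q) x = x & del (U_F q) x = m)).
- by exists 0; rewrite linear0.
- move=> c _ _ [x Kx <-] [y Ky <-]; exists (c *: x + y); first by rewrite linearP /= Kx Ky.
  by rewrite linearP.
move=> _ [n [j [k [-> /oppr_inj wj]]]].
have j0 : (0 < j)%N.
  case: (j : nat) wj => // /eqP; rewrite /weight.
  by have : 0 <= n%:R :> R by []; move=> n0 /eqP; lra.
have j'P : (j.-1 < n.+1)%N by rewrite (leq_ltn_trans (leq_pred _)).
pose j' := Ordinal j'P.
have jj' : j = j'.+1 :> nat by rewrite /= prednK.
have al0 : - Q * (alpha q n j')%:C != 0.
  rewrite mulf_neq0 ?oppr_eq0 // fmorph_eq0 lt0r_neq0 // alpha_gt0 //.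
  by rewrite -jj' -ltnS.
exists ((- Q * (alpha q n j')%:C)^-1 *: t n j' k).
  rewrite linearZ /= del_Kt.
  have -> : w n j' = 0 by have := weight_succ R n jj'; rewrite wj; lra.
  by rewrite oppr0 qpow0 scale1r.
rewrite linearZ /= del_Ft (big_pred1 j) => [|i]; last by rewrite -jj'.
by rewrite scalerA mulVf ?scale1r.
Qed.

(** On the row of weight 0, del E o del F is the square of alpha, which vanishes
    for spin zero only. *)
Lemma del_F_kernel x : del (U_K q) x = x -> del (U_F q) x = 0 -> exists c, x = c *: 1.
Proof.
move=> Kx Fx.
have EFt n (j k : 'I_n.+1) : (del (U_E q) \o del (U_F q)) (t n j k) =
    ((alpha q n j)%:C ^+ 2 * (j < n)%:R) *: t n j k.
  rewrite /= del_Ft; have [jn|jn] := ltnP j n; last first.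
    rewrite big1 ?linear0 ?mulr0 ?scale0r // => i /eqP ij.
    by have := ltn_ord i; rewrite ij ltnS ltnNge jn.
  have j1 : (j.+1 < n.+1)%N by [].
  rewrite (big_pred1 (Ordinal j1)) // linearZ /= del_Et (big_pred1 j); last first.
    by move=> i /=; rewrite eqSS eq_sym.
  by rewrite mulr1 scalerA; congr (_ *: _); field.
have EFL : linear (del (U_E q) \o del (U_F q)) by move=> c u v /=; rewrite !linearP.
have : del (U_K q) x = qpow 0 *: x by rewrite qpow0 scale1r.
move/del_K_eigen => x_span.
pose S l y := exists n (j k : 'I_n.+1),
  [/\ y = t n j k, w n j = 0 & (alpha q n j)%:C ^+ 2 * (j < n)%:R = l].
have : lspan (S 0) x.
  apply: (eigen_lspan EFL) => [l _ [n [j [k [-> _ <-]]]]||]; rewrite ?EFt //.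
  - apply: lspan_sub x_span => _ [n [j [k [-> /eqP]]]]; rewrite oppr_eq0 => /eqP wj.
    by apply: lspan_mem; eexists; exists n, j, k.
  - by rewrite /= Fx linear0 scale0r.
apply: (lspan_closed (Q := fun x => exists c, x = c *: 1)) =>
  [|c y z [cy ->] [cz ->]|_ [n [j [k [-> wj /eqP]]]]].
- by exists 0; rewrite scale0r.
- by exists (c * cy + cz); rewrite scalerDl scalerA.
have [jn|jn] := ltnP j n; rewrite ?mulr1 ?mulr0.
  by rewrite expf_eq0 /= fmorph_eq0 gt_eqF // alpha_gt0.
have nj : n = j by apply/eqP; rewrite eqn_leq jn -ltnS ltn_ord.
move: wj; rewrite /weight -nj => /eqP wj _.
have /eqP : n%:R = 0 :> R by move/eqP: wj; lra.
rewrite pnatr_eq0 => /eqP n0; case: n j k n0 {nj jn wj} => // j k _.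
by exists 1; rewrite (ord1 j) (ord1 k) pw_t0 scale1r.
Qed.

Let r := qpow (1 / 2).

Let wt10 : w 1 0 = - (1 / 2). Proof. by rewrite /weight sub0r. Qed.
Let wt11 : w 1 1 = 1 / 2. Proof. by rewrite /weight; lra. Qed.

Let fundE : [/\ SU_a q = t 1 0 0, SU_b q = t 1 0 1, SU_c q = t 1 1 0 & SU_d q = t 1 1 1].
Proof. by case: (pw_fundamental ht). Qed.

Lemma del_K_gens : [/\ del (U_K q) (SU_a q) = r *: SU_a q,
  del (U_K q) (SU_b q) = r *: SU_b q, del (U_K q) (SU_c q) = r^-1 *: SU_c q
  & del (U_K q) (SU_d q) = r^-1 *: SU_d q].
Proof.
by case: fundE => -> -> -> ->; rewrite !del_Kt wt10 wt11 opprK qpowN.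
Qed.

Lemma act_K_gens : [/\ act (U_K q) (SU_a q) = r^-1 *: SU_a q,
  act (U_K q) (SU_b q) = r *: SU_b q, act (U_K q) (SU_c q) = r^-1 *: SU_c q
  & act (U_K q) (SU_d q) = r *: SU_d q].
Proof.
by case: fundE => -> -> -> ->; rewrite !act_Kt wt10 wt11 qpowN.
Qed.

Let alpha10 : alpha q 1 0 = 1.
Proof.
rewrite /alpha wt10 (_ : _ - _ = 1); last by lra.
by rewrite (_ : _ + 1 = 1); [rewrite qnum1 // mulr1 sqrtr1|lra].
Qed.

Lemma del_E_gens : [/\ del (U_E q) (SU_a q) = 0, del (U_E q) (SU_b q) = 0,
  del (U_E q) (SU_c q) = - Q^-1 *: SU_a q & del (U_E q) (SU_d q) = - Q^-1 *: SU_b q].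
Proof.
case: fundE => -> -> -> ->; rewrite !del_Et; split.
- by rewrite big1 // => i /eqP.
- by rewrite big1 // => i /eqP.
- rewrite (big_pred1 0) => [|i]; last by rewrite eq_sym.
  by rewrite alpha10 mulr1.
- rewrite (big_pred1 0) => [|i]; last by rewrite eq_sym.
  by rewrite alpha10 mulr1.
Qed.

Lemma del_F_gens : [/\ del (U_F q) (SU_a q) = - Q *: SU_c q,
  del (U_F q) (SU_b q) = - Q *: SU_d q,
  del (U_F q) (SU_c q) = 0 & del (U_F q) (SU_d q) = 0].
Proof.
case: fundE => -> -> -> ->; rewrite !del_Ft; split.
- by rewrite (big_pred1 1) => [|i]; rewrite ?alpha10 ?mulr1.
- by rewrite (big_pred1 1) => [|i]; rewrite ?alpha10 ?mulr1.
- by rewrite big1 // => i /eqP ik; have := ltn_ord i; rewrite ik.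
- by rewrite big1 // => i /eqP ik; have := ltn_ord i; rewrite ik.
Qed.
End Basis.

(** * Monomials in the generators *)

Section SkewPowers.
Variables (F : fieldType) (A : algType F).

Lemma skew_exprr (x y : A) l i : x * y = l *: (y * x) ->
  x * y ^+ i = l ^+ i *: (y ^+ i * x).
Proof.
move=> xy; elim: i => [|i IH]; first by rewrite !expr0 mulr1 mul1r scale1r.
rewrite [in LHS]exprSr mulrA IH -scalerAl -mulrA xy -scalerAr scalerA -exprSr.
by rewrite mulrA -exprSr.
Qed.
End SkewPowers.

Section PBW.
Variables (R : realType) (q : R).
Hypothesis (q_neq0 : q != 0).
Local Notation C := R[i].
Local Notation A := (SUq2 q).
Local Notation Q := (q%:C).
Local Notation a := (SU_a q).
Local Notation b := (SU_b q).
Local Notation c := (SU_c q).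
Local Notation d := (SU_d q).

Let Q0 : Q != 0. Proof. by rewrite fmorph_eq0. Qed.
Let QV : (q^-1)%:C = Q^-1. Proof. exact: fmorphV. Qed.

Lemma ad_bc : a * d = 1 + Q *: (b * c). Proof. exact: SUadE. Qed.
Lemma da_bc : d * a = 1 + Q^-1 *: (b * c). Proof. by rewrite SUdaE QV. Qed.
Lemma ba_comm : b * a = Q^-1 *: (a * b).
Proof. by rewrite SUabE scalerA mulVf // scale1r. Qed.
Lemma ca_comm : c * a = Q^-1 *: (a * c).
Proof. by rewrite SUacE scalerA mulVf // scale1r. Qed.
Lemma a_bc : a * (b * c) = Q ^+ 2 *: (b * c * a).
Proof. by rewrite mulrA SUabE -scalerAl -[b * a * c]mulrA SUacE -scalerAr scalerA mulrA. Qed.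
Lemma bc_a : b * c * a = Q ^- 2 *: (a * (b * c)).
Proof. by rewrite a_bc scalerA mulVf ?scale1r // expf_neq0. Qed.
Lemma bc_d : b * c * d = Q ^+ 2 *: (d * (b * c)).
Proof. by rewrite -mulrA SUcdE -scalerAr [b * (d * c)]mulrA SUbdE -scalerAl scalerA mulrA. Qed.
Lemma d_bc : d * (b * c) = Q ^- 2 *: (b * c * d).
Proof. by rewrite bc_d scalerA mulVf ?scale1r // expf_neq0. Qed.

Lemma bcXn n : b ^+ n * c ^+ n = (b * c) ^+ n.
Proof. by rewrite exprMn_comm //; apply: SUbcC. Qed.
Lemma bcX_b n : (b * c) ^+ n * b = b * (b * c) ^+ n.
Proof.
by apply/commr_sym/commrX; rewrite /GRing.comm -mulrA -SUbcC.
Qed.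
Lemma bcX_c n : (b * c) ^+ n * c = c * (b * c) ^+ n.
Proof. by apply/commr_sym/commrX; rewrite /GRing.comm mulrA -SUbcC. Qed.

Definition pbw_monomial (e : bool) i j k : A := (if e then d else a) ^+ i * b ^+ j * c ^+ k.

Let spanned : A -> Prop := lspan (fun y => exists e i j k, y = pbw_monomial e i j k).

Let spanned_mono e i j k : spanned (pbw_monomial e i j k).
Proof. by apply: lspan_mem; exists e, i, j, k. Qed.

(** The span of the monomials contains 1 and is stable under left
    multiplication by the generators: b and c commute with the other generators
    up to scalars, and the products ad and da are 1 plus a multiple of bc. *)
Lemma pbw_span x : spanned x.
Proof.
suff mul_spanned y : spanned y -> spanned (x * y).
  rewrite -[x]mulr1; apply: mul_spanned.
  by have := spanned_mono false 0 0 0; rewrite /pbw_monomial !expr0 !mulr1.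
have genP (g : A) : (forall e i j k, spanned (g * pbw_monomial e i j k)) ->
    forall y, spanned y -> spanned (g * y).
  move=> gP {}y; apply: (lspan_closed (Q := fun y => spanned (g * y))).
  - by rewrite mulr0; apply: lspan0.
  - by move=> l u v gu gv; rewrite mulrDr -scalerAr; apply: lspanD => //; apply: lspanZ.
  - by move=> _ [e [i [j [k ->]]]].
have shift e i j k : b * c * pbw_monomial e i j k =
    (if e then Q ^+ 2 else Q ^- 2) ^+ i *: pbw_monomial e i j.+1 k.+1.
  have bce : b * c * (if e then d else a) = (if e then Q ^+ 2 else Q ^- 2) *:
      ((if e then d else a) * (b * c)).
    by case: e; [apply: bc_d|apply: bc_a].
  rewrite /pbw_monomial !mulrA (skew_exprr _ bce) -!scalerAl -!mulrA; congr (_ *: (_ * _)).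
  rewrite [c * (_ * _)]mulrA [c * b ^+ j](_ : _ = b ^+ j * c); last first.
    by apply/commrX; rewrite /GRing.comm SUbcC.
  by rewrite !exprS !mulrA.
elim/palg_ind: x y => s; rewrite pi_eval.
elim: s => /= [x|l|s IHs s' IHs'|s IHs s' IHs'] y y_spanned.
- case: x; apply: genP y y_spanned => e i j k.
  + case: e i => [[|i]|i].
    * by have := spanned_mono false 1 j k; rewrite /pbw_monomial expr0 expr1 mul1r mulrA.
    * rewrite {1}/pbw_monomial exprS !mulrA ad_bc !mulrDl !mul1r -!scalerAl.
      apply: lspanD; first exact: (spanned_mono true).
      apply: lspanZ; have := shift true i j k; rewrite /pbw_monomial !mulrA => ->.
      by apply: lspanZ; apply: (spanned_mono true).
    * by have := spanned_mono false i.+1 j k; rewrite /pbw_monomial exprS !mulrA.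
  + have be : b * (if e then d else a) = (if e then Q else Q^-1) *: ((if e then d else a) * b).
      by case: e; [apply: SUbdE|apply: ba_comm].
    rewrite /pbw_monomial !mulrA (skew_exprr _ be) -!scalerAl -(mulrA _ b) -exprS.
    by apply: lspanZ; apply: spanned_mono.
  + have ce : c * (if e then d else a) = (if e then Q else Q^-1) *: ((if e then d else a) * c).
      by case: e; [apply: SUcdE|apply: ca_comm].
    rewrite /pbw_monomial !mulrA (skew_exprr _ ce) -!scalerAl -(mulrA _ c).
    rewrite [c * b ^+ j](_ : _ = b ^+ j * c); last first.
      by apply/commrX; rewrite /GRing.comm SUbcC.
    by rewrite -!mulrA -exprS mulrA; apply: lspanZ; apply: spanned_mono.
  + case: e i => [i|[|i]].
    * by have := spanned_mono true i.+1 j k; rewrite /pbw_monomial exprS !mulrA.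
    * by have := spanned_mono true 1 j k; rewrite /pbw_monomial expr0 expr1 mul1r mulrA.
    * rewrite {1}/pbw_monomial exprS !mulrA da_bc !mulrDl !mul1r -!scalerAl.
      apply: lspanD; first exact: (spanned_mono false).
      apply: lspanZ; have := shift false i j k; rewrite /pbw_monomial !mulrA => ->.
      by apply: lspanZ; apply: (spanned_mono false).
- by rewrite -scalerAl mul1r; apply: lspanZ.
- by rewrite mulrDl; apply: lspanD; [apply: IHs|apply: IHs'].
- by rewrite -mulrA; apply/IHs/IHs'.
Qed.
End PBW.

(** * The Haar state and the lowered functional on the sphere *)

Section Eigenvectors.
Variables (F : fieldType) (A : algType F) (f : A -> A).
Hypotheses (fM : forall x y, f (x * y) = f x * f y) (f1 : f 1 = 1).

Lemma eigenM l l' x y : f x = l *: x -> f y = l' *: y -> f (x * y) = (l * l') *: (x * y).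
Proof. by rewrite fM => -> ->; rewrite -scalerAl -scalerAr scalerA. Qed.

Lemma eigenX l x n : f x = l *: x -> f (x ^+ n) = l ^+ n *: x ^+ n.
Proof.
move=> fx; elim: n => [|n IH]; first by rewrite !expr0 f1 scale1r.
by rewrite !exprS; apply: eigenM.
Qed.
End Eigenvectors.

Section Sphere.
Variables (R : realType) (q : R).
Hypothesis (q_neq0 : q != 0).
Local Notation C := R[i].
Local Notation A := (SUq2 q).
Local Notation Q := (q%:C).
Local Notation a := (SU_a q).
Local Notation b := (SU_b q).
Local Notation c := (SU_c q).
Local Notation d := (SU_d q).
Hypothesis Q_tors : forall n, (0 < n)%N -> Q ^+ n != 1.
Variable r : C.
Hypothesis rr : r * r = Q.

Let Q0 : Q != 0. Proof. by rewrite fmorph_eq0. Qed.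
Let r0 : r != 0.
Proof. by apply/eqP => r0; have := Q0; rewrite -rr r0 mulr0 eqxx. Qed.

Let r_inj m n : r ^+ m = r ^+ n -> m = n.
Proof.
wlog mn : m n / (m <= n)%N => [hw|].
  by case: (leqP m n) => [|/ltnW] mn e; [|symmetry]; apply: hw.
rewrite -{1}(subnKC mn) exprD => /esym/eqP; rewrite -{2}[r ^+ m]mulr1.
rewrite (inj_eq (mulfI (expf_neq0 _ r0))) => /eqP rk.
apply/eqP; rewrite eqn_leq mn leqNgt -subn_gt0; apply/negP => /Q_tors/eqP.
by rewrite -rr -expr2 -exprM mulnC exprM rk expr1n; apply.
Qed.

(* K is the operator del K, and kr is the left action of K. *)
Variables K kr : A -> A.
Hypotheses (KL : linear K) (KM : forall x y, K (x * y) = K x * K y) (K1 : K 1 = 1).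
Hypotheses (krM : forall x y, kr (x * y) = kr x * kr y) (kr1 : kr 1 = 1).
Hypotheses (Ka : K a = r *: a) (Kb : K b = r *: b).
Hypotheses (Kc : K c = r^-1 *: c) (Kd : K d = r^-1 *: d).
Hypotheses (kra : kr a = r^-1 *: a) (krb : kr b = r *: b).
Hypotheses (krc : kr c = r^-1 *: c) (krd : kr d = r *: d).

Let z := b * c.

Let lab (e : bool) i j k : C :=
  if e then r ^+ j / r ^+ (i + k) else r ^+ (i + j) / r ^+ k.

Let K_mono e i j k : K (pbw_monomial q e i j k) = lab e i j k *: pbw_monomial q e i j k.
Proof.
have Ke : K (if e then d else a) = (if e then r^-1 else r) *: (if e then d else a).
  by case: e.
have KX := eigenX KM K1.
rewrite (eigenM KM (eigenM KM (KX _ _ i Ke) (KX _ _ j Kb)) (KX _ _ k Kc)).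
congr (_ *: _); rewrite /lab; case: e {Ke} => /=; rewrite ?exprD ?exprVn ?invfM //.
by rewrite mulrAC mulrC mulrA mulrAC.
Qed.

Let K_span l x : K x = l *: x ->
  lspan (fun y => exists e i j k, y = pbw_monomial q e i j k /\ lab e i j k = l) x.
Proof.
pose S l y := exists e i j k, y = pbw_monomial q e i j k /\ lab e i j k = l.
apply: (eigen_lspan KL (S := S)) => [_ _ [e [i [j [k [-> <-]]]]]|]; first exact: K_mono.
apply: lspan_sub (pbw_span q_neq0 x) => _ [e [i [j [k ->]]]].
by apply: lspan_mem; exists (lab e i j k), e, i, j, k.
Qed.

(* The weight of a monomial determines the balance of its exponents, because r is
   not a root of unity. *)
Let r_div m n k : r ^+ m / r ^+ n = r ^- k -> n = (m + k)%N.
Proof.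
move=> mnk; apply: r_inj; rewrite exprD.
have -> : r ^+ m = r ^- k * r ^+ n by rewrite -mnk divfK // expf_neq0.
by rewrite mulrAC mulVf ?mul1r // expf_neq0.
Qed.

Lemma sphere_span x : K x = x ->
  lspan (fun y => exists i j, y = a ^+ i * z ^+ j * c ^+ i \/ y = d ^+ i * b ^+ i * z ^+ j) x.
Proof.
move=> Kx; have {Kx} /K_span : K x = r ^- 0 *: x by rewrite expr0 invr1 scale1r.
apply: lspan_sub => _ [e [i [j [k [-> ]]]]]; rewrite /lab /pbw_monomial.
case: e => /r_div; rewrite addn0; [move=> <-|move=> ->]; apply: lspan_mem.
  by exists i, k; right; rewrite exprD mulrA -mulrA bcXn.
by exists i, j; left; rewrite addnC exprD -/z -bcXn !mulrA.
Qed.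

Lemma lowered_span x : K x = Q^-1 *: x ->
  lspan (fun y => (exists i j, y = a ^+ i * z ^+ j * c ^+ i * c ^+ 2) \/
     (exists j, y = d * z ^+ j * c) \/
     (exists i j, y = d ^+ 2 * d ^+ i * b ^+ i * z ^+ j)) x.
Proof.
move=> Kx; have {Kx} /K_span : K x = r ^- 2 *: x by rewrite Kx expr2 rr.
apply: lspan_sub => _ [e [i [j [k [-> ]]]]]; rewrite /lab /pbw_monomial.
case: e => /r_div; last first.
  move=> ->; apply: lspan_mem; left; exists i, j.
  by rewrite (addnC i j) !exprD -/z -bcXn !mulrA.
rewrite addn2; case: i => [|[|i]]; rewrite ?add0n ?add1n ?addSn; last first.
- move=> [<-]; apply: lspan_mem; right; right; exists i, k.
  by rewrite -[i.+2]/(2 + i)%N !exprD !mulrA -(mulrA _ (b ^+ k)) bcXn.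
- move=> [->]; apply: lspan_mem; right; left; exists j.
  by rewrite expr1 exprSr !mulrA -(mulrA d) bcXn.
move=> ->; apply: lspan_mem; left; exists 0%N, j.
by rewrite !expr0 !mul1r mulr1 -addn2 exprD mulrA bcXn.
Qed.

Let K_ac : K (a * c) = a * c.
Proof. by rewrite (eigenM KM Ka Kc) mulfV // scale1r. Qed.
Let K_z : K z = z.
Proof. by rewrite (eigenM KM Kb Kc) mulfV // scale1r. Qed.
Let K_bd : K (b * d) = b * d.
Proof. by rewrite (eigenM KM Kb Kd) mulfV // scale1r. Qed.
Let K_fix x y : K x = x -> K y = y -> K (x * y) = x * y.
Proof. by rewrite KM => -> ->. Qed.
Let K_fixX x n : K x = x -> K (x ^+ n) = x ^+ n.
Proof. by move=> Kx; elim: n => [|n IH]; rewrite ?expr0 // exprS K_fix. Qed.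

(** The monomials of weight 1 are, up to scalars, products of ac, bc and bd. *)
Lemma sphere_ind (P : A -> Prop) :
    P 0 -> (forall l x y, P x -> P y -> P (l *: x + y)) ->
    P 1 -> P (a * c) -> P (b * c) -> P (b * d) ->
    (forall x y, K x = x -> K y = y -> P x -> P y -> P (x * y)) ->
  forall x, K x = x -> P x.
Proof.
move=> P0 PL P1 Pac Pz Pbd PM x Kx.
pose Q' x := K x = x /\ P x.
have Q'M x' y : Q' x' -> Q' y -> Q' (x' * y).
  by move=> [Kx' Px'] [Ky Py]; split; [apply: K_fix|apply: PM].
have [K0 _ KZ] := linear_rules KL.
have Q'0 : Q' 0 by [].
have Q'L l x' y : Q' x' -> Q' y -> Q' (l *: x' + y).
  by move=> [Kx' Px'] [Ky Py]; split; [rewrite KL Kx' Ky|apply: PL].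
have Q'Z l x' : Q' x' -> Q' (l *: x') by move=> Qx; rewrite -[_ *: _]addr0; apply: Q'L.
have Q'z j : Q' (z ^+ j).
  by elim: j => [|j IH]; rewrite ?exprS; [split|apply: Q'M].
suff: Q' x by case.
apply: (lspan_closed (Q := Q')) (sphere_span Kx) => // _ [i [j [->|->]]].
- elim: i => [|i IH]; first by rewrite !expr0 mul1r mulr1.
  have -> : a ^+ i.+1 * z ^+ j * c ^+ i.+1 = Q ^+ i *: (a * c * (a ^+ i * z ^+ j * c ^+ i)).
    rewrite !mulrA -(mulrA a c) (skew_exprr _ (ca_comm q_neq0)) -scalerAr -!scalerAl.
    rewrite scalerA -exprMn mulfV // expr1n scale1r !mulrA -exprS.
    by rewrite -(mulrA _ c) -bcX_c mulrA -(mulrA _ c) -exprS.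
  by apply/Q'Z/Q'M.
- elim: i => [|i IH]; first by rewrite !expr0 !mul1r.
  have -> : d ^+ i.+1 * b ^+ i.+1 * z ^+ j = Q ^- i.+1 *: (b * d * (d ^+ i * b ^+ i * z ^+ j)).
    rewrite !mulrA -(mulrA b d) -exprS (skew_exprr _ (SUbdE q)) -!scalerAl.
    by rewrite scalerA mulVf ?expf_neq0 // scale1r -(mulrA _ b) -exprS.
  by apply/Q'Z/Q'M.
Qed.

Section Haar.
Variables (X Y theta : A -> A) (Ki : A -> A).
Hypotheses (XL : linear X) (YL : linear Y) (thetaL : linear theta).
Hypothesis KK : forall x, Ki (K x) = x.
Hypothesis KiL : linear Ki.
Hypotheses (XM : forall x y, X (x * y) = K x * X y + X x * Ki y).
Hypotheses (YM : forall x y, Y (x * y) = K x * Y y + Y x * Ki y).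
Hypotheses (Xa : X a = 0) (Xb : X b = 0) (Xc : X c = - Q^-1 *: a) (Xd : X d = - Q^-1 *: b).
Hypotheses (Yb : Y b = - Q *: d) (Yc : Y c = 0).
Hypotheses (thetaM : forall x y, theta (x * y) = theta x * theta y).
Hypotheses (theta1 : theta 1 = 1).
Hypotheses (thetaa : theta a = Q *: a) (thetab : theta b = Q^-1 *: b).
Hypotheses (thetac : theta c = Q *: c) (thetad : theta d = Q^-1 *: d).
Hypothesis thetaK : forall x, K x = x -> K (theta x) = theta x.
Variable h : A -> C.
Hypothesis hL : scalar h.
Hypotheses (hX : forall x, h (X x) = 0) (hkr : forall x, h (kr x) = h x).

#[local] HB.instance Definition _ := GRing.isLinear.Build C A A *:%R X XL.
#[local] HB.instance Definition _ := GRing.isLinear.Build C A A *:%R Y YL.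
#[local] HB.instance Definition _ := GRing.isLinear.Build C A A *:%R theta thetaL.
#[local] HB.instance Definition _ := GRing.isLinear.Build C A A *:%R K KL.
#[local] HB.instance Definition _ := GRing.isLinear.Build C A A *:%R Ki KiL.
#[local] HB.instance Definition _ := GRing.isLinear.Build C A C *%R h hL.

Let hD x y : h (x + y) = h x + h y. Proof. exact: linearD. Qed.
Let hB x y : h (x - y) = h x - h y. Proof. exact: linearB. Qed.
Let hZ l x : h (l *: x) = l * h x. Proof. exact: linearZ. Qed.
Let h0 : h 0 = 0. Proof. exact: linear0. Qed.

Let Ki_scale l x : l != 0 -> K x = l *: x -> Ki x = l^-1 *: x.
Proof.
by move=> l0 Kx; rewrite -{2}(KK x) Kx linearZ /= scalerA mulVf // scale1r.
Qed.
Let Ki_fix x : K x = x -> Ki x = x.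
Proof. by move=> Kx; rewrite -{1}Kx KK. Qed.
Let K_zX n : K (z ^+ n) = z ^+ n. Proof. exact: K_fixX. Qed.

Let a_zX n : a * z ^+ n = Q ^+ 2 ^+ n *: (z ^+ n * a).
Proof. exact/skew_exprr/a_bc. Qed.
Let d_zX n : d * z ^+ n = Q ^- 2 ^+ n *: (z ^+ n * d).
Proof. exact/skew_exprr/d_bc. Qed.

Let Xz : X z = - (Q^-1 * r) *: (b * a).
Proof.
by rewrite XM Kb Xb Xc mul0r addr0 -scalerAl -scalerAr scalerA mulrN mulrC.
Qed.
Let Yz : Y z = - r *: (c * d).
Proof.
have Kic := Ki_scale (invr_neq0 r0) Kc; rewrite invrK in Kic.
rewrite YM Kb Yb Yc mulr0 add0r Kic SUcdE -scalerAl -scalerAr scalerA.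
by rewrite [in RHS]scalerA mulNr mulNr mulrC.
Qed.

Let zb : z * b = b * z. Proof. by have := bcX_b q 1; rewrite expr1. Qed.
Let zc : z * c = c * z. Proof. by have := bcX_c q 1; rewrite expr1. Qed.
Let az : a * z = Q ^+ 2 *: (z * a). Proof. exact: a_bc. Qed.
Let dz : d * z = Q ^- 2 *: (z * d). Proof. exact: d_bc. Qed.
Let Xz_z : X z * z = Q ^+ 2 *: (z * X z).
Proof.
rewrite Xz -scalerAl -mulrA az -scalerAr mulrA -zb -[z * b * a]mulrA -!scalerAr.
by rewrite !scalerA mulrC.
Qed.
Let Yz_z : Y z * z = Q ^- 2 *: (z * Y z).
Proof.
rewrite Yz -scalerAl -mulrA dz -scalerAr mulrA -zc -[z * c * d]mulrA -!scalerAr.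
by rewrite !scalerA mulrC.
Qed.

(** A geometric sum, since X(z) and Y(z) commute with z up to a scalar. *)
Definition geom (l : C) n := \sum_(i < n) l ^+ i.

Let geomS l n : geom l n.+1 = l * geom l n + 1.
Proof.
rewrite /geom big_ord_recl expr0 addrC mulr_sumr; congr (_ + _).
by apply: eq_bigr => i _; rewrite exprS.
Qed.

Let XzS n : X (z ^+ n.+1) = geom (Q ^+ 2) n.+1 *: (z ^+ n * X z).
Proof.
elim: n => [|n IH]; first by rewrite expr1 expr0 mul1r geomS /geom big_ord0 mulr0 add0r scale1r.
rewrite exprSr XM K_zX (Ki_fix K_z) IH [geom _ n.+2]geomS scalerDl scale1r addrC; congr (_ + _).
by rewrite -scalerAl -mulrA Xz_z -scalerAr mulrA -exprSr scalerA mulrC.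
Qed.
Let YzS n : Y (z ^+ n.+1) = geom (Q ^- 2) n.+1 *: (z ^+ n * Y z).
Proof.
elim: n => [|n IH]; first by rewrite expr1 expr0 mul1r geomS /geom big_ord0 mulr0 add0r scale1r.
rewrite exprSr YM K_zX (Ki_fix K_z) IH [geom _ n.+2]geomS scalerDl scale1r addrC; congr (_ + _).
by rewrite -scalerAl -mulrA Yz_z -scalerAr mulrA -exprSr scalerA mulrC.
Qed.

Let m n := h (z ^+ n).
Let qp n := Q ^+ 2 ^+ n.
Let qp0 n : qp n != 0. Proof. by rewrite !expf_neq0. Qed.
Let qpS n : qp n.+1 = Q ^+ 2 * qp n. Proof. exact: exprS. Qed.
Let qp_neq1 n : qp n.+1 - 1 != 0.
Proof. by rewrite subr_eq0 /qp -exprM; apply: Q_tors. Qed.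
Let qq1 : Q ^+ 2 - 1 != 0. Proof. exact: (qp_neq1 0). Qed.

Let geomE n : geom (Q ^+ 2) n = (qp n - 1) / (Q ^+ 2 - 1).
Proof.
elim: n => [|n IH]; first by rewrite /geom big_ord0 /qp expr0 subrr mul0r.
by rewrite geomS IH qpS; field.
Qed.
Let geomVE n : geom (Q ^- 2) n.+1 = (qp n.+1 - 1) / (qp n * (Q ^+ 2 - 1)).
Proof.
elim: n => [|n IH].
  by rewrite geomS /geom big_ord0 qpS /qp expr0; field; rewrite qq1 Q0.
have u0 := qp0 n.
by rewrite geomS IH !qpS; field; rewrite qq1 u0 Q0.
Qed.

Let X1 : X 1 = 0.
Proof.
have := XM 1 1; rewrite K1 !mul1r (Ki_fix K1) mulr1 => /eqP.
by rewrite -subr_eq subrr eq_sym => /eqP.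
Qed.

Let Kicd : Ki (c * d) = Q *: (c * d).
Proof.
have -> : Q = (r^-1 * r^-1)^-1 by rewrite invfM invrK rr.
apply: Ki_scale; last exact: (eigenM KM Kc Kd).
by apply: mulf_neq0; apply: invr_neq0.
Qed.
Let Xcd : X (c * d) = - (Q^-1 * r) *: 1 - (Q^-1 * r^-1 + r) *: z.
Proof.
rewrite XM Kc Xd Xc (Ki_scale (invr_neq0 r0) Kd) invrK.
rewrite -!scalerAl -!scalerAr -SUbcC !scalerA ad_bc scalerDr addrCA scalerA -scalerDl.
rewrite mulNr -[X in _ = _ + X]scaleNr; congr (_ + _ *: _).
by field; rewrite r0 Q0.
Qed.
Let Xzcd : X z * (c * d) = - r *: (z + Q *: z ^+ 2).
Proof.
have -> : X z * (c * d) = - (Q^-1 * r) *: (b * (a * c) * d).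
  by rewrite Xz -scalerAl !mulrA.
rewrite SUacE -scalerAr -scalerAl; have -> : b * (c * a) * d = z * (a * d) by rewrite !mulrA.
rewrite ad_bc mulrDr mulr1 -scalerAr -expr2 scalerA; congr (_ *: _).
by field.
Qed.

(** This is h(X(z^n cd)) = 0: since ad = 1 + qz, the derivative is a combination
    of z^n and z^(n+1). *)
Lemma haar_moment_rec n :
  geom (Q ^+ 2) n.+1 * (m n + Q * m n.+1) = - Q^-1 * m n.+1.
Proof.
have := hX (z ^+ n * (c * d)).
have Xn : h (X (z ^+ n * (c * d))) = - (Q^-1 * r) * m n - (Q^-1 * r^-1 + r) * m n.+1
    - r * Q * geom (Q ^+ 2) n * (m n + Q * m n.+1).
  rewrite XM K_zX Kicd Xcd mulrBr -!scalerAr mulr1 -exprSr hD hB !hZ.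
  congr (_ + _); case: n => [|n].
    have -> : X (z ^+ 0) * (c * d) = 0 by rewrite expr0 X1; exact: mul0r.
    by rewrite h0 /geom big_ord0 !(mulr0, mul0r, oppr0).
  rewrite XzS -scalerAl -(mulrA (z ^+ n)) Xzcd -scalerAr mulrDr -scalerAr -exprD addn2 -exprSr.
  by rewrite !hZ hD hZ -/(m _) -/(m _); ring.
rewrite Xn => e; apply: (mulfI r0); apply: (mulfI (invr_neq0 Q0)).
rewrite geomS; apply/eqP; rewrite -subr_eq0; apply/eqP.
transitivity (- (- (Q^-1 * r) * m n - (Q^-1 * r^-1 + r) * m n.+1
    - r * Q * geom (Q ^+ 2) n * (m n + Q * m n.+1))); last by rewrite e oppr0.
by rewrite -rr; field; rewrite r0.
Qed.

Lemma haar_momentS n : m n.+1 = - Q * (qp n.+1 - 1) / (qp n.+2 - 1) * m n.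
Proof.
have := haar_moment_rec n; rewrite geomE => e.
have u0 := qp0 n; have D1 := qp_neq1 n; have D2 := qp_neq1 n.+1.
have {}e : Q^-1 * (Q ^+ 2 - 1) * m n.+1 = - ((qp n.+1 - 1) * (m n + Q * m n.+1)).
  apply: (mulfI (invr_neq0 qq1)); apply: oppr_inj; rewrite mulrN opprK.
  transitivity (- Q^-1 * m n.+1); last by rewrite -e; field.
  by field; rewrite qq1 Q0.
apply: (mulfI D2).
transitivity (Q * (Q * (qp n.+1 - 1) * m n.+1 + Q^-1 * (Q ^+ 2 - 1) * m n.+1)).
  by rewrite [qp n.+2]qpS; field.
by rewrite e; field.
Qed.

Let kr_z n : kr (z ^+ n) = 1 *: z ^+ n.
Proof.
have kz : kr z = 1 *: z by rewrite (eigenM krM krb krc) mulfV.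
by rewrite (eigenX krM kr1 n kz) expr1n.
Qed.
Let rVrV : r^-1 * r^-1 = Q^-1. Proof. by rewrite -invfM rr. Qed.
Let rVX i : r^-1 ^+ i * r^-1 ^+ i = Q^-1 ^+ i. Proof. by rewrite -exprMn rVrV. Qed.
Let kr_ac : kr (a * c) = Q^-1 *: (a * c).
Proof. by rewrite (eigenM krM kra krc) rVrV. Qed.
Let kr_bd : kr (b * d) = Q *: (b * d).
Proof. by rewrite (eigenM krM krb krd) rr. Qed.
Let kr_neg i j : kr (a ^+ i * z ^+ j * c ^+ i) = Q^-1 ^+ i *: (a ^+ i * z ^+ j * c ^+ i).
Proof.
have kX := eigenX krM kr1.
by rewrite (eigenM krM (eigenM krM (kX _ _ i kra) (kr_z j)) (kX _ _ i krc)) mulr1 rVX.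
Qed.
Let kr_pos i j : kr (d ^+ i * b ^+ i * z ^+ j) = Q ^+ i *: (d ^+ i * b ^+ i * z ^+ j).
Proof.
have kX := eigenX krM kr1.
rewrite (eigenM krM (eigenM krM (kX _ _ i krd) (kX _ _ i krb)) (kr_z j)) mulr1.
by rewrite -exprMn rr.
Qed.

Let h_weight x l : kr x = l *: x -> l != 1 -> h x = 0.
Proof.
move=> krx l1; have /eqP : h x - l * h x = 0 by rewrite -hZ -krx hkr subrr.
rewrite -{1}[h x]mul1r -mulrBl mulf_eq0 subr_eq0 eq_sym (negPf l1) /=.
by move/eqP.
Qed.

Let QV_tors n : (0 < n)%N -> Q^-1 ^+ n != 1.
Proof. by move=> n0; rewrite exprVn invr_eq1 Q_tors. Qed.

(* Both sides vanish when the product is not fixed by kr. *)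
Let h_skew x y l l1 l2 : kr x = l1 *: x -> kr y = l2 *: y -> l1 * l2 != 1 ->
  h (x * y) = l * h (y * x).
Proof.
move=> kx ky l12; rewrite (h_weight (eigenM krM kx ky) l12).
by rewrite (h_weight (eigenM krM ky kx)) ?mulr0 // mulrC.
Qed.

Let trace_gen y l : K y = y -> theta y = l *: y ->
    (forall i j, h (a ^+ i * z ^+ j * c ^+ i * y) = l * h (y * (a ^+ i * z ^+ j * c ^+ i))) ->
    (forall i j, h (d ^+ i * b ^+ i * z ^+ j * y) = l * h (y * (d ^+ i * b ^+ i * z ^+ j))) ->
  forall x, K x = x -> h (x * y) = h (theta y * x).
Proof.
move=> Ky ty hneg hpos x /sphere_span.
apply: (lspan_closed (Q := fun x => h (x * y) = h (theta y * x))).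
- by rewrite mul0r mulr0.
- by move=> k u v hu hv; rewrite mulrDl mulrDr -scalerAl -scalerAr !hD !hZ hu hv.
by move=> _ [i [j [->|->]]]; rewrite ty -scalerAl hZ.
Qed.

Let zX_a j : z ^+ j * a = (qp j)^-1 *: (a * z ^+ j).
Proof. by rewrite a_zX scalerA mulVf ?scale1r. Qed.

Let h_db_ac j : h (d * b * z ^+ j * (a * c)) = (qp j)^-1 * Q^-1 * (m j.+1 + Q^-1 * m j.+2).
Proof.
have -> : d * b * z ^+ j * (a * c) = d * b * (z ^+ j * a) * c by rewrite !mulrA.
have -> : d * b * (z ^+ j * a) * c = (qp j)^-1 *: (d * (b * a) * (z ^+ j * c)).
  by rewrite zX_a -scalerAr -scalerAl !mulrA.
rewrite ba_comm // bcX_c -scalerAr -scalerAl scalerA.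
have -> : d * (a * b) * (c * z ^+ j) = d * a * (z * z ^+ j) by rewrite !mulrA.
by rewrite da_bc // -exprS mulrDl mul1r -scalerAl -exprS hZ hD hZ.
Qed.
Let h_ac_db j : h (a * c * (d * b * z ^+ j)) = Q * (m j.+1 + Q * m j.+2).
Proof.
have -> : a * c * (d * b * z ^+ j) = a * (c * d) * b * z ^+ j by rewrite !mulrA.
have -> : a * (c * d) * b * z ^+ j = Q *: (a * d * (c * b * z ^+ j)).
  by rewrite SUcdE -scalerAr -!scalerAl !mulrA.
by rewrite -SUbcC ad_bc -exprS mulrDl mul1r -scalerAl -exprS hZ hD hZ.
Qed.
Let h_ac_bd j : h (a * z ^+ j * c * (b * d)) = qp j.+1 * (m j.+1 + Q * m j.+2).
Proof.
have -> : a * z ^+ j * c * (b * d) = a * (z ^+ j * (c * b)) * d by rewrite !mulrA.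
rewrite -SUbcC -exprSr a_zX -scalerAl -mulrA ad_bc mulrDr mulr1 -scalerAr -exprSr.
by rewrite hZ hD hZ.
Qed.
Let h_bd_ac j : h (b * d * (a * z ^+ j * c)) = m j.+1 + Q^-1 * m j.+2.
Proof.
have -> : b * d * (a * z ^+ j * c) = b * (d * a) * (z ^+ j * c) by rewrite !mulrA.
rewrite da_bc // bcX_c mulrDr mulr1 -scalerAr -zb mulrDl -scalerAl.
have -> : z * b * (c * z ^+ j) = z * (z * z ^+ j) by rewrite !mulrA.
by rewrite mulrA -!exprS hD hZ.
Qed.

(** The identity passes to products in y, so y may be ac, bc or bd.  For x a
    monomial, invariance under kr leaves one family of monomials for each y, and
    there the identity is a consequence of the recursion for the moments. *)
Lemma haar_twisted_trace x y : K x = x -> K y = y -> h (x * y) = h (theta y * x).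
Proof.
move=> Kx Ky; move: y Ky x Kx.
apply: sphere_ind.
- have t0 : theta 0 = 0 by exact: linear0.
  by move=> x _; rewrite mulr0 t0 mul0r.
- move=> l u v hu hv x Kx; rewrite linearP /= mulrDr mulrDl -scalerAl -scalerAr !hD !hZ.
  by rewrite hu ?hv.
- by move=> x _; rewrite theta1 mul1r mulr1.
- apply: (trace_gen (l := Q ^+ 2)) => //.
  + by rewrite thetaM thetaa thetac -scalerAl -scalerAr scalerA.
  + by move=> i j; apply: h_skew (kr_neg i j) kr_ac _; rewrite -exprSr QV_tors.
  + case=> [|[|i]] j.
    * by apply: h_skew (kr_pos 0 j) kr_ac _; rewrite expr0 mul1r (QV_tors (n := 1)).
    * rewrite !expr1 h_db_ac h_ac_db (haar_momentS j.+1).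
      have u0 := qp0 j; have D2 := qp_neq1 j.+1; have D3 := qp_neq1 j.+2.
      by rewrite !qpS in D2 D3 *; field; rewrite Q0 u0 D3.
    * apply: h_skew (kr_pos i.+2 j) kr_ac _.
      by rewrite exprSr -mulrA mulfV // mulr1 Q_tors.
- apply: (trace_gen (l := 1)); rewrite ?mulfV ?scale1r //.
  + by rewrite thetaM thetab thetac -scalerAl -scalerAr scalerA mulVf ?scale1r.
  + case=> [|i] j; first by rewrite !mulr1 !mul1r -exprS -exprSr.
    by apply: h_skew (kr_neg i.+1 j) (kr_z 1) _; rewrite mulr1 QV_tors.
  + case=> [|i] j; first by rewrite !mul1r -exprS -exprSr.
    by apply: h_skew (kr_pos i.+1 j) (kr_z 1) _; rewrite mulr1 Q_tors.
- apply: (trace_gen (l := Q ^- 2)) => //.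
  + by rewrite thetaM thetab thetad -scalerAl -scalerAr scalerA -invfM.
  + case=> [|[|i]] j.
    * by apply: h_skew (kr_neg 0 j) kr_bd _; rewrite expr0 mul1r (Q_tors (n := 1)).
    * rewrite !expr1 h_ac_bd h_bd_ac (haar_momentS j.+1).
      have u0 := qp0 j; have D2 := qp_neq1 j.+1; have D3 := qp_neq1 j.+2.
      by rewrite !qpS in D2 D3 *; field; rewrite Q0 D3.
    * apply: h_skew (kr_neg i.+2 j) kr_bd _.
      by rewrite exprSr -mulrA mulVf // mulr1 QV_tors.
  + by move=> i j; apply: h_skew (kr_pos i j) kr_bd _; rewrite -exprSr Q_tors.
- move=> u v Ku Kv hu hv x Kx.
  by rewrite mulrA hv ?K_fix // mulrA hu ?K_fix ?thetaK // thetaM mulrA.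
Qed.

Section Transgression.
Variables (g G : A -> C).
Hypothesis gz : forall n, g (z ^+ n.+1) = - h (z ^+ n.+1).
Hypothesis GL : forall l x y, K x = Q^-1 *: x -> K y = Q^-1 *: y ->
  G (l *: x + y) = l * G x + G y.
Hypothesis GY : forall x, K x = x -> G (Y x) = g x.
Hypothesis Gkr : forall x, K x = Q^-1 *: x -> G (kr x) = G x.
Hypothesis KX : forall x, K (X x) = Q *: X (K x).
Hypothesis krX : forall x, kr (X x) = X (kr x).

(* The weight of the vectors Y(x) with x in the sphere, where G is linear. *)
Let low x := K x = Q^-1 *: x.
Let low0 : low 0.
Proof. by rewrite /low linear0 scaler0. Qed.
Let lowD x y : low x -> low y -> low (x + y).
Proof. by rewrite /low linearD scalerDr => /= -> ->. Qed.
Let lowZ l x : low x -> low (l *: x).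
Proof. by rewrite /low linearZ /= => ->; rewrite !scalerA mulrC. Qed.
Let low_fixl x y : K x = x -> low y -> low (x * y).
Proof. by rewrite /low KM => -> ->; rewrite scalerAr. Qed.
Let low_fixr x y : low x -> K y = y -> low (x * y).
Proof. by rewrite /low KM => -> ->; rewrite scalerAl. Qed.
Let low_cd : low (c * d).
Proof. by rewrite /low (eigenM KM Kc Kd) rVrV. Qed.
Let low_c2 : low (c ^+ 2).
Proof. by rewrite /low (eigenX KM K1 _ Kc) expr2 rVrV. Qed.
Let low_d2 : low (d ^+ 2).
Proof. by rewrite /low (eigenX KM K1 _ Kd) expr2 rVrV. Qed.

Let GD x y : low x -> low y -> G (x + y) = G x + G y.
Proof. by move=> lx ly; have := GL 1 lx ly; rewrite scale1r mul1r. Qed.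
Let G0 : G 0 = 0.
Proof. by have := GL (-1) low0 low0; rewrite scaler0 addr0 mulN1r addNr. Qed.
Let GZ l x : low x -> G (l *: x) = l * G x.
Proof. by move=> lx; have := GL l lx low0; rewrite addr0 G0 addr0. Qed.

Let gam n := G (z ^+ n * (c * d)).
Let low_zcd n : low (z ^+ n * (c * d)).
Proof. exact: low_fixl. Qed.

Let geomV_neq0 n : geom (Q ^- 2) n.+1 != 0.
Proof. by rewrite geomVE mulf_neq0 // invr_neq0 // mulf_neq0. Qed.

(* Y(z^(n+1)) is a multiple of z^n cd, so G(Y(x)) = g(x) gives the moments of G. *)
Let gamE n : gam n = m n.+1 / (r * geom (Q ^- 2) n.+1).
Proof.
have T0 := geomV_neq0 n; have := GY (K_zX n.+1).
rewrite gz YzS Yz -scalerAr scalerA GZ // -/(gam n) -/(m n.+1) => e.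
by apply: oppr_inj; rewrite -mulNr -e; field; rewrite r0 T0.
Qed.

Let G_weight x l : low x -> kr x = l *: x -> l != 1 -> G x = 0.
Proof.
move=> lx krx l1; have /eqP : G x - l * G x = 0 by rewrite -GZ // -krx Gkr // subrr.
rewrite -{1}[G x]mul1r -mulrBl mulf_eq0 subr_eq0 eq_sym (negPf l1) /=.
by move/eqP.
Qed.

Let Gtwist y x := G (theta y * x) - G (x * y) = (Q ^+ 2 - 1) * h (X (theta y) * x).

Let G_skew y x l l1 l2 : K y = y -> low x -> theta y = l *: y ->
  kr x = l2 *: x -> kr y = l1 *: y -> l1 * l2 != 1 -> Gtwist y x.
Proof.
move=> Ky lx ty kx ky l12; rewrite /Gtwist ty -scalerAl.
have lxy : low (x * y) by apply: low_fixr.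
have lyx : low (y * x) by apply: low_fixl.
rewrite GZ // (G_weight lyx (eigenM krM ky kx)) // mulr0.
have l21 : l2 * l1 != 1 by rewrite mulrC.
rewrite (G_weight lxy (eigenM krM kx ky)) // subrr.
have krXy : kr (X y) = l1 *: X y by rewrite krX ky linearZ.
have -> : X (l *: y) = l *: X y by exact: linearZ.
by rewrite -scalerAl hZ (h_weight (eigenM krM krXy kx)) // mulr0 mulr0.
Qed.

Let lowered_neg i j : low (a ^+ i * z ^+ j * c ^+ i * c ^+ 2).
Proof.
apply: low_fixl => //; have KwX := eigenX KM K1.
rewrite !KM K_zX (KwX _ _ i Ka) (KwX _ _ i Kc) -!scalerAl -!scalerAr !scalerA.
by rewrite -exprMn ?mulVf ?mulfV // expr1n scale1r.
Qed.
Let lowered_mid j : low (d * z ^+ j * c).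
Proof.
by rewrite /low !KM K_zX Kc Kd -!scalerAl -!scalerAr !scalerA rVrV.
Qed.
Let lowered_pos i j : low (d ^+ 2 * d ^+ i * b ^+ i * z ^+ j).
Proof.
apply: low_fixr => //; rewrite -mulrA; apply: low_fixr => //; have KwX := eigenX KM K1.
rewrite !KM (KwX _ _ i Kb) (KwX _ _ i Kd) -!scalerAl -!scalerAr !scalerA.
by rewrite -exprMn ?mulVf ?mulfV // expr1n scale1r.
Qed.
Let kr_lneg i j : kr (a ^+ i * z ^+ j * c ^+ i * c ^+ 2) =
  Q^-1 ^+ i.+1 *: (a ^+ i * z ^+ j * c ^+ i * c ^+ 2).
Proof.
rewrite (eigenM krM (kr_neg i j) (eigenX krM kr1 2 krc)).
by rewrite [r^-1 ^+ 2]expr2 rVrV -exprSr.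
Qed.
Let kr_lmid j : kr (d * z ^+ j * c) = 1 *: (d * z ^+ j * c).
Proof. by rewrite (eigenM krM (eigenM krM krd (kr_z j)) krc) mulr1 mulfV. Qed.
Let kr_lpos i j : kr (d ^+ 2 * d ^+ i * b ^+ i * z ^+ j) =
  Q ^+ i.+1 *: (d ^+ 2 * d ^+ i * b ^+ i * z ^+ j).
Proof.
have -> : d ^+ 2 * d ^+ i * b ^+ i * z ^+ j = d ^+ 2 * (d ^+ i * b ^+ i * z ^+ j).
  by rewrite !mulrA.
rewrite (eigenM krM (eigenX krM kr1 2 krd) (kr_pos i j)).
by rewrite expr2 rr -exprS.
Qed.

Let cd_zX j : c * d * z ^+ j = (qp j)^-1 *: (z ^+ j * (c * d)).
Proof. by rewrite -[LHS]mulrA d_zX -scalerAr (mulrA c) -bcX_c -(mulrA _ c) exprVn. Qed.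
Let dcE : d * c = Q^-1 *: (c * d).
Proof. by rewrite SUcdE scalerA mulVf ?scale1r. Qed.

(* For y an eigenvector of theta the identity is linear in x, hence a matter of
   monomials. *)
Let Gtwist_gen y l : K y = y -> theta y = l *: y ->
    (forall i j, Gtwist y (a ^+ i * z ^+ j * c ^+ i * c ^+ 2)) ->
    (forall j, Gtwist y (d * z ^+ j * c)) ->
    (forall i j, Gtwist y (d ^+ 2 * d ^+ i * b ^+ i * z ^+ j)) ->
  forall x, low x -> Gtwist y x.
Proof.
move=> Ky ty Gneg Gmid Gpos x lx; suff: low x /\ Gtwist y x by case.
have Kty : K (theta y) = theta y by apply: thetaK.
apply: (lspan_closed (Q := fun x => low x /\ Gtwist y x)) (lowered_span lx).
- by split=> //; rewrite /Gtwist mulr0 mul0r subrr mulr0 h0 mulr0.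
- move=> k u v [lu Gu] [lv Gv]; split; first by apply: lowD => //; apply: lowZ.
  rewrite /Gtwist mulrDr mulrDl -!scalerAr -scalerAl.
  rewrite !GL; do ?[exact: low_fixl|exact: low_fixr].
  by rewrite mulrDr -scalerAr hD hZ mulrDr mulrCA -Gu -Gv; ring.
by move=> _ [[i [j ->]]|[[j ->]|[i [j ->]]]]; split.
Qed.

Let X_ac : X (a * c) = - (Q^-1 * r) *: (a ^+ 2).
Proof.
by rewrite XM Ka Xa Xc mul0r addr0 -scalerAl -scalerAr scalerA -expr2 mulrN mulrC.
Qed.
Let X_bd : X (b * d) = - (Q^-1 * r) *: (b ^+ 2).
Proof.
by rewrite XM Kb Xb Xd mul0r addr0 -scalerAl -scalerAr scalerA -expr2 mulrN mulrC.
Qed.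

Let ad_z : a * d = 1 + Q *: z. Proof. exact: ad_bc. Qed.
Let da_z : d * a = 1 + Q^-1 *: z. Proof. exact: da_bc. Qed.
Let G_zcd n k x : x = k *: (z ^+ n * (c * d)) -> G x = k * gam n.
Proof. by move=> ->; rewrite GZ. Qed.
Let G_zcd2 n k l x :
  x = k *: (z ^+ n * (c * d) + l *: (z ^+ n.+1 * (c * d))) ->
  G x = k * (gam n + l * gam n.+1).
Proof. by move=> ->; rewrite GZ ?GD ?GZ //; do ?[apply: lowD|apply: lowZ]. Qed.

Let G_ac_d2 j : G (a * c * (d ^+ 2 * z ^+ j)) = Q / qp j * (gam j + Q * gam j.+1).
Proof.
apply: G_zcd2.
have -> : a * c * (d ^+ 2 * z ^+ j) = a * (c * d) * (d * z ^+ j) by rewrite expr2 !mulrA.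
have -> : a * (c * d) * (d * z ^+ j) = Q *: (a * d * (c * d * z ^+ j)).
  by rewrite {1}SUcdE -scalerAr -scalerAl !mulrA.
by rewrite cd_zX ad_z -scalerAr scalerA mulrDl mul1r -scalerAl (mulrA z) -exprS.
Qed.
Let G_d2_ac j : G (d ^+ 2 * z ^+ j * (a * c)) =
  (Q * qp j ^+ 2)^-1 * (gam j + Q ^- 3 * gam j.+1).
Proof.
apply: G_zcd2.
have -> : d ^+ 2 * z ^+ j * (a * c) = d * (d * (z ^+ j * a)) * c by rewrite expr2 !mulrA.
rewrite zX_a -!scalerAr -scalerAl.
have -> : d * (d * (a * z ^+ j)) * c = d * (d * a) * (z ^+ j * c) by rewrite !mulrA.
rewrite da_z bcX_c mulrDr mulr1 -scalerAr dz mulrDl -!scalerAl.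
have -> : d * (c * z ^+ j) = Q^-1 *: (c * d * z ^+ j).
  by rewrite mulrA dcE -scalerAl.
have -> : z * d * (c * z ^+ j) = Q^-1 *: (z * (c * d * z ^+ j)).
  by rewrite -mulrA (mulrA d) dcE -!(scalerAl, scalerAr).
rewrite cd_zX -!scalerAr (mulrA z) -exprS !scalerDr !scalerA.
have u0 := qp0 j; congr (_ *: _ + _ *: _); field; rewrite ?Q0 ?u0 //.
Qed.
Let h_X_ac_d2 j : h (X (a * c) * (d ^+ 2 * z ^+ j)) =
  - (Q^-1 * r) * (m j + (Q + Q ^+ 3) * m j.+1 + Q ^+ 4 * m j.+2).
Proof.
rewrite X_ac -scalerAl hZ; congr (_ * _).
have -> : a ^+ 2 * (d ^+ 2 * z ^+ j) = a * (a * d) * (d * z ^+ j) by rewrite !expr2 !mulrA.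
rewrite ad_z mulrDr mulr1 -scalerAr az scalerA mulrDl -scalerAl.
have -> : z * a * (d * z ^+ j) = z * (a * d * z ^+ j) by rewrite !mulrA.
have -> : a * (d * z ^+ j) = a * d * z ^+ j by rewrite !mulrA.
rewrite ad_z mulrDl mul1r -scalerAl -exprS mulrDr -scalerAr -!exprS.
by rewrite !(hD, hZ) -!/(m _); ring.
Qed.

Let G_z_mid j : G (z * (d * z ^+ j * c)) = (Q * qp j)^-1 * gam j.+1.
Proof.
apply: G_zcd.
rewrite -(mulrA d) bcX_c (mulrA d) dcE -scalerAl -scalerAr cd_zX -scalerAr (mulrA z).
by rewrite -exprS scalerA invfM.
Qed.
Let G_mid_z j : G (d * z ^+ j * c * z) = (Q * qp j.+1)^-1 * gam j.+1.
Proof.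
apply: G_zcd.
rewrite -(mulrA _ c) -zc (mulrA _ z) -(mulrA d) -exprSr -(mulrA d) bcX_c (mulrA d) dcE.
by rewrite -scalerAl cd_zX scalerA invfM.
Qed.
Let h_X_z_mid j : h (X z * (d * z ^+ j * c)) = - (Q^-1 * r) * (m j.+1 + Q * m j.+2).
Proof.
rewrite Xz -scalerAl hZ; congr (_ * _).
have -> : b * a * (d * z ^+ j * c) = b * (a * d) * (z ^+ j * c) by rewrite !mulrA.
rewrite ad_z bcX_c mulrDr mulr1 -scalerAr -zb mulrDl -scalerAl.
have -> : z * b * (c * z ^+ j) = z * (z * z ^+ j) by rewrite !mulrA.
by rewrite mulrA -!exprS hD hZ.
Qed.

Let G_bd_c2 j : G (b * d * (z ^+ j * c ^+ 2)) = (Q ^+ 2 * qp j)^-1 * gam j.+1.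
Proof.
apply: G_zcd.
have -> : b * d * (z ^+ j * c ^+ 2) = b * (d * z ^+ j) * (c * c) by rewrite expr2 !mulrA.
rewrite d_zX -scalerAr -scalerAl.
have -> : b * (z ^+ j * d) * (c * c) = b * z ^+ j * (d * c) * c by rewrite !mulrA.
rewrite dcE -scalerAr -scalerAl -bcX_b.
have -> : z ^+ j * b * (c * d) * c = z ^+ j * z * (d * c) by rewrite !mulrA.
rewrite dcE -scalerAr -exprSr !scalerA; congr (_ *: _).
have u0 := qp0 j; rewrite exprVn -/(qp j); field; rewrite ?Q0 ?u0 //.
Qed.
Let G_c2_bd j : G (z ^+ j * c ^+ 2 * (b * d)) = 1 * gam j.+1.
Proof.
apply: G_zcd.
have -> : z ^+ j * c ^+ 2 * (b * d) = z ^+ j * c * (c * b) * d by rewrite expr2 !mulrA.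
rewrite -SUbcC scale1r -(mulrA _ c) -zc.
by rewrite exprSr !mulrA.
Qed.
Let h_X_bd_c2 j : h (X (b * d) * (z ^+ j * c ^+ 2)) = - (Q^-1 * r) * m j.+2.
Proof.
rewrite X_bd -scalerAl hZ; congr (_ * _).
have -> : b ^+ 2 * (z ^+ j * c ^+ 2) = b * (b * z ^+ j) * (c * c) by rewrite !expr2 !mulrA.
rewrite -bcX_b.
have -> : b * (z ^+ j * b) * (c * c) = b * (z ^+ j * z * c) by rewrite !mulrA.
by rewrite -exprSr bcX_c mulrA -exprS.
Qed.

Let geomVE' j : geom (Q ^- 2) j.+1 = (Q ^+ 2 * qp j - 1) / (qp j * (Q ^+ 2 - 1)).
Proof. by rewrite geomVE qpS. Qed.

Let theta_ac : theta (a * c) = Q ^+ 2 *: (a * c).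
Proof. by rewrite thetaM thetaa thetac -scalerAl -scalerAr scalerA. Qed.
Let theta_z : theta z = 1 *: z.
Proof. by rewrite thetaM thetab thetac -scalerAl -scalerAr scalerA mulVf. Qed.
Let theta_bd : theta (b * d) = Q ^- 2 *: (b * d).
Proof. by rewrite thetaM thetab thetad -scalerAl -scalerAr scalerA -invfM. Qed.
Let XZ l x : X (l *: x) = l *: X x. Proof. exact: linearZ. Qed.

Let Gtwist_ac j : Gtwist (a * c) (d ^+ 2 * z ^+ j).
Proof.
rewrite /Gtwist theta_ac XZ -!scalerAl hZ GZ; last by apply: low_fixl => //; apply: low_fixr.
rewrite G_ac_d2 G_d2_ac h_X_ac_d2 !gamE !haar_momentS !geomVE'.
have u0 := qp0 j; have D1 := qp_neq1 j; have D2 := qp_neq1 j.+1; have D3 := qp_neq1 j.+2.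
rewrite !qpS in D1 D2 D3 *; rewrite -rr in D1 D2 D3 *; have q1 := qq1; rewrite -rr in q1.
by field; rewrite ?r0 ?u0 ?D1 ?D2 ?D3 ?q1.
Qed.
Let Gtwist_z j : Gtwist z (d * z ^+ j * c).
Proof.
rewrite /Gtwist theta_z scale1r.
rewrite G_z_mid G_mid_z h_X_z_mid !gamE !haar_momentS !geomVE'.
have u0 := qp0 j; have D1 := qp_neq1 j; have D2 := qp_neq1 j.+1; have D3 := qp_neq1 j.+2.
rewrite !qpS in D1 D2 D3 *; rewrite -rr in D1 D2 D3 *; have q1 := qq1; rewrite -rr in q1.
by field; rewrite ?r0 ?u0 ?D1 ?D2 ?D3 ?q1.
Qed.
Let Gtwist_bd j : Gtwist (b * d) (z ^+ j * c ^+ 2).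
Proof.
rewrite /Gtwist theta_bd XZ -!scalerAl hZ GZ; last by apply: low_fixl => //; apply: low_fixl.
rewrite G_bd_c2 G_c2_bd h_X_bd_c2 !gamE !haar_momentS !geomVE'.
have u0 := qp0 j; have D1 := qp_neq1 j; have D2 := qp_neq1 j.+1; have D3 := qp_neq1 j.+2.
rewrite !qpS in D1 D2 D3 *; rewrite -rr in D1 D2 D3 *; have q1 := qq1; rewrite -rr in q1.
by field; rewrite ?r0 ?u0 ?D1 ?D2 ?D3 ?q1.
Qed.

(** Both sides are compatible with products in x: on the right by the derivation
    rule for X and the trace property of h.  For the generators ac, bc and bd,
    invariance under kr kills all monomials y except d^2 z^j, d z^j c and
    z^j c^2 respectively, where the moments of h and G decide. *)
Lemma lowered_functional_twisted x y : K x = x -> K y = Q^-1 *: y ->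
  G (theta x * y) - G (y * x) = (Q ^+ 2 - 1) * h (X (theta x) * y).
Proof.
move=> Kx ly; suff [_ /(_ y ly)] : K x = x /\ forall y, low y -> Gtwist x y by [].
move: x Kx {y ly}; have theta0 : theta 0 = 0 by exact: linear0.
have X0 : X 0 = 0 by exact: linear0.
apply: sphere_ind.
- split=> [|y _]; first exact: linear0.
  by rewrite /Gtwist theta0 X0 !(mul0r, mulr0) G0 h0 subrr mulr0.
- move=> k u v [Ku Gu] [Kv Gv]; split=> [|y ly]; first by rewrite linearP /= Ku Kv.
  have := Gu y ly; have := Gv y ly; rewrite /Gtwist; move: (Q ^+ 2 - 1) => kap.
  have -> : theta (k *: u + v) = k *: theta u + theta v by exact: linearP.
  have -> : X (k *: theta u + theta v) = k *: X (theta u) + X (theta v) by exact: linearP.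
  have Ktu := thetaK Ku; have Ktv := thetaK Kv.
  rewrite !mulrDr !mulrDl -!scalerAl -!scalerAr hD hZ.
  rewrite !GL; do ?[exact: low_fixl|exact: low_fixr].
  by move=> ev eu; rewrite mulrDr mulrCA -eu -ev; ring.
- split=> [//|y ly]; rewrite /Gtwist theta1 mul1r mulr1 subrr X1.
  by rewrite mul0r h0 mulr0.
- split=> //; apply: (Gtwist_gen K_ac theta_ac).
  + move=> i j; apply: (G_skew K_ac _ theta_ac (kr_lneg i j) kr_ac) => //.
    by rewrite -exprS QV_tors.
  + move=> j; apply: (G_skew K_ac _ theta_ac (kr_lmid j) kr_ac) => //.
    by rewrite mulr1 (QV_tors (n := 1)).
  + case=> [|i] j; first by rewrite !mulr1; apply: Gtwist_ac.
    apply: (G_skew K_ac _ theta_ac (kr_lpos i.+1 j) kr_ac) => //.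
    by rewrite exprS mulrA mulVf // mul1r Q_tors.
- split=> //; apply: (Gtwist_gen K_z theta_z).
  + move=> i j; apply: (G_skew K_z _ theta_z (kr_lneg i j) (kr_z 1)) => //.
    by rewrite mul1r QV_tors.
  + exact: Gtwist_z.
  + move=> i j; apply: (G_skew K_z _ theta_z (kr_lpos i j) (kr_z 1)) => //.
    by rewrite mul1r Q_tors.
- split=> //; apply: (Gtwist_gen K_bd theta_bd).
  + case=> [|i] j; first by rewrite !mul1r mulr1; apply: Gtwist_bd.
    apply: (G_skew K_bd _ theta_bd (kr_lneg i.+1 j) kr_bd) => //.
    by rewrite exprS mulrA mulfV // mul1r QV_tors.
  + move=> j; apply: (G_skew K_bd _ theta_bd (kr_lmid j) kr_bd) => //.
    by rewrite mulr1 (Q_tors (n := 1)).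
  + move=> i j; apply: (G_skew K_bd _ theta_bd (kr_lpos i j) kr_bd) => //.
    by rewrite -exprS Q_tors.
- move=> u v Ku Kv [_ Gu] [_ Gv]; split=> [|y ly]; first exact: K_fix.
  have Ktu := thetaK Ku; have Ktv := thetaK Kv.
  have e1 := Gu _ (low_fixl Ktv ly); have e2 := Gv _ (low_fixr ly Ku).
  have KXv : K (X (theta v) * y) = X (theta v) * y.
    by rewrite KM KX Ktv ly -scalerAl -scalerAr scalerA mulfV // scale1r.
  have e3 := haar_twisted_trace KXv Ku.
  rewrite /Gtwist in e1 e2; rewrite /Gtwist; move: (Q ^+ 2 - 1) e1 e2 => kap e1 e2.
  rewrite thetaM XM Ktu (Ki_fix Ktv) mulrDl hD.
  rewrite !mulrA in e1 e2 e3 *.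
  by rewrite mulrDr -e3 -e2 -e1; ring.
Qed.
End Transgression.
End Haar.
End Sphere.

(** * The pairing with the invariant projections *)

Section Pairing.
Variables (R : realType) (q : R).
Hypotheses (q_gt0 : 0 < q) (q_neq1 : q != 1).
Local Notation C := R[i].
Local Notation A := (SUq2 q).
Local Notation U := (Uqsu2 q).
Local Notation Q := (q%:C).
Local Notation qpow := (@qpow R q).
Local Notation w := (weight R).
Variables (t : forall n, 'M[A]_n.+1) (ht : peter_weyl t).
Variables (h : A -> C) (hh : haar_state t h).
Variables (act del : U -> A -> A) (hact : left_action t act) (hdel : del_action t del).
Variables (sigma : forall n, U -> 'M[C]_n.+1) (hsigma : action_matrices t act sigma).

Let star : A -> A := @SU_star R q.
Let r := qpow (1 / 2).

Let delD f x y : del f (x + y) = del f x + del f y.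
Proof. by have [_ ->] := linear_rules (delL hdel f). Qed.
Let delZ f c x : del f (c *: x) = c *: del f x.
Proof. by have [_ _ ->] := linear_rules (delL hdel f). Qed.
Let hZ c x : h (c *: x) = c * h x.
Proof. by have [_ _ ->] := linear_rules (haar_linear hh : linear (h : A -> C^o)). Qed.
Let hD x y : h (x + y) = h x + h y.
Proof. by have [_ ->] := linear_rules (haar_linear hh : linear (h : A -> C^o)). Qed.

Let starM x y : star (x * y) = star y * star x. Proof. exact: paliftM. Qed.
Let starD x y : star (x + y) = star x + star y. Proof. exact: paliftD. Qed.
Let starZ c x : star (c *: x) = conjc c *: star x. Proof. exact: paliftZ. Qed.
Let star1 : star 1 = 1. Proof. exact: palift1. Qed.
Let conj_real (x : R) : conjc x%:C = x%:C.
Proof. by rewrite /conjc /= oppr0. Qed.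
Let conj_qpow x : conjc (qpow x) = qpow x. Proof. exact: conj_real. Qed.
Let conjQV : conjc (Q^-1) = Q^-1. Proof. by rewrite -fmorphV conj_real. Qed.

Let Q0 : Q != 0. Proof. by rewrite fmorph_eq0 lt0r_neq0. Qed.

Let KM := del_KM q_gt0 q_neq1 ht hact hdel.
Let KiM := del_KiM q_gt0 q_neq1 ht hact hdel.
Let XM := del_EM q_gt0 q_neq1 ht hact hdel.
Let YM := del_FM q_gt0 q_neq1 ht hact hdel.

Definition star_compatible x :=
  [/\ del (U_K q) (star x) = star (del (U_Ki q) x),
      del (U_Ki q) (star x) = star (del (U_K q) x),
      del (U_E q) (star x) = - Q^-1 *: star (del (U_F q) x)
    & del (U_F q) (star x) = - Q *: star (del (U_E q) x)].

(** Since the star reverses products and exchanges del K with its inverse, the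
    four relations pass to products, and they hold for the generators. *)
Lemma star_del x : star_compatible x.
Proof.
have [Ka Kb Kc Kd] := del_K_gens q_gt0 q_neq1 ht hdel.
have [Xa Xb Xc Xd] := del_E_gens q_gt0 q_neq1 ht hdel.
have [Ya Yb Yc Yd] := del_F_gens q_gt0 q_neq1 ht hdel.
have r0 : r != 0 by apply: qpow_neq0.
have Kig (g : A) l : l != 0 -> del (U_K q) g = l *: g -> del (U_Ki q) g = l^-1 *: g.
  by move=> l0 Kg; rewrite -{2}(del_KiK hdel g) [del (U_K q) g]Kg delZ scalerA mulVf ?scale1r.
have Kia := Kig _ _ r0 Ka; have Kib := Kig _ _ r0 Kb.
have Kic := Kig _ _ (invr_neq0 r0) Kc; have Kid := Kig _ _ (invr_neq0 r0) Kd.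
have conjr : conjc r = r by apply: conj_qpow.
have conjrV : conjc r^-1 = r^-1 by rewrite /r -qpowN conj_qpow.
have sa : star (SU_a q) = SU_d q by apply: palift_gen.
have sb : star (SU_b q) = - Q *: SU_c q by rewrite -rmorphN; apply: palift_gen.
have sc : star (SU_c q) = - Q^-1 *: SU_b q.
  by rewrite -fmorphV -rmorphN; apply: palift_gen.
have sd : star (SU_d q) = SU_a q by apply: palift_gen.
have conjNQ : conjc (- Q) = - Q by rewrite rmorphN; congr (- _); apply: conj_real.
have conjNQV : conjc (- Q^-1) = - Q^-1 by rewrite rmorphN; congr (- _); apply: conjQV.
have s0 : star 0 = 0 by rewrite -[0 in LHS](scale0r 1) starZ rmorph0 scale0r.
have [K1 Ki1 X1 Y1] := del_one q_gt0 q_neq1 ht hdel.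
elim/palg_ind: x => s; rewrite pi_eval.
elim: s => /= [g|c|s [IK IKi IX IY] s' [JK JKi JX JY]|s [IK IKi IX IY] s' [JK JKi JX JY]].
- case: g; rewrite /star_compatible -/(SU_a q) -/(SU_b q) -/(SU_c q) -/(SU_d q);
    rewrite ?(sa, sb, sc, sd) ?delZ
      ?(Ka, Kb, Kc, Kd, Kia, Kib, Kic, Kid, Xa, Xb, Xc, Xd, Ya, Yb, Yc, Yd) ?starZ
      ?(sa, sb, sc, sd, s0) ?(conjr, conjrV, conjNQ, conjNQV) -/r ?conjr ?conjrV ?invrK
      ?scalerA ?scaler0.
  + by rewrite ?conjr; split=> //; congr (_ *: _); field; rewrite ?Q0 ?r0.
  + by rewrite ?conjr; split=> //; congr (_ *: _); field; rewrite ?Q0 ?r0.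
  + by rewrite ?conjr; split=> //; congr (_ *: _); field; rewrite ?Q0 ?r0.
  + by rewrite ?conjr; split=> //; congr (_ *: _); field; rewrite ?Q0 ?r0.
- rewrite /star_compatible !starZ star1 !delZ !(K1, Ki1, X1, Y1).
  by rewrite !scaler0 s0 !scaler0 !starZ star1.
- by rewrite /star_compatible !starD !delD !starD !scalerDr IK IKi IX IY JK JKi JX JY.
rewrite /star_compatible !starM !(KM, KiM, XM, YM) !starM !starD !starM.
rewrite IK IKi IX IY JK JKi JX JY !scalerDr -!scalerAl -!scalerAr.
by split=> //; rewrite addrC.
Qed.

Let v_orth n (i j k : 'I_n.+1) :
  h (star (pw_v t i j) * pw_v t i k) = (j == k)%:R.
Proof. by rewrite (haar_orthonormal hh) !eqxx. Qed.

(* Orthonormality of the v recovers the entries of sigma from the action. *)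
Let sigma_diag n f (mu : 'I_n.+1 -> C) :
    (forall k, act f (pw_v t ord0 k) = mu k *: pw_v t ord0 k) ->
  forall j k, sigma n f j k = (j == k)%:R * mu k.
Proof.
move=> fmu j k; have := congr1 (fun x => h (star (pw_v t ord0 j) * x)) (hsigma f ord0 k).
rewrite fmu -scalerAr hZ v_orth mulrC => ->.
rewrite mulr_sumr (big_morph h hD (_ : h 0 = 0)); last first.
  by have [->] := linear_rules (haar_linear hh : linear (h : A -> C^o)).
rewrite (bigD1 j) //= -scalerAr hZ v_orth eqxx mulr1 big1 ?addr0 // => i ij.
by rewrite -scalerAr hZ v_orth eq_sym (negPf ij) mulr0.
Qed.

Let act_Kv n (i k : 'I_n.+1) : act (U_K q) (pw_v t i k) = qpow (w n k) *: pw_v t i k.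
Proof. exact: act_K hact n i k. Qed.
Let act_Kiv n (i k : 'I_n.+1) : act (U_Ki q) (pw_v t i k) = qpow (- w n k) *: pw_v t i k.
Proof.
have := act_Kv i k; move: (pw_v t i k) => v Kv; rewrite -{2}(act_KiK hact v) Kv.
have [_ _ ->] := linear_rules (actL hact (U_Ki q)).
by rewrite scalerA -qpowD // addNr qpow0 scale1r.
Qed.
Let actZ f c x : act f (c *: x) = c *: act f x.
Proof. by have [_ _ ->] := linear_rules (actL hact f). Qed.

Let S_Ki : U_antipode (U_Ki q) = U_K q. Proof. exact: palift_gen. Qed.
Let S_K : U_antipode (U_K q) = U_Ki q. Proof. exact: palift_gen. Qed.

Let rho_Ki n j k : rho_circ sigma n (U_Ki q) j k = (j == k)%:R * qpow (w n k).
Proof.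
apply: (sigma_diag (mu := fun k => qpow (w n k))) => i.
by rewrite S_Ki UKiKE mul1r act_Kv.
Qed.
Let rho_K n j k : rho_circ sigma n (U_K q) j k = (j == k)%:R * qpow (- w n k).
Proof.
apply: (sigma_diag (mu := fun k => qpow (- w n k))) => i.
by rewrite S_K -mulrA UKiKE mulr1 act_Kiv.
Qed.
Let rho_Ki2 n j k : rho_circ sigma n (U_Ki q ^+ 2) j k = (j == k)%:R * qpow (w n k) ^+ 2.
Proof.
apply: (sigma_diag (mu := fun k => qpow (w n k) ^+ 2)) => i.
rewrite expr2 /U_antipode paliftM -/(U_antipode _) S_Ki mulrA UKiKE mul1r.
by rewrite (actM hact) act_Kv actZ act_Kv scalerA expr2.
Qed.

Let diag_mull n m (D : 'M[C]_n.+1) (mu : 'I_n.+1 -> C) (M : 'M[A]_(n.+1, m)) i j :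
    (forall i k, D i k = (i == k)%:R * mu k) ->
  (scalar_mx_alg q D *m M) i j = mu i *: M i j.
Proof.
move=> DE; rewrite mxE (bigD1 i) //= !mxE DE eqxx mul1r big1 ?addr0 => [|k ki].
  by rewrite -scalerAl mul1r.
by rewrite !mxE DE eq_sym (negPf ki) mul0r scale0r mul0r.
Qed.
Let diag_mulr n m (D : 'M[C]_n.+1) (mu : 'I_n.+1 -> C) (M : 'M[A]_(m, n.+1)) i j :
    (forall i k, D i k = (i == k)%:R * mu k) ->
  (M *m scalar_mx_alg q D) i j = mu j *: M i j.
Proof.
move=> DE; rewrite mxE (bigD1 j) //= !mxE DE eqxx mul1r big1 ?addr0 => [|k ki].
  by rewrite -scalerAr mulr1.
by rewrite !mxE DE (negPf ki) mul0r scale0r mulr0.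
Qed.

Lemma projectionE N i j : projection t sigma N i j =
  (qpow (w `|N| i) * qpow (- w `|N| j)) *:
    (star (t `|N| (extremal N) i) * t `|N| (extremal N) j).
Proof.
rewrite /projection (diag_mulr _ _ _ (rho_K (n := _))) -!mulmxA.
rewrite (diag_mull _ _ _ (rho_Ki (n := _))) scalerA mulrC; congr (_ *: _).
by rewrite !mxE big_ord1 !mxE.
Qed.

Let unit_sum n (i j : 'I_n.+1) : \sum_k t n i k * star (t n j k) = (i == j)%:R.
Proof.
have /matrixP/(_ i j) := pw_unitaryr ht n; rewrite !mxE => <-.
by apply: eq_bigr => k _; rewrite !mxE.
Qed.

Lemma projection_sphere N i j : podles_sphere del (projection t sigma N i j).
Proof.
apply/(podlesP q_gt0 q_neq1 ht hdel).
have [Ks _ _ _] := star_del (t `|N| (extremal N) i).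
rewrite projectionE delZ KM Ks (del_Kit q_gt0 q_neq1 hdel) (del_Kt q_gt0 q_neq1 hdel).
congr (_ *: _); rewrite starZ conj_qpow -scalerAl -scalerAr scalerA.
by rewrite -(qpowD q_gt0) addrN qpow0 scale1r.
Qed.

Let tau_form (x y z : A) := h (x * (Q *: (del (U_E q) y * del (U_F q) z)
  - (q^-1)%:C *: (del (U_F q) y * del (U_E q) z))).

Let h0 : h 0 = 0.
Proof. by have [->] := linear_rules (haar_linear hh : linear (h : A -> C^o)). Qed.
Let hN x : h (- x) = - h x. Proof. by rewrite -scaleN1r hZ mulN1r. Qed.
Let h_sum (I : Type) (s : seq I) (f : I -> A) : h (\sum_(i <- s) f i) = \sum_(i <- s) h (f i).
Proof. exact: (big_morph h hD h0). Qed.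

Let tau_formZ c1 c2 c3 x y z :
  tau_form (c1 *: x) (c2 *: y) (c3 *: z) = c1 * c2 * c3 * tau_form x y z.
Proof.
have e f g : del f (c2 *: y) * del g (c3 *: z) = (c2 * c3) *: (del f y * del g z).
  by rewrite !delZ -scalerAl -scalerAr scalerA.
rewrite /tau_form !e ![_ *: ((c2 * c3) *: _)]scalerA ![_ * (c2 * c3)]mulrC -!scalerA -!scalerBr.
by rewrite scalerA -scalerAl -scalerAr !hZ; ring.
Qed.

Section Row.
Variables (n : nat) (e e' : 'I_n.+1).
Hypothesis ee' : e != e'.
Let x := t n e.
Let y := t n e'.
Let p i j := star (x i) * x j.

(* x and y are rows of a unitary matrix. *)
Let collapse i :
  \sum_j \sum_k p i j * (star (x j) * y k * (star (y k) * x i)) = p i i.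
Proof.
transitivity (star (x i) * ((\sum_j x j * star (x j)) * (\sum_k y k * star (y k))) * x i).
  rewrite big_distrlr /= mulr_sumr mulr_suml; apply: eq_bigr => j _.
  rewrite mulr_sumr mulr_suml; apply: eq_bigr => k _.
  by rewrite /p !mulrA.
by rewrite !unit_sum !eqxx !mulr1.
Qed.

Let collapse0 i :
  \sum_j \sum_k p i j * (star (y j) * x k * (star (x k) * y i)) = 0.
Proof.
transitivity (star (x i) * ((\sum_j x j * star (y j)) * (\sum_k x k * star (x k))) * y i).
  rewrite big_distrlr /= mulr_sumr mulr_suml; apply: eq_bigr => j _.
  rewrite mulr_sumr mulr_suml; apply: eq_bigr => k _.
  by rewrite /p !mulrA.
by rewrite !unit_sum (negPf ee') mul0r mulr0 mul0r.
Qed.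

Let s := qpow (w n e).
Let qn := (qnum q n.+1%:R)%:C : C.

Let haar_norm i : h (p i i) = (qn * s ^+ 2)^-1.
Proof.
have conjE : conjc ((Num.sqrt (qnum q n.+1%:R))%:C * s) =
    (Num.sqrt (qnum q n.+1%:R))%:C * s.
  by rewrite rmorphM; congr (_ * _); [apply: conj_real|apply: conj_qpow].
have := v_orth e i i; rewrite pw_vE starZ conjE -scalerAl -scalerAr scalerA hZ eqxx.
have <- : (Num.sqrt (qnum q n.+1%:R))%:C ^+ 2 = qn.
  by rewrite -rmorphXn /= sqr_sqrtr // ltW // qnum_gt0 // ltr0n.
have c0 := sqrt_qnum_neq0 q_gt0 q_neq1 n; have s0 : s != 0 by apply: qpow_neq0.
rewrite -/s -/(p i i) => e1; apply: (mulfI (mulf_neq0 (mulf_neq0 c0 s0) (mulf_neq0 c0 s0))).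
by rewrite e1 mulr1n; field; rewrite s0 c0.
Qed.

(* The quantum dimension of the representation of spin n/2. *)
Let sum_weights : \sum_(i < n.+1) qpow (w n i) ^+ 2 = qn.
Proof.
have QQ : Q ^+ 2 - 1 != 0.
  have : Q - Q^-1 != 0 by rewrite -fmorphV -rmorphB fmorph_eq0 qsub_neq0.
  apply: contra_neq => /eqP; rewrite subr_eq0 => /eqP QQ.
  by apply/eqP; rewrite subr_eq0; apply/eqP/(mulfI Q0); rewrite -expr2 QQ mulfV.
have term (i : nat) : qpow (w n i) ^+ 2 = qpow (- n%:R) * Q ^+ 2 ^+ i.
  have -> : Q ^+ 2 ^+ i = qpow i%:R ^+ 2.
    by rewrite -exprM mulnC exprM; congr (_ ^+ 2); rewrite /qpow powR_mulrn ?ltW // rmorphXn.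
  rewrite !expr2 -!qpowD //; congr (qpow _); rewrite /weight; lra.
under eq_bigr do rewrite term.
rewrite -mulr_sumr; apply: (mulfI QQ); rewrite mulrCA -subrX1.
rewrite /qn /qnum rmorphM rmorphB fmorphV rmorphB fmorphV /= -!/(qpow _).
have QE : Q ^+ 2 ^+ n.+1 = qpow n.+1%:R ^+ 2.
  by rewrite -exprM mulnC exprM; congr (_ ^+ 2); rewrite /qpow powR_mulrn ?ltW // rmorphXn.
have nE : qpow (- n%:R) = Q / qpow n.+1%:R.
  by rewrite -qpow1 // -qpowB //; congr (qpow _); rewrite -natr1; lra.
have u0 : qpow n.+1%:R != 0 by apply: qpow_neq0.
by rewrite QE nE qpowN //; field; rewrite u0 Q0 QQ.
Qed.

Let mul_scale (k l : C) (u v : A) : (k *: u) * (l *: v) = (k * l) *: (u * v).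
Proof. by rewrite -scalerAl -scalerAr scalerA. Qed.

Let trace_sum (c1 : C) (f : 'I_n.+1 -> A) :
    (forall i, f i = c1 *: p i i) ->
  \sum_(i < n.+1) qpow (w n i) ^+ 2 * h (f i) = c1 / s ^+ 2.
Proof.
move=> fE; under eq_bigr do rewrite fE hZ haar_norm mulrC.
rewrite -mulr_sumr sum_weights; have s0 : s != 0 by apply: qpow_neq0.
have qn0 : qn != 0 by rewrite fmorph_eq0 gt_eqF // qnum_gt0 // ltr0n.
by field; rewrite qn0 s0.
Qed.

(** In the first term of tau the inner sums are those of orthonormal rows; in the
    second one x meets y and they vanish. *)
Lemma sum_tau_top c1 c2 :
    (forall i j, del (U_E q) (p i j) = c1 *: (star (x i) * y j)) ->
    (forall i j, del (U_F q) (p i j) = c2 *: (star (y i) * x j)) ->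
  \sum_(i < n.+1) \sum_j \sum_k qpow (w n i) ^+ 2 * tau_form (p i j) (p j k) (p k i) =
  Q * c1 * c2 / s ^+ 2.
Proof.
move=> Xp Yp; rewrite -(trace_sum (f := fun i => (Q * c1 * c2) *: p i i)) //.
apply: eq_bigr => i _; rewrite -[in RHS]collapse scaler_sumr h_sum mulr_sumr.
have e0 : \sum_j \sum_k h (p i j * (star (y j) * x k * (star (x k) * y i))) = 0.
  by under eq_bigr do rewrite -h_sum; rewrite -h_sum collapse0 h0.
transitivity (\sum_j \sum_k (qpow (w n i) ^+ 2 * h ((Q * c1 * c2) *:
    (p i j * (star (x j) * y k * (star (y k) * x i)))) -
    qpow (w n i) ^+ 2 * (q^-1)%:C * c1 * c2 *
      h (p i j * (star (y j) * x k * (star (x k) * y i))))).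
  apply: eq_bigr => j _; apply: eq_bigr => k _; rewrite /tau_form !Xp !Yp.
  by rewrite !mul_scale !scalerA mulrBr -!scalerAr hD hN !hZ; ring.
under eq_bigr do rewrite sumrB.
rewrite sumrB; under [X in _ - X]eq_bigr do rewrite -mulr_sumr.
rewrite -[X in _ - X]mulr_sumr e0 mulr0 subr0.
by apply: eq_bigr => j _; rewrite scaler_sumr h_sum mulr_sumr.
Qed.

Lemma sum_tau_bottom c1 c2 :
    (forall i j, del (U_E q) (p i j) = c1 *: (star (y i) * x j)) ->
    (forall i j, del (U_F q) (p i j) = c2 *: (star (x i) * y j)) ->
  \sum_(i < n.+1) \sum_j \sum_k qpow (w n i) ^+ 2 * tau_form (p i j) (p j k) (p k i) =
  - Q^-1 * c1 * c2 / s ^+ 2.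
Proof.
move=> Xp Yp; rewrite -(trace_sum (f := fun i => (- Q^-1 * c1 * c2) *: p i i)) //.
apply: eq_bigr => i _; rewrite -[in RHS]collapse scaler_sumr h_sum mulr_sumr.
have e0 : \sum_j \sum_k h (p i j * (star (y j) * x k * (star (x k) * y i))) = 0.
  by under eq_bigr do rewrite -h_sum; rewrite -h_sum collapse0 h0.
transitivity (\sum_j \sum_k (qpow (w n i) ^+ 2 * h ((- Q^-1 * c1 * c2) *:
    (p i j * (star (x j) * y k * (star (y k) * x i)))) +
    qpow (w n i) ^+ 2 * Q * c1 * c2 *
      h (p i j * (star (y j) * x k * (star (x k) * y i))))).
  apply: eq_bigr => j _; apply: eq_bigr => k _; rewrite /tau_form !Xp !Yp.
  by rewrite !mul_scale !scalerA mulrBr -!scalerAr hD hN !hZ fmorphV; ring.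
under eq_bigr do rewrite big_split.
rewrite big_split /=; under [X in _ + X]eq_bigr do rewrite -mulr_sumr.
rewrite -[X in _ + X]mulr_sumr e0 mulr0 addr0.
by apply: eq_bigr => j _; rewrite scaler_sumr h_sum mulr_sumr.
Qed.
End Row.

Let del_p f (g : U) (k : C) n (e : 'I_n.+1) i j :
    (forall x y, del f (x * y) = del (U_K q) x * del f y + del f x * del (U_Ki q) y) ->
    del f (star (t n e i)) = k *: star (del g (t n e i)) ->
  del f (star (t n e i) * t n e j) = qpow (w n e) *:
    (star (t n e i) * del f (t n e j) + k *: (star (del g (t n e i)) * t n e j)).
Proof.
move=> fM fstar; have [Ks _ _ _] := star_del (t n e i).
rewrite fM fstar Ks !(del_Kit q_gt0 q_neq1 hdel) starZ conj_qpow scalerDr.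
by rewrite -!scalerAl -!scalerAr !scalerA [k * _]mulrC.
Qed.

Let Xp n (e : 'I_n.+1) i j : del (U_E q) (star (t n e i) * t n e j) = qpow (w n e) *:
  (star (t n e i) * del (U_E q) (t n e j) - Q^-1 *: (star (del (U_F q) (t n e i)) * t n e j)).
Proof. by rewrite -scaleNr; apply: del_p => //; have [] := star_del (t n e i). Qed.
Let Yp n (e : 'I_n.+1) i j : del (U_F q) (star (t n e i) * t n e j) = qpow (w n e) *:
  (star (t n e i) * del (U_F q) (t n e j) - Q *: (star (del (U_E q) (t n e i)) * t n e j)).
Proof. by rewrite -scaleNr; apply: del_p => //; have [] := star_del (t n e i). Qed.

(** The scalars in the entries of the projection cancel around the cycle
    i, j, k.  For N > 0 the row x is the last one and Y kills it, for N < 0 it is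
    the first one and X kills it; in both cases the product of the two remaining
    coefficients contains the square of alpha, which is the quantum number of
    the absolute value of N. *)
Lemma pairing_tau N :
  pairing (n := 1) (tau del h) (projection t sigma N)
    (rho_circ sigma `|N| (U_Ki q ^+ 2)) = (2 * qnum q N%:~R)%:C.
Proof.
pose e := extremal N; pose p i j := star (t `|N| e i) * t `|N| e j.
have -> : pairing (n := 1) (tau del h) (projection t sigma N)
    (rho_circ sigma `|N| (U_Ki q ^+ 2)) =
    - (2 * \sum_(i < `|N|.+1) \sum_j \sum_k
             qpow (w `|N| i) ^+ 2 * tau_form (p i j) (p j k) (p k i)).
  rewrite /pairing expr1 mulN1r mulNr; congr (- (_ * _)).
    by rewrite divr1.
  rewrite (@twisted_trace_diag _ _ _ tau_form _ _ _ (rho_Ki2 (n := _))).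
  apply: eq_bigr => i _; apply: eq_bigr => j _; apply: eq_bigr => k _.
  rewrite !projectionE tau_formZ -/e.
  congr (_ * _); rewrite -[RHS]mul1r; congr (_ * _); rewrite !qpowN //.
  have u0 := qpow_neq0 q_gt0 (w `|N| i); have u1 := qpow_neq0 q_gt0 (w `|N| j).
  by have u2 := qpow_neq0 q_gt0 (w `|N| k); field; rewrite u0 u1 u2.
rewrite /p /e {p e}; case: N => [[|m]|m].
- have [_ _ X1 Y1] := del_one q_gt0 q_neq1 ht hdel.
  rewrite !big_ord1 /extremal /= (ord1 ord_max) (pw_t0 ht) star1 mulr1 /tau_form X1 Y1.
  by rewrite !mulr0 !scaler0 subrr mulr0 h0 !mulr0 oppr0 qnum0 mulr0.
- have m2 : (m < m.+2)%N by [].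
  pose e' : 'I_m.+2 := Ordinal m2; have ee' : ord_max != e' by rewrite -val_eqE /= gtn_eqF.
  rewrite /extremal /=; set al := (alpha q m.+1 m)%:C.
  have Yx k : del (U_F q) (t m.+1 ord_max k) = 0.
    rewrite (del_Ft q_gt0 q_neq1 hdel) big1 // => i /eqP ik.
    by have := ltn_ord i; rewrite ik ltnn.
  have Xx k : del (U_E q) (t m.+1 ord_max k) = (- Q^-1 * al) *: t m.+1 e' k.
    by rewrite (del_Et q_gt0 q_neq1 hdel) (big_pred1 e') // => i; rewrite /= eqSS eq_sym.
  have conj_al : conjc (- Q^-1 * al) = - Q^-1 * al.
    by rewrite -fmorphV -rmorphN -rmorphM; apply: conj_real.
  have star0 : star 0 = 0 by rewrite -[0 in LHS](scale0r 1) starZ rmorph0 scale0r.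
  rewrite (sum_tau_top ee' (c1 := - (qpow (w m.+1 (@ord_max m.+1)) * Q^-1 * al))
    (c2 := qpow (w m.+1 (@ord_max m.+1)) * al)).
  + have s0 : qpow (w m.+1 (@ord_max m.+1)) != 0 by apply: qpow_neq0.
    have alE : al ^+ 2 = (qnum q m.+1%:R)%:C.
      rewrite /al -rmorphXn /= /alpha.
      rewrite (_ : _ - _ = 1); last by rewrite /weight -natr1; lra.
      rewrite (_ : _ + 1 = m.+1%:R); last by rewrite /weight -natr1; lra.
      by rewrite qnum1 // mul1r sqr_sqrtr // ltW // qnum_gt0 // ltr0n.
    rewrite rmorphM -pmulrn /= -alE.
    by field; rewrite s0 Q0.
  + move=> i j; rewrite Xp Yx star0 mul0r scaler0 subr0 Xx -scalerAr scalerA.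
    by congr (_ *: _); ring.
  + move=> i j; rewrite Yp Yx mulr0 Xx starZ conj_al -scalerAl.
    by rewrite sub0r -scaleNr !scalerA; congr (_ *: _); field.
rewrite /extremal /=.
have m2 : (1 < m.+2)%N by [].
pose e' : 'I_m.+2 := Ordinal m2; have ee' : ord0 != e' by [].
set al := (alpha q m.+1 0)%:C.
have Xx k : del (U_E q) (t m.+1 ord0 k) = 0.
  by rewrite (del_Et q_gt0 q_neq1 hdel) big1.
have Yx k : del (U_F q) (t m.+1 ord0 k) = (- Q * al) *: t m.+1 e' k.
  by rewrite (del_Ft q_gt0 q_neq1 hdel) (big_pred1 e').
have conj_al : conjc (- Q * al) = - Q * al.
  by rewrite -rmorphN -rmorphM; apply: conj_real.
have star0 : star 0 = 0 by rewrite -[0 in LHS](scale0r 1) starZ rmorph0 scale0r.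
rewrite (sum_tau_bottom ee' (c1 := qpow (w m.+1 (@ord0 m.+1)) * al)
  (c2 := - (qpow (w m.+1 (@ord0 m.+1)) * Q * al))).
- have s0 : qpow (w m.+1 (@ord0 m.+1)) != 0 by apply: qpow_neq0.
  have alE : al ^+ 2 = (qnum q m.+1%:R)%:C.
    rewrite /al -rmorphXn /= /alpha.
    rewrite (_ : _ - _ = m.+1%:R); last by rewrite /weight; lra.
    rewrite (_ : _ + 1 = 1); last by rewrite /weight; lra.
    by rewrite qnum1 // mulr1 sqr_sqrtr // ltW // qnum_gt0 // ltr0n.
  rewrite rmorphM NegzE mulrNz -pmulrn qnumN rmorphN /= -alE.
  by field; rewrite s0 Q0.
- move=> i j; rewrite Xp Xx mulr0 Yx starZ conj_al -scalerAl.
  by rewrite sub0r -scaleNr !scalerA; congr (_ *: _); field.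
- move=> i j; rewrite Yp Xx star0 mul0r scaler0 subr0 Yx -scalerAr scalerA.
  by congr (_ *: _); ring.
Qed.
End Pairing.

(** * The cohomology class *)

Section Assembly.
Variables (R : realType) (q : R).
Hypotheses (q_gt0 : 0 < q) (q_neq1 : q != 1).
Local Notation C := R[i].
Local Notation A := (SUq2 q).
Local Notation U := (Uqsu2 q).
Local Notation Q := (q%:C).
Variables (t : forall n, 'M[A]_n.+1) (ht : peter_weyl t).
Variables (h : A -> C) (hh : haar_state t h).
Variables (act del : U -> A -> A) (hact : left_action t act) (hdel : del_action t del).

Let theta := modular_aut act.
Let eps : A -> C := @SU_counit R q.
Let r := qpow q (1 / 2).

Let rr : r * r = Q. Proof. exact: qpow_half. Qed.
Let r0 : r != 0. Proof. exact: qpow_neq0. Qed.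
Let Q0 : Q != 0. Proof. by rewrite fmorph_eq0 lt0r_neq0. Qed.
Let QV : (q^-1)%:C = Q^-1. Proof. exact: fmorphV. Qed.
Let q1 : Q - Q^-1 != 0.
Proof. by rewrite -QV -rmorphB fmorph_eq0 qsub_neq0. Qed.
Let Q_tors n : (0 < n)%N -> Q ^+ n != 1.
Proof.
move=> n0; rewrite -rmorphXn fmorph_eq1 /= -powR_mulrn ?ltW // powR_eq1.
by rewrite (negPf q_neq1) ltNge ltW //= pnatr_eq0 -lt0n.
Qed.

Let epsL : scalar eps. Proof. by move=> c x y; rewrite /eps /SU_counit linearP. Qed.
Let epsM x y : eps (x * y) = eps x * eps y.
Proof. by rewrite /eps /SU_counit rmorphM. Qed.

Let actZ f c x : act f (c *: x) = c *: act f x.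
Proof. by have [_ _ ->] := linear_rules (actL hact f). Qed.

Let thetaE x : theta x = act (U_Ki q) (act (U_Ki q) x).
Proof. by rewrite /theta /modular_aut expr2 (actM hact). Qed.
Let thetaL : linear theta.
Proof. by move=> c x y; rewrite !thetaE !(actL hact). Qed.
Let thetaM x y : theta (x * y) = theta x * theta y.
Proof. by rewrite !thetaE !(act_KiM hact). Qed.
Let theta1 : theta 1 = 1.
Proof. by rewrite thetaE !(act_Ki1 q_gt0 q_neq1 ht hact). Qed.
Let theta_weight l x : l != 0 -> act (U_K q) x = l *: x -> theta x = (l * l)^-1 *: x.
Proof.
move=> l0 Kx; have Kix : act (U_Ki q) x = l^-1 *: x.
  by rewrite -{2}(act_KiK hact x) Kx actZ scalerA mulVf ?scale1r.
by rewrite thetaE Kix actZ Kix scalerA invfM.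
Qed.
Let thetaK x : del (U_K q) x = x -> del (U_K q) (theta x) = theta x.
Proof.
move=> Kx; rewrite thetaE -!(act_Ki_del_K q_gt0 q_neq1 ht hact hdel).
by rewrite Kx.
Qed.

Let g x := eps x - h x.
Let gL : scalar g.
Proof. by move=> c x y; rewrite /g epsL (haar_linear hh); ring. Qed.

Let g_const c : g (c *: 1) = 0.
Proof.
have eps1 : eps 1 = 1 by rewrite /eps /SU_counit rmorph1.
have h1 := haar1 ht hh.
have [g0 _ gZ] := linear_rules (gL : linear (g : A -> C^o)).
by rewrite gZ /g eps1 h1 subrr; apply: mulr0.
Qed.

(** G(m) is g at a preimage of m under del F.  This is well defined because the
    kernel of del F on the sphere consists of constants, where g vanishes. *)
Lemma lowering_functional : exists G : A -> C,
  [/\ forall l x y, del (U_K q) x = Q^-1 *: x -> del (U_K q) y = Q^-1 *: y ->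
        G (l *: x + y) = l * G x + G y,
      forall x, del (U_K q) x = x -> G (del (U_F q) x) = g x
    & forall x, del (U_K q) x = Q^-1 *: x -> G (act (U_K q) x) = G x].
Proof.
pose P x y := del (U_K q) y = y /\ del (U_F q) y = x.
pose G x := if pselect (exists y, P x y) is left e then g (projT1 (cid e)) else 0.
have YL := delL hdel (U_F q); have KL := delL hdel (U_K q).
have GY x : del (U_K q) x = x -> G (del (U_F q) x) = g x.
  move=> Kx; rewrite /G; case: pselect => [e|[]]; last by exists x.
  case: cid => y /= [Ky Yy].
  have Kyx : del (U_K q) (-1 *: x + y) = -1 *: x + y by rewrite KL Kx Ky.
  have Yyx : del (U_F q) (-1 *: x + y) = 0 by rewrite YL Yy scaleN1r addNr.
  have [c yxE] := del_F_kernel q_gt0 q_neq1 ht hdel Kyx Yyx.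
  have := gL (-1) x y; rewrite yxE g_const mulN1r => /esym/eqP.
  by rewrite addrC subr_eq0 => /eqP.
have onto := del_F_onto q_gt0 q_neq1 ht hdel.
exists G; split=> // [l x y /onto[u Ku <-] /onto[v Kv <-]|x /onto[u Ku <-]].
  by rewrite -YL !GY // ?gL // KL Ku Kv.
rewrite (act_K_del_F q_gt0 q_neq1 ht hact hdel) !GY //; last first.
  by rewrite -(act_K_del_K q_gt0 q_neq1 ht hact hdel) Ku.
rewrite /g (haar_act_K q_gt0 q_neq1 ht hh hact); congr (_ - _).
exact: (counit_act_K q_gt0 q_neq1 ht hact hdel).
Qed.

Let KL := delL hdel (U_K q).
Let KiL := delL hdel (U_Ki q).
Let XL := delL hdel (U_E q).
Let YL := delL hdel (U_F q).
Let KM := del_KM q_gt0 q_neq1 ht hact hdel.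
Let XM := del_EM q_gt0 q_neq1 ht hact hdel.
Let YM := del_FM q_gt0 q_neq1 ht hact hdel.
Let hL := haar_linear hh.

(* The counit is a character and is invariant under theta on the sphere. *)
Let eps_trace x y : del (U_K q) x = x -> del (U_K q) y = y ->
  eps (x * y) = eps (theta y * x).
Proof.
move=> _ Ky; rewrite !epsM mulrC; congr (_ * _); rewrite thetaE.
have KKi z : act (U_K q) (act (U_Ki q) z) = z.
  by rewrite -(actM hact) UKKiE (act1 hact).
have eps_Ki z : del (U_K q) z = z -> eps (act (U_Ki q) z) = eps z.
  move=> Kz; rewrite -{2}(KKi z); apply/esym/(counit_act_K q_gt0 q_neq1 ht hact hdel).
  by rewrite -(act_Ki_del_K q_gt0 q_neq1 ht hact hdel) Kz.
rewrite !eps_Ki // -(act_Ki_del_K q_gt0 q_neq1 ht hact hdel) Ky //.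
Qed.

Let haar_trace x y : del (U_K q) x = x -> del (U_K q) y = y ->
  h (x * y) = h (theta y * x).
Proof.
have [Ka Kb Kc Kd] := del_K_gens q_gt0 q_neq1 ht hdel.
have [Xa Xb Xc Xd] := del_E_gens q_gt0 q_neq1 ht hdel.
have [ka kb kc kd] := act_K_gens q_gt0 q_neq1 ht hact.
have [K1 _ _ _] := del_one q_gt0 q_neq1 ht hdel.
have r0V : r^-1 != 0 by rewrite invr_eq0.
have ta := theta_weight r0V ka; have tb := theta_weight r0 kb.
have tc := theta_weight r0V kc; have td := theta_weight r0 kd.
rewrite rr in tb td; rewrite -invfM rr invrK in ta tc.
apply: (haar_twisted_trace (lt0r_neq0 q_gt0) Q_tors rr KL KM K1 (act_KM hact)
  (act_K1 q_gt0 q_neq1 ht hact) Ka Kb Kc Kd ka kb kc kd thetaL (del_KiK hdel) KiL XM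
  Xb Xc Xd thetaM theta1 ta tb tc td thetaK hL
  (haar_del_E q_gt0 q_neq1 ht hh hdel) (haar_act_K q_gt0 q_neq1 ht hh hact)).
Qed.

Let sphereE : podles_sphere del = (fun x => del (U_K q) x = x).
Proof. by apply/funext => x; apply/propext/(podlesP q_gt0 q_neq1 ht hdel). Qed.

Let tauE : tau del h = (fun a : 'I_3 -> A =>
  area_cochain Q (del (U_E q)) (del (U_F q)) h (a 0) (a 1) (a 2)).
Proof. by rewrite /tau /area_cochain /area QV. Qed.

Lemma tau_cocycle : cyclic_cocycle (podles_sphere del) theta (tau del h).
Proof.
rewrite sphereE tauE.
exact: (area_cocycle Q0 XL YL KL KiL hL KM (del_KiK hdel) XM YM (del_K_E hdel)
  (del_K_F q_gt0 hdel) (del_EF hdel) (haar_del_E q_gt0 q_neq1 ht hh hdel)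
  (haar_del_F q_gt0 q_neq1 ht hh hdel) haar_trace).
Qed.

Let sphereM x y : podles_sphere del x -> podles_sphere del y -> podles_sphere del (x * y).
Proof. by rewrite sphereE KM => -> ->. Qed.

Lemma haar_cocycle :
  cyclic_cocycle (podles_sphere del) theta (periodicity0 (cochain0 h)).
Proof.
apply: periodicity_cocycle; [exact: sphereM|exact: hL|].
by rewrite sphereE => x y Kx Ky; exact: haar_trace Kx Ky.
Qed.

Lemma counit_cocycle :
  cyclic_cocycle (podles_sphere del) theta (periodicity0 (cochain0 (@SU_counit R q))).
Proof.
apply: periodicity_cocycle; [exact: sphereM|exact: epsL|].
by rewrite sphereE => x y Kx Ky; exact: eps_trace Kx Ky.
Qed.

Lemma tau_cohomologous : HC_eq (podles_sphere del) theta (tau del h)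
  (fun a => (2 / (q^-1 - q))%:C * (periodicity0 (cochain0 h) a
     - periodicity0 (cochain0 (@SU_counit R q)) a)).
Proof.
have [G [GL GY Gkr]] := lowering_functional.
have [Ka Kb Kc Kd] := del_K_gens q_gt0 q_neq1 ht hdel.
have [Xa Xb Xc Xd] := del_E_gens q_gt0 q_neq1 ht hdel.
have [Ya Yb Yc Yd] := del_F_gens q_gt0 q_neq1 ht hdel.
have [ka kb kc kd] := act_K_gens q_gt0 q_neq1 ht hact.
have [K1 _ _ _] := del_one q_gt0 q_neq1 ht hdel.
have r0V : r^-1 != 0 by rewrite invr_eq0.
have ta := theta_weight r0V ka; have tb := theta_weight r0 kb.
have tc := theta_weight r0V kc; have td := theta_weight r0 kd.
rewrite rr in tb td; rewrite -invfM rr invrK in ta tc.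
have gz n : g ((SU_b q * SU_c q) ^+ n.+1) = - h ((SU_b q * SU_c q) ^+ n.+1).
  have eb : eps (SU_b q) = 0 by rewrite /eps /SU_counit /SU_b plift_gen.
  by rewrite /g exprS epsM epsM eb !mul0r sub0r.
have gT x y : del (U_K q) x = x -> del (U_K q) y = y -> g (x * y) = g (theta y * x).
  by move=> Kx Ky; rewrite /g (eps_trace Kx Ky) (haar_trace Kx Ky).
have Gtheta x y : del (U_K q) x = x -> del (U_K q) y = Q^-1 *: y ->
    G (theta x * y) - G (y * x) = (Q ^+ 2 - 1) * h (del (U_E q) (theta x) * y).
  apply: (@lowered_functional_twisted R q (lt0r_neq0 q_gt0) Q_tors r rr (del (U_K q)) (act (U_K q))
    KL KM K1 (act_KM hact) (act_K1 q_gt0 q_neq1 ht hact) Ka Kb Kc Kd ka kb kc kd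
    (del (U_E q)) (del (U_F q)) theta (del (U_Ki q)) XL thetaL).
  - exact: del_KiK hdel.
  - exact: KiL.
  - exact: XM.
  - exact: YM.
  - exact: Xa.
  - exact: Xb.
  - exact: Xc.
  - exact: Xd.
  - exact: Yb.
  - exact: Yc.
  - exact: thetaM.
  - exact: theta1.
  - exact: ta.
  - exact: tb.
  - exact: tc.
  - exact: td.
  - exact: thetaK.
  - exact: hL.
  - exact: (haar_del_E q_gt0 q_neq1 ht hh hdel).
  - exact: (haar_act_K q_gt0 q_neq1 ht hh hact).
  - exact: gz.
  - exact: GL.
  - exact: GY.
  - exact: Gkr.
  - exact: del_K_E hdel.
  - exact: (act_K_del_E q_gt0 q_neq1 ht hact hdel).
have cE : (2 / (q^-1 - q))%:C = 2 / (Q^-1 - Q) :> C.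
  by rewrite rmorphM fmorphV rmorphB rmorph_nat fmorphV.
rewrite sphereE tauE cE.
exact: (area_cohomologous Q0 q1 XL YL KL KiL hL KM (del_KiK hdel) XM YM (del_K_E hdel)
  (del_K_F q_gt0 hdel) (del_EF hdel) (haar_del_E q_gt0 q_neq1 ht hh hdel)
  (haar_del_F q_gt0 q_neq1 ht hh hdel) thetaK haar_trace gT GL GY Gtheta epsL eps_trace).
Qed.
End Assembly.

Theorem proposition5p2 (R : realType) (q : R) (q_gt0 : 0 < q) (q_neq1 : q != 1)
    (t : forall n, 'M[SUq2 q]_n.+1) (ht : peter_weyl t)
    (h : SUq2 q -> R[i]) (hh : haar_state t h)
    (act del : Uqsu2 q -> SUq2 q -> SUq2 q)
    (hact : left_action t act) (hdel : del_action t del)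
    (sigma : forall n, Uqsu2 q -> 'M[R[i]]_n.+1)
    (hsigma : action_matrices t act sigma) :
  let B := podles_sphere del in
  let theta := modular_aut act in
  let Sh := periodicity0 (cochain0 h) in
  let Seps := periodicity0 (cochain0 (@SU_counit R q)) in
  [/\ cyclic_cocycle B theta (tau del h),
      forall N : int,
        let P := projection t sigma N in
        (forall i j, B (P i j)) /\
        pairing (n := 1) (tau del h) P (rho_circ sigma `|N| (U_Ki q ^+ 2))
          = (2 * qnum q N%:~R)%:C
    & [/\ cyclic_cocycle B theta Sh, cyclic_cocycle B theta Seps
        & HC_eq B theta (tau del h)
            (fun a => (2 / (q^-1 - q))%:C * (Sh a - Seps a))]].
Proof.
split; first exact: (tau_cocycle q_gt0 q_neq1 ht hh hact hdel).
  move=> N; split=> [i j|].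
    exact: (projection_sphere q_gt0 q_neq1 ht hh hact hdel hsigma).
  exact: (pairing_tau q_gt0 q_neq1 ht hh hact hdel hsigma).
split.
- exact: (haar_cocycle q_gt0 q_neq1 ht hh hact hdel).
- exact: (counit_cocycle q_gt0 q_neq1 ht hact hdel).
- exact: (tau_cohomologous q_gt0 q_neq1 ht hh hact hdel).
Qed.
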